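(* Let $(X^8,J,g,\omega,\Omega)$ be a Calabi--Yau 4-manifold (complex dimension 4) and let $L\to X$ be a smooth complex line bundle with a Hermitian metric $h$. Equip $X$ with the $\mathrm{Spin}(7)$-structure $$\Phi=\tfrac12\omega^2+\mathrm{Re}\,\Omega .$$ Let $\nabla$ be a Hermitian connection of $(L,h)$ such that the $(0,2)$-part $F_\nabla^{0,2}$ of its curvature $F_\nabla$ vanishes. Then $\mathcal{F}^2_{\mathrm{Spin}(7)}(\nabla)=0$. Moreover, $\nabla$ is a deformed Hermitian Yang--Mills connection with phase $1$, i.e. $\mathrm{Im}\,(\omega+F_\nabla)^4=0$, if and only if $\nabla$ is a $\mathrm{Spin}(7)$-dDT connection, i.e. $\mathcal{F}^1_{\mathrm{Spin}(7)}(\nabla)=0$.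
   Context: The curvature $F_\nabla$ of a Hermitian connection is regarded as a $\sqrt{-1}\,\mathbb{R}$-valued closed 2-form; powers are wedge powers. $J$ is the complex structure, $g$ the Kähler metric, $\omega$ the Kähler form, and $\Omega$ the holomorphic volume form, normalized so that $\Phi=\frac12\omega^2+\mathrm{Re}\,\Omega$ is a $\mathrm{Spin}(7)$-structure inducing $g$ and the orientation $\omega^4/4!$; equivalently $\omega^4/4!=\frac1{16}\Omega\wedge\overline\Omega$. $\mathrm{Spin}(7)$-structure: a 4-form $\Phi$ on an 8-manifold which at each point has the form $e^0\wedge\varphi_0+*_7\varphi_0$ for a positively oriented basis with dual basis $e^0,\dots,e^7$, where $\varphi_0=e^{123}+e^{145}+e^{167}+e^{246}-e^{257}-e^{347}-e^{356}$ and $*_7\varphi_0=e^{4567}+e^{2367}+e^{2345}+e^{1357}-e^{1346}-e^{1256}-e^{1247}$ (with $e^{ij\cdots}=e^i\wedge e^j\wedge\cdots$); it determines a metric (making $e^0,\dots,e^7$ orthonormal) and orientation. $*$ denotes the Hodge star on $X$. $\pi^k_\ell:\Omega^k\to\Omega^k_\ell$ is the orthogonal projection (extended complex linearly) onto the forms with values in the subbundle of $\Lambda^kT^*X$ corresponding to the $\ell$-dimensional irreducible $\mathrm{Spin}(7)$-representation; $\Lambda^2\cong W_7\oplus W_{21}$, $\Lambda^4\cong W_1\oplus W_7\oplus W_{27}\oplus W_{35}$. Explicitly $\pi^2_7(\alpha)=\frac14(\alpha+*(\Phi\wedge\alpha))$ and $\Lambda^4_7=\{e^0\wedge i(\alpha^\sharp)*_7\varphi_0-\alpha\wedge\varphi_0\mid\alpha\in\mathrm{span}(e^1,\dots,e^7)\}$,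 with $i(\cdot)$ the interior product and $\alpha^\sharp$ the metric dual. For a Hermitian connection $\nabla$ of $(L,h)$: $\mathcal{F}^1_{\mathrm{Spin}(7)}(\nabla)=\pi^2_7\big(F_\nabla+\frac16*F_\nabla^3\big)$ and $\mathcal{F}^2_{\mathrm{Spin}(7)}(\nabla)=\pi^4_7(F_\nabla^2)$. $\nabla$ is a $\mathrm{Spin}(7)$-dDT connection if both vanish. *)

(* Defs.v *)
From HB Require Import structures.
From mathcomp Require Import all_boot all_order all_algebra all_fingroup.
From mathcomp Require Import complex.
From mathcomp Require Import all_classical all_reals all_analysis.

Set Implicit Arguments.
Unset Strict Implicit.
Unset Printing Implicit Defensive.
Import Order.TTheory GRing.Theory Num.Theory.
Import numFieldNormedType.Exports.
Local Open Scope classical_set_scope.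
Local Open Scope ring_scope.

(** * Complex-valued exterior algebra of R^8 = C^4

    A complex-valued k-form is a function of k vectors, namely of the k rows
    of a matrix.  Pullback by a linear map is [fun m => a (m *m P)]. *)

Definition form (R : realType) (k : nat) : Type := 'M[R]_(k, 8) -> R[i].

(* The normalization for which a wedge product of 1-forms is a determinant:
   (t_1 /\ ... /\ t_k)(v_1, ..., v_k) = det (t_b (v_a)). *)
Definition wedge (R : realType) (p q : nat) (a : form R p) (b : form R q) :
    form R (p + q) :=
  fun m => ((p`! * q`!)%N%:R)^-1 *
    \sum_(s : 'S_(p + q)) (-1) ^+ s *
       (a (usubmx (row_perm s m)) * b (dsubmx (row_perm s m))).

Fixpoint wexp (R : realType) (k : nat) (a : form R k) (n : nat) :
    form R (n * k) :=
  match n with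
  | 0 => fun=> 1
  | n'.+1 => wedge a (@wexp R k a n')
  end.

Arguments wexp {R k} a n.

(* The interior product i(v)a. *)
Definition iprod (R : realType) (k : nat) (v : 'rV[R]_8) (a : form R k.+1) :
    form R k :=
  fun m => a (col_mx v m : 'M[R]_(1 + k, 8)).

Definition form_conj (R : realType) k (a : form R k) : form R k :=
  fun m => conjc (a m).

Definition form_Re (R : realType) k (a : form R k) : form R k :=
  fun m => (complex.Re (a m))%:C%C.

(* The standard complex structure of C^4: the real coordinates are
   (x_0, ..., x_3, y_0, ..., y_3) with z_j = x_j + i y_j, and vectors are rows,
   so that J v = v *m Jmx = (- y, x). *)
Definition Jmx (R : realType) : 'M[R]_8 :=
  (block_mx 0 1%:M (- 1%:M) 0 : 'M[R]_(4 + 4)).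

Definition zcoord (R : realType) (j : 'I_4) (v : 'rV[R]_8) : R[i] :=
  (v 0%R (lshift 4 j : 'I_8) +i* v 0%R (rshift 4 j : 'I_8))%C.

(* dz^0 /\ dz^1 /\ dz^2 /\ dz^3 *)
Definition dz4 (R : realType) : form R 4 :=
  fun m => \det (\matrix_(a < 4, j < 4) zcoord j (row a m)).

(* a^{0,2}(v, w) = a(v'', w''), where v'' = (v + i J v) / 2 is the
   (0,1)-component of v and a is extended complex bilinearly. *)
Definition part02 (R : realType) (a : form R 2) : form R 2 :=
  fun m =>
    let v := row 0%R m in
    let w := row 1%R m in
    let b (v' w' : 'rV[R]_8) := a (col_mx v' w' : 'M[R]_(1 + 1, 8)) in
    4%:R^-1 * (b v w + 'i%C * b (v *m Jmx R) w + 'i%C * b v (w *m Jmx R)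
               - b (v *m Jmx R) (w *m Jmx R)).

(** ** Metric, volume form and Hodge star; [G] is the Gram matrix *)

Definition gdot (R : realType) (G : 'M[R]_8) (v w : 'rV[R]_8) : R :=
  (v *m G *m w^T) 0%R 0%R.

(* Complex bilinear extension of the inner product on Lambda^k for which the
   e^{i_1 ... i_k}, i_1 < ... < i_k, are orthonormal if the e_i are:
   <a, b> = 1/k! g^{i_1 j_1} ... g^{i_k j_k} a_{i_1 ... i_k} b_{j_1 ... j_k}. *)
Definition form_dot (R : realType) (G : 'M[R]_8) k (a b : form R k) : R[i] :=
  (k`!%:R)^-1 *
  \sum_(i : {ffun 'I_k -> 'I_8}) \sum_(j : {ffun 'I_k -> 'I_8})
     (\prod_(c < k) invmx G (i c) (j c))%:C%C *
     (a (rowsub i 1%:M) * b (rowsub j 1%:M)).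

(* a /\ *b = <a, b> vol, i.e. *a is the contraction
   1/k! g^{i_1 j_1} ... g^{i_k j_k} a_{i_1 ... i_k} vol_{j_1 ... j_k ...}. *)
Definition star (R : realType) (G : 'M[R]_8) k l (vol : form R (k + l))
    (a : form R k) : form R l :=
  fun m => (k`!%:R)^-1 *
    \sum_(i : {ffun 'I_k -> 'I_8}) \sum_(j : {ffun 'I_k -> 'I_8})
       (\prod_(c < k) invmx G (i c) (j c))%:C%C *
       (a (rowsub i 1%:M) * vol (col_mx (rowsub j 1%:M) m)).

(** ** The bundle Lambda^4_7 of a Spin(7)-structure

    [E] is a basis, whose rows are e_0, ..., e_7. *)

Definition coframe (R : realType) (E : 'M[R]_8) (i : nat) : form R 1 :=
  fun v => ((v *m invmx E) 0%R (inord i : 'I_8))%:C%C.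

Definition emono (R : realType) (E : 'M[R]_8) (s : seq nat) :
    form R (size s) :=
  fun m => \det (\matrix_(a < size s, b < size s)
                    coframe E (nth 0%N s b) (row a m)).

Arguments emono {R} E s.

Definition phi0 (R : realType) (E : 'M[R]_8) : form R 3 :=
  fun m => emono E [:: 1; 2; 3]%N m + emono E [:: 1; 4; 5]%N m
    + emono E [:: 1; 6; 7]%N m + emono E [:: 2; 4; 6]%N m
    - emono E [:: 2; 5; 7]%N m - emono E [:: 3; 4; 7]%N m
    - emono E [:: 3; 5; 6]%N m.

Definition star7_phi0 (R : realType) (E : 'M[R]_8) : form R 4 :=
  fun m => emono E [:: 4; 5; 6; 7]%N m + emono E [:: 2; 3; 6; 7]%N m
    + emono E [:: 2; 3; 4; 5]%N m + emono E [:: 1; 3; 5; 7]%N m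
    - emono E [:: 1; 3; 4; 6]%N m - emono E [:: 1; 2; 5; 6]%N m
    - emono E [:: 1; 2; 4; 7]%N m.

Definition spin7_form (R : realType) (E : 'M[R]_8) : form R 4 :=
  (wedge (coframe E 0) (phi0 E) : form R 4) + star7_phi0 E.

(* [E] is a positively oriented orthonormal basis in which [Phi] has the
   standard expression e^0 /\ phi_0 + *_7 phi_0. *)
Definition adapted (R : realType) (G : 'M[R]_8) (vol : form R 8)
    (Phi : form R 4) (E : 'M[R]_8) : Prop :=
  [/\ E *m G *m E^T = 1%:M, 0 < vol E & Phi = spin7_form E].

(* e^0 /\ i(v) *_7 phi_0 - v^flat /\ phi_0 *)
Definition lambda47_elt (R : realType) (G E : 'M[R]_8) (v : 'rV[R]_8) :
    form R 4 :=
  (wedge (coframe E 0) (iprod v (star7_phi0 E)) : form R 4)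
  - (wedge (fun w : 'M[R]_(1, 8) => (gdot G v w)%:C%C) (phi0 E) : form R 4).

(* The condition on v says that v lies in the span of e_1, ..., e_7.  The
   subspace does not depend on the choice of the adapted basis [E]. *)
Definition Lambda47 (R : realType) (G : 'M[R]_8) (vol : form R 8)
    (Phi : form R 4) : set (form R 4) :=
  [set a | exists E v, [/\ adapted G vol Phi E, coframe E 0 v = 0
                         & a = lambda47_elt G E v]].

(* [p] is the orthogonal projection of [b] onto the complexification of the
   space [W] of real forms. *)
Definition is_orth_proj (R : realType) (G : 'M[R]_8) k (W : set (form R k))
    (b p : form R k) : Prop :=
  (exists w1 w2, [/\ W w1, W w2 & p = fun m => w1 m + 'i%C * w2 m]) /\
  (forall w, W w -> form_dot G (b - p) w = 0).

(* The default value, taken if there were no projection, is [b] itself. *)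
Definition pi47 (R : realType) (G : 'M[R]_8) (vol : form R 8)
    (Phi : form R 4) (b : form R 4) : form R 4 :=
  xget b [set p | is_orth_proj G (Lambda47 G vol Phi) b p].

Definition pi27 (R : realType) (G : 'M[R]_8) (vol : form R 8)
    (Phi : form R 4) (a : form R 2) : form R 2 :=
  fun m => 4%:R^-1 *
    (a m + @star R G 6 2 vol (wedge Phi a : form R 6) m).

(** * Smooth and holomorphic maps on open subsets of R^8 = C^4 *)

(* Class C^oo on the open set U: all iterated directional derivatives exist
   and are Frechet differentiable. *)
Definition smooth_on (R : realType) (W : normedModType R)
    (U : set 'rV[R]_8) (f : 'rV[R]_8 -> W) : Prop :=
  forall (vs : seq 'rV[R]_8) (u : 'rV[R]_8), U u ->
    differentiable
      (foldr (fun v (g : 'rV[R]_8 -> W) (w : 'rV[R]_8) => 'D_v g w) f vs) u.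

Definition Csmooth_on (R : realType) (U : set 'rV[R]_8)
    (f : 'rV[R]_8 -> R[i]) : Prop :=
  smooth_on U (fun u => complex.Re (f u) : R^o) /\
  smooth_on U (fun u => complex.Im (f u) : R^o).

Definition CD (R : realType) (f : 'rV[R]_8 -> R[i]) (u v : 'rV[R]_8) : R[i] :=
  ('D_v (fun w => complex.Re (f w) : R^o) u +i*
   'D_v (fun w => complex.Im (f w) : R^o) u)%C.

Definition holo_map_on (R : realType) (U : set 'rV[R]_8)
    (f : 'rV[R]_8 -> 'rV[R]_8) : Prop :=
  smooth_on U f /\
  forall u, U u -> forall v, 'D_(v *m Jmx R) f u = 'D_v f u *m Jmx R.

Definition holo_fun_on (R : realType) (U : set 'rV[R]_8)
    (f : 'rV[R]_8 -> R[i]) : Prop :=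
  Csmooth_on U f /\
  forall u, U u -> forall v, CD f u (v *m Jmx R) = 'i%C * CD f u v.

(** * Complex manifolds of complex dimension 4 *)

Record chart (R : realType) (X : topologicalType) := Chart {
  cdom : set X;
  cfun :> X -> 'rV[R]_8;
  cinv : 'rV[R]_8 -> X;
  cdom_open : open cdom;
  cimg_open : open (cfun @` cdom);
  cfunK : forall x, cdom x -> cinv (cfun x) = x;
  cfun_continuous : {within cdom, continuous cfun};
  cinv_continuous : {within cfun @` cdom, continuous cinv}
}.

Definition cimg (R : realType) (X : topologicalType) (c : chart R X) :
  set 'rV[R]_8 := c @` cdom c.

(* [chart_at x] is a chart around x, used to identify T_x X with R^8 = C^4.
   As the transition maps are holomorphic, the complex structure J of T_x X is
   [Jmx] under this identification, and in every other chart. *)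
Record complex_manifold4 (R : realType) := ComplexManifold4 {
  cm_space :> topologicalType;
  cm_hausdorff : hausdorff_space cm_space;
  cm_second_countable : @second_countable cm_space;
  atlas : set (chart R cm_space);
  chart_at : cm_space -> chart R cm_space;
  chart_at_atlas : forall x, atlas (chart_at x);
  chart_at_dom : forall x, cdom (chart_at x) x;
  cm_transition : forall c c', atlas c -> atlas c' ->
    holo_map_on (cimg c `&` cinv c @^-1` cdom c') (fun u => c' (cinv c u))
}.

(* The identification of R^8, as tangent space at u in the chart c, with the
   tangent space at [cinv c u]. *)
Definition tangent_change (R : realType) (X : complex_manifold4 R)
    (c : chart R X) (u : 'rV[R]_8) : 'M[R]_8 :=
  jacobian (fun w => chart_at (cinv c u) (cinv c w)) u.

(* A field of k-forms on X is a function [a : X -> form R k], [a x] being a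
   form on T_x X; this is its expression in the chart [c]. *)
Definition local_form (R : realType) (X : complex_manifold4 R) k
    (a : X -> form R k) (c : chart R X) (u : 'rV[R]_8) : form R k :=
  fun m => a (cinv c u) (m *m tangent_change c u).

Definition smooth_fun (R : realType) (X : complex_manifold4 R) (W : set X)
    (f : X -> R[i]) : Prop :=
  forall c, atlas c ->
    Csmooth_on (cimg c `&` cinv c @^-1` W) (fun u => f (cinv c u)).

Definition smooth_form (R : realType) (X : complex_manifold4 R) (W : set X) k
    (a : X -> form R k) : Prop :=
  forall c, atlas c -> forall m,
    Csmooth_on (cimg c `&` cinv c @^-1` W) (fun u => local_form a c u m).

Definition dfun (R : realType) (X : complex_manifold4 R) (f : X -> R[i])
    (x : X) (v : 'rV[R]_8) : R[i] :=
  CD (fun u => f (cinv (chart_at x) u)) (chart_at x x) v.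

(* Exterior derivative, computed in the chart at x:
   (db)(v_0, ..., v_k) = \sum_i (-1)^i D_{v_i} (b (v_0, .., v_i omitted, ..)). *)
Definition extd (R : realType) (X : complex_manifold4 R) k
    (a : X -> form R k) (x : X) : form R k.+1 :=
  fun m => \sum_(i < k.+1) (-1) ^+ i *
    CD (fun u => local_form a (chart_at x) u (row' i m))
       (chart_at x x) (row i m).

(** * Calabi-Yau 4-manifolds *)

(* omega = g(J -, -) *)
Definition kahler_form (R : realType) (G : 'M[R]_8) : form R 2 :=
  fun m => (gdot G (row 0%R m *m Jmx R) (row 1%R m))%:C%C.

(* omega^4 / 4!, the volume form of g for the complex orientation *)
Definition kahler_vol (R : realType) (G : 'M[R]_8) : form R 8 :=
  fun m => (4`!%:R)^-1 * wexp (kahler_form G) 4 m.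

Record calabi_yau4 (R : realType) := CalabiYau4 {
  cy_mfd :> complex_manifold4 R;
  cy_metric : cy_mfd -> 'M[R]_8;
  cy_metric_sym : forall x, (cy_metric x)^T = cy_metric x;
  cy_metric_pos : forall x v, v != 0 -> 0 < gdot (cy_metric x) v v;
  cy_metric_smooth : forall c, atlas c -> forall v w,
    smooth_on (cimg c)
      (fun u => gdot (cy_metric (cinv c u)) (v *m tangent_change c u)
                     (w *m tangent_change c u) : R^o);
  cy_metric_J : forall x v w,
    gdot (cy_metric x) (v *m Jmx R) (w *m Jmx R) = gdot (cy_metric x) v w;
  cy_kahler : forall x, extd (fun y => kahler_form (cy_metric y)) x = 0;
  cy_Omega : cy_mfd -> form R 4;
  cy_Omega_holo : forall c, atlas c ->
    exists f : 'rV[R]_8 -> R[i],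
      [/\ holo_fun_on (cimg c) f,
          forall u, cimg c u -> f u != 0
        & forall u, cimg c u ->
            local_form cy_Omega c u = fun m => f u * dz4 m];
  cy_normalized : forall x,
    kahler_vol (cy_metric x) =
    fun m => 16%:R^-1 *
      (wedge (cy_Omega x) (form_conj (cy_Omega x)) : form R 8) m
}.

Definition cy_omega (R : realType) (X : calabi_yau4 R) (x : X) : form R 2 :=
  kahler_form (cy_metric x).

Definition cy_vol (R : realType) (X : calabi_yau4 R) (x : X) : form R 8 :=
  kahler_vol (cy_metric x).

Definition cy_Phi (R : realType) (X : calabi_yau4 R) (x : X) : form R 4 :=
  fun m => 2%:R^-1 * wexp (cy_omega x) 2 m + form_Re (cy_Omega x) m.

(** * Hermitian line bundles and connections *)

(* Over the open set [ldom a] the bundle is trivialized by the nowhere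
   vanishing section [lframe a]; [lcoef a x s] is the coefficient of s. *)
Record line_bundle (R : realType) (X : complex_manifold4 R) := LineBundle {
  fiber :> X -> lmodType R[i];
  lidx : Type;
  ldom : lidx -> set X;
  lframe : lidx -> forall x, fiber x;
  lcoef : lidx -> forall x, fiber x -> R[i];
  ldom_open : forall a, open (ldom a);
  triv_at : X -> lidx;
  triv_at_dom : forall x, ldom (triv_at x) x;
  lframeK : forall a x, ldom a x -> forall s, lcoef a s *: lframe a x = s;
  lcoefK : forall a x, ldom a x -> forall z, lcoef a (z *: lframe a x) = z;
  ltransition : forall a b,
    smooth_fun (ldom a `&` ldom b) (fun x => lcoef b (lframe a x))
}.

Definition smooth_section (R : realType) (X : complex_manifold4 R)
    (L : line_bundle X) (W : set X) (s : forall x, L x) : Prop :=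
  forall a, smooth_fun (W `&` ldom a) (fun x => lcoef a (s x)).

Definition section_smooth_at (R : realType) (X : complex_manifold4 R)
    (L : line_bundle X) (s : forall x, L x) (x : X) : Prop :=
  exists W : set X, [/\ open W, W x & smooth_section W s].

Definition fun_smooth_at (R : realType) (X : complex_manifold4 R)
    (f : X -> R[i]) (x : X) : Prop :=
  exists W : set X, [/\ open W, W x & smooth_fun W f].

Record hermitian_metric (R : realType) (X : complex_manifold4 R)
    (L : line_bundle X) := HermitianMetric {
  hdot :> forall x, L x -> L x -> R[i];
  hdot_linear : forall x (z : R[i]) (s s' t : L x),
    hdot (z *: s + s') t = z * hdot s t + hdot s' t;
  hdot_sym : forall x (s t : L x), hdot t s = conjc (hdot s t);
  hdot_pos : forall x (s : L x), s != 0 -> 0 < hdot s s;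
  hdot_smooth : forall a : lidx L,
    smooth_fun (ldom a) (fun x => hdot (lframe a x) (lframe a x))
}.

(* [cov s x v] is the covariant derivative at x in the direction v of the
   section s; it is only meaningful if s is smooth near x. *)
Record connection (R : realType) (X : complex_manifold4 R)
    (L : line_bundle X) := Connection {
  cov :> (forall x, L x) -> forall x : X, 'rV[R]_8 -> L x;
  cov_local : forall s t x,
    section_smooth_at s x -> (\forall y \near x, s y = t y) ->
    cov s x = cov t x;
  cov_linear : forall s x, section_smooth_at s x ->
    forall (r : R) (v w : 'rV[R]_8),
    cov s x (r *: v + w) = r%:C%C *: cov s x v + cov s x w;
  cov_add : forall s t x, section_smooth_at s x -> section_smooth_at t x ->
    forall v, cov (fun y => s y + t y) x v = cov s x v + cov t x v;
  cov_leibniz : forall f s x, fun_smooth_at f x -> section_smooth_at s x ->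
    forall v, cov (fun y => f y *: s y) x v =
              dfun f x v *: s x + f x *: cov s x v;
  cov_smooth : forall a : lidx L,
    @smooth_form R X (ldom a) 1 (fun x v => lcoef a (cov (lframe a) x v))
}.

Definition hermitian_connection (R : realType) (X : complex_manifold4 R)
    (L : line_bundle X) (h : hermitian_metric L) (D : connection L) : Prop :=
  forall s t x, section_smooth_at s x -> section_smooth_at t x ->
  forall v, dfun (fun y => h y (s y) (t y)) x v =
            h x (D s x v) (t x) + h x (s x) (D t x v).

(* The connection form A of the a-th trivialization: D e_a = A (x) e_a. *)
Definition connection_form (R : realType) (X : complex_manifold4 R)
    (L : line_bundle X) (D : connection L) (a : lidx L) (x : X) : form R 1 :=
  fun v => lcoef a (D (lframe a) x v).

(* F = dA in any local trivialization *)
Definition curvature (R : realType) (X : complex_manifold4 R)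
    (L : line_bundle X) (D : connection L) (x : X) : form R 2 :=
  extd (connection_form D (triv_at L x)) x.

(** * dHYM and Spin(7)-dDT connections *)

Definition F1_spin7 (R : realType) (X : calabi_yau4 R) (L : line_bundle X)
    (D : connection L) (x : X) : form R 2 :=
  let F := curvature D x in
  pi27 (cy_metric x) (cy_vol x) (cy_Phi x)
    (fun m => F m + 6%:R^-1 *
       @star R (cy_metric x) 6 2 (cy_vol x) (wexp F 3) m).

Definition F2_spin7 (R : realType) (X : calabi_yau4 R) (L : line_bundle X)
    (D : connection L) (x : X) : form R 4 :=
  pi47 (cy_metric x) (cy_vol x) (cy_Phi x) (wexp (curvature D x) 2).

Definition spin7_dDT (R : realType) (X : calabi_yau4 R) (L : line_bundle X)
    (D : connection L) : Prop :=
  (forall x, F1_spin7 D x = 0) /\ (forall x, F2_spin7 D x = 0).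

(* The phase 1 condition Im (omega + F)^4 = 0 *)
Definition dHYM (R : realType) (X : calabi_yau4 R) (L : line_bundle X)
    (D : connection L) : Prop :=
  forall x m, complex.Im (wexp (cy_omega x + curvature D x) 4 m) = 0.

(* Main.v *)
(** Since F is imaginary with F^{0,2} = 0, its coefficient matrix commutes
    with J, and simultaneous diagonalization of Hermitian forms yields at each
    point a unitary frame in which omega = sum_j dx_j /\ dy_j,
    Omega = dz^0 /\ ... /\ dz^3 and F = sum_j u_j dx_j /\ dy_j with u_j
    imaginary.

    There *F^3/6 = sum_j (prod_{i != j} u_i) dx_j /\ dy_j, and pi^2_7 maps
    sum_j a_j dx_j /\ dy_j to (sum_j a_j) omega / 4.  Hence F^1 vanishes iff
    sum_j (u_j + prod_{i != j} u_i) = 0; this sum is i times the imaginary part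
    of prod_j (1 + u_j), which is the coefficient of (omega + F)^4 / 4!.

    The elements of Lambda^4_7 are the forms T.Phi, where T runs through certain
    skew endomorphisms acting as derivations.  As F^2 only involves the 4-planes
    spanned by x_a, y_a, x_b, y_b with a != b, and T.Phi vanishes on these for
    every skew T, F^2 is orthogonal to Lambda^4_7. *)
From Pilot Require Import Defs.
From HB Require Import structures.
From mathcomp Require Import all_boot all_order all_algebra all_fingroup.
From mathcomp Require Import complex.
From mathcomp Require Import all_classical all_reals all_analysis.
From mathcomp Require Import ring lra zify.
(* Otherwise [form] is the one of mathcomp. *)
Import Pilot.Defs.
Import Order.TTheory GRing.Theory Num.Theory.
Import numFieldNormedType.Exports.
Local Open Scope ring_scope.
Set Implicit Arguments.
Unset Strict Implicit.
Unset Printing Implicit Defensive.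

(** * Decomposable forms *)

(** The wedge sums over all permutations and the star over all index tuples, so neither can be
    evaluated entry by entry. Everything is reduced to decomposable forms: there the wedge
    concatenates lists of covectors, and the star fills slots of a determinant.

    That F is imaginary needs an argument: the local frame of L need not have constant length, so
    the real part of the connection form need not vanish. It is only closed, which rests on the
    symmetry of second derivatives.

    Diagonalization alone fixes Omega up to a factor. A phase rotation makes the factor positive,
    and the normalization of Omega makes it 1.

    Elements of Lambda^4_7 are given in adapted bases unrelated to the unitary frame. An orthogonal
    change of basis keeps T skew and Phi is the same form, so a statement about all skew T suffices.
    T.Phi vanishes on x_a, y_a, x_b, y_b because replacing one vector breaks a pair that omega^2
    needs, while Re Omega vanishes on the pair left intact.

    The projection [pi47] is a chosen element, so its vanishing needs uniqueness of the projection
    as well as the fact that 0 is one. *)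

Lemma card_perm_stable (T : finType) (A : {set T}) :
  #|[pred s : {perm T} | [forall x, (s x \in A) == (x \in A)]]| =
  ((#|A|)`! * (#|~: A|)`!)%N.
Proof.
(* The stable permutations form the product of the symmetric groups of [A] and of its complement,
   and these two subgroups meet trivially. *)
rewrite -!card_Sym -TI_cardMg; last first.
  apply/setP => s; rewrite !inE; apply/andP/eqP => [[sA sAC]|->]; last first.
    by rewrite !perm_on1.
  apply/permP => x; rewrite perm1.
  have [xA|xA] := boolP (x \in A).
    by apply: (out_perm sAC); rewrite inE xA.
  exact: (out_perm sA).
apply: eq_card => s; rewrite inE; apply/forallP/mulsgP => [sA|].
  have sN (B : {set T}) : (forall x, (s x \in B) = (x \in B)) ->
      s \in ('N(B | 'P))%g.
    by move=> sB; apply/astabsP => x; apply: sB.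
  have sNA := sN A (fun x => eqP (sA x)).
  have sNC : s \in ('N(~: A | 'P))%g.
    by apply: sN => x; rewrite !inE (eqP (sA x)).
  exists (restr_perm A s) (restr_perm (~: A) s);
    rewrite ?inE ?restr_perm_on //.
  apply/permP => x; rewrite permM.
  have [xA|xA] := boolP (x \in A).
    rewrite (restr_permE sNA xA) (out_perm (restr_perm_on _ _)) //.
    by rewrite inE (eqP (sA x)) xA.
  rewrite (out_perm (restr_perm_on A s) xA) (restr_permE sNC) //.
  by rewrite inE.
move=> [t u]; rewrite !inE => tA uA -> x; rewrite permM.
have uA' y : (u y \in A) = (y \in A).
  by have := perm_closed y uA; rewrite !inE => /(congr1 negb); rewrite !negbK.
by rewrite uA' (perm_closed _ tA).
Qed.

Definition same_side (p q : nat) (i j : 'I_(p + q)) := (i < p)%N == (j < p)%N.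

(** The product of the two minors is the determinant of a block diagonal matrix, hence a sum over
    permutations [t] preserving the two blocks. For each such [t] the sum over [s] is the whole
    determinant, and there are p! q! of them. *)
Lemma laplace_blocks (C : comNzRingType) (p q : nat) (M : 'M[C]_(p + q)) :
  \sum_(s : 'S_(p + q)) (-1) ^+ s *
    (\det (ulsubmx (row_perm s M)) * \det (drsubmx (row_perm s M))) =
  (p`! * q`!)%N%:R * \det M.
Proof.
transitivity (\sum_(s : 'S_(p + q)) (-1) ^+ s *
   \sum_(t : 'S_(p + q)) (-1) ^+ t *
     \prod_i (M (s i) (t i) *+ same_side i (t i))).
  apply: eq_bigr => s _; congr (_ * _).
  rewrite -(det_ublock _ 0) -[LHS]/(\sum_t _).
  apply: eq_bigr => t _; congr (_ * _); apply: eq_bigr => i _.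
  set j := t i; rewrite /same_side.
  case: (split_ordP i) => i' ->; case: (split_ordP j) => j' ->;
    rewrite ?block_mxEul ?block_mxEur ?block_mxEdl ?block_mxEdr !mxE /=
      ?ltn_ord ?(ltnNge (p + _)) ?leq_addr //=;
    by congr (M _ _); apply/val_inj.
under eq_bigr => s _ do rewrite big_distrr /=.
rewrite exchange_big /=.
transitivity (\sum_(t : 'S_(p + q) | [forall i, same_side i (t i)]) \det M).
  rewrite [RHS]big_mkcond; apply: eq_bigr => t _; case: ifPn => [/forallP ht|].
    transitivity ((-1) ^+ t * \det (row_perm t M^T)).
      rewrite /determinant big_distrr /=; apply: eq_bigr => s _.
      rewrite mulrCA; congr (_ * (_ * _)); apply: eq_bigr => i _.
      by rewrite ht !mxE mulr1n.
    by rewrite row_permE det_mulmx det_perm det_tr mulrA -signr_addb addbb mul1r.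
  rewrite negb_forall => /existsP[i hi]; apply: big1 => s _.
  by rewrite (bigD1 i) //= (negbTE hi) mulr0n mul0r !mulr0.
rewrite sumr_const -[LHS]mulr_natl; congr (_%:R * _).
pose A := [set i : 'I_(p + q) | (i < p)%N].
have cA : #|A| = p.
  rewrite -sum1_card big_mkcond big_split_ord /=.
  rewrite (eq_bigr (fun=> 1%N)) => [|i _]; last by rewrite inE /= ltn_ord.
  rewrite sum_nat_const card_ord muln1 [X in (_ + X)%N]big1 ?addn0 // => i _.
  by rewrite inE /= ltnNge leq_addr.
have cAC : #|~: A| = q.
  by have := cardsC A; rewrite cA card_ord => /addnI.
have := card_perm_stable A; rewrite cA cAC => <-; apply: eq_card => s.
rewrite !inE; apply: eq_forallb => x.
by rewrite !inE eq_sym.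
Qed.

Section Forms.
Variable R : realType.
Local Notation C := R[i].

Definition cmx m n (A : 'M[R]_(m, n)) : 'M[C]_(m, n) :=
  map_mx (real_complex R) A.

(* The k-form l_0 /\ ... /\ l_(k-1), the columns l_b being covectors. *)
Definition dform k (l : seq 'cV[C]_8) : form R k :=
  fun m => \det (\matrix_(a < k, b < k) (cmx m *m nth 0 l b) a 0).

Arguments dform : clear implicits.

(** The factor p! q! of [laplace_blocks] is exactly the one divided out in [wedge]. *)
Lemma wedge_dform p q l1 l2 : size l1 = p ->
  wedge (dform p l1) (dform q l2) = dform (p + q) (l1 ++ l2).
Proof.
move=> sl; apply/funext => m; rewrite /wedge /dform.
set M := \matrix_(a, b) _.
apply: (canLR (mulKf _)); first by rewrite pnatr_eq0 -lt0n muln_gt0 !fact_gt0.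
rewrite -laplace_blocks; apply: eq_bigr => s _; congr (_ * (_ * _)).
  congr (\det _); apply/matrixP => a b; rewrite !mxE nth_cat sl /= ltn_ord.
  by apply: eq_bigr => c _; rewrite !mxE.
congr (\det _); apply/matrixP => a b; rewrite !mxE nth_cat sl /= ltnNge leq_addr /= addKn.
by apply: eq_bigr => c _; rewrite !mxE.
Qed.

Definition alternating k (a : form R k) :=
  forall (s : 'S_k) m, a (row_perm s m) = (-1) ^+ s * a m.

Lemma wedge_alternating p q (a : form R p) (b : form R q) :
  alternating (wedge a b).
Proof.
move=> t m; rewrite /wedge mulrCA; congr (_ * _).
rewrite (reindex_inj (mulIg t^-1)%g) big_distrr /=; apply: eq_bigr => s _.
rewrite -row_permM mulgKV odd_permM odd_permV signr_addb.
by rewrite -!mulrA mulrCA.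
Qed.

Definition pullback k (P : 'M[R]_8) (a : form R k) : form R k :=
  fun m => a (m *m P).

Lemma pullback_wedge p q P (a : form R p) (b : form R q) :
  pullback P (wedge a b) = wedge (pullback P a) (pullback P b).
Proof.
apply/funext => m; congr (_ * _); apply: eq_bigr => s _.
by rewrite /pullback !row_permE mulmxA -mul_usub_mx -mul_dsub_mx.
Qed.

Lemma pullback_wexp k P (a : form R k) n :
  pullback P (wexp a n) = wexp (pullback P a) n.
Proof. by elim: n => //= n IHn; rewrite pullback_wedge IHn. Qed.

Lemma wedge_suml p q (I : Type) (r : seq I) (Q : pred I) (c : I -> C)
    (a : I -> form R p) (b : form R q) :
  wedge (fun m => \sum_(i <- r | Q i) c i * a i m) b =
  fun m => \sum_(i <- r | Q i) c i * wedge (a i) b m.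
Proof.
apply/funext => m; rewrite /wedge.
under [RHS]eq_bigr => i _ do rewrite mulrCA big_distrr.
rewrite -big_distrr exchange_big /=; congr (_ * _); apply: eq_bigr => s _.
rewrite big_distrl big_distrr /=; apply: eq_bigr => i _.
by rewrite [RHS]mulrCA !mulrA.
Qed.

Lemma wedge_sumr p q (I : Type) (r : seq I) (Q : pred I) (c : I -> C)
    (a : form R p) (b : I -> form R q) :
  wedge a (fun m => \sum_(i <- r | Q i) c i * b i m) =
  fun m => \sum_(i <- r | Q i) c i * wedge a (b i) m.
Proof.
apply/funext => m; rewrite /wedge.
under [RHS]eq_bigr => i _ do rewrite mulrCA big_distrr.
rewrite -big_distrr exchange_big /=; congr (_ * _); apply: eq_bigr => s _.
rewrite !big_distrr /=; apply: eq_bigr => i _.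
by rewrite [RHS]mulrCA; congr (_ * _); rewrite mulrCA.
Qed.

(** Both sides are the derivative of the determinant at [N] in the direction [N'], the sum of the
    entries of [N'] times the cofactors of [N]. It lets a derivation pass from vectors (rows) to
    covectors (columns). *)
Lemma det_replace (k : nat) (N N' : 'M[C]_k) :
  \sum_c \det (\matrix_(a, b) (if a == c then N' a b else N a b)) =
  \sum_c \det (\matrix_(a, b) (if b == c then N' a b else N a b)).
Proof.
transitivity (\sum_c \sum_b N' c b * cofactor N c b).
  apply: eq_bigr => c _; rewrite (expand_det_row _ c); apply: eq_bigr => b _.
  rewrite mxE eqxx; congr (_ * (_ * \det _)).
  by apply/matrixP => i j; rewrite !mxE eq_sym (negbTE (neq_lift _ _)).
rewrite exchange_big; apply: eq_bigr => c _.
rewrite (expand_det_col _ c); apply: eq_bigr => b _.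
rewrite mxE eqxx; congr (_ * (_ * \det _)).
by apply/matrixP => i j; rewrite !mxE eq_sym (negbTE (neq_lift _ _)).
Qed.

Lemma dform_dup k l (i j : 'I_k) : i != j -> nth 0 l i = nth 0 l j ->
  dform k l = fun=> 0.
Proof.
move=> ij lij; apply/funext => m; rewrite /dform -det_tr.
by apply: (determinant_alternate ij) => b; rewrite !mxE lij.
Qed.

Lemma dform_perm k l l' (s : 'S_k) :
  (forall i : 'I_k, nth 0 l' i = nth 0 l (s i)) ->
  dform k l' = fun m => (-1) ^+ s * dform k l m.
Proof.
move=> ll'; apply/funext => m; rewrite /dform -det_tr -[in RHS]det_tr.
rewrite -det_perm -det_mulmx -row_permE; congr (\det _).
by apply/matrixP => a b; rewrite !mxE ll'.
Qed.

Lemma dform_lin k (l1 l2 : seq ('cV[C]_8)) (c d : C) (x y : 'cV[C]_8) : (size l1 < k)%N ->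
  dform k (l1 ++ (c *: x + d *: y) :: l2) =
  fun m => c * dform k (l1 ++ x :: l2) m + d * dform k (l1 ++ y :: l2) m.
Proof.
move=> sk; apply/funext => m; rewrite /dform.
rewrite -[LHS]det_tr -[X in c * X]det_tr -[X in d * X]det_tr.
apply: (determinant_multilinear (i0 := Ordinal sk)).
- apply/rowP => b; rewrite !mxE /= !nth_cat ltnn subnn /= !big_distrr -big_split.
  by apply: eq_bigr => i _; rewrite /= !mxE; ring.
- apply/matrixP => a b; rewrite !mxE !nth_cat; move: (lift _ a) (neq_lift (Ordinal sk) a) => a' a'n.
  case: ltngtP => // h; first by rewrite -(subnSK h).
  by case/eqP: a'n; apply/val_inj.
- apply/matrixP => a b; rewrite !mxE !nth_cat; move: (lift _ a) (neq_lift (Ordinal sk) a) => a' a'n.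
  case: ltngtP => // h; first by rewrite -(subnSK h).
  by case/eqP: a'n; apply/val_inj.
Qed.

End Forms.
Arguments dform {R} k l.

(** * Contractions in an orthonormal frame *)

Section Multilinear.
Variable R : realType.
Local Notation C := R[i].
Local Open Scope complex_scope.

(** Phrased as the expansion in the coordinate basis, the form in which contractions use it. *)
Definition multilinear k (a : form R k) := forall m,
  a m = \sum_(i : {ffun 'I_k -> 'I_8}) (\prod_c m c (i c))%:C *
          a (rowsub i 1%:M).

Lemma cmx_rowsub1 k (f : 'I_k -> 'I_8) (v : 'cV[C]_8) a :
  (cmx (rowsub f 1%:M : 'M[R]_(k, 8)) *m v) a 0 = v (f a) 0.
Proof.
rewrite mxE (bigD1 (f a)) //= big1 => [|i ia]; rewrite !mxE.
  by rewrite eqxx mul1r addr0.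
by rewrite eq_sym (negbTE ia) mul0r.
Qed.

Lemma multilinear_dform k l : multilinear (dform k l).
Proof.
move=> m; rewrite /dform.
transitivity (\sum_(s : 'S_k) (-1) ^+ s * \sum_(f : {ffun 'I_k -> 'I_8})
    (\prod_c m c (f c))%:C * \prod_c (nth 0 l (s c)) (f c) 0).
  apply: eq_bigr => s _; congr (_ * _).
  under eq_bigr => c _ do rewrite !mxE.
  rewrite bigA_distr_bigA; apply: eq_bigr => f _.
  rewrite big_split rmorph_prod; congr (_ * _).
  by apply: eq_bigr => c _; rewrite mxE.
under eq_bigr => s _ do rewrite big_distrr.
rewrite exchange_big; apply: eq_bigr => f _.
rewrite /determinant big_distrr; apply: eq_bigr => s _ /=.
rewrite mulrCA; congr (_ * (_ * _)); apply: eq_bigr => c _.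
by rewrite mxE cmx_rowsub1.
Qed.

Lemma multilinear_sum k (I : Type) (r : seq I) (Q : pred I) (c : I -> C)
    (a : I -> form R k) : (forall i, multilinear (a i)) ->
  multilinear (fun m => \sum_(i <- r | Q i) c i * a i m).
Proof.
move=> ha m; under eq_bigr => i _ do rewrite ha big_distrr.
rewrite exchange_big; apply: eq_bigr => f _ /=.
by rewrite big_distrr; apply: eq_bigr => i _; rewrite mulrCA.
Qed.

Lemma multilinear_pullback k P (a : form R k) :
  multilinear a -> multilinear (pullback P a).
Proof.
move=> ha m; rewrite /pullback ha.
under [RHS]eq_bigr => f _ do rewrite ha big_distrr.
rewrite exchange_big; apply: eq_bigr => i _ /=.
have -> : \prod_c (m *m P) c (i c) =
    \sum_(f : {ffun 'I_k -> 'I_8}) \prod_c (m c (f c) * P (f c) (i c)).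
  by under eq_bigr do rewrite mxE; rewrite bigA_distr_bigA.
rewrite rmorph_sum big_distrl; apply: eq_bigr => f _ /=.
rewrite big_split rmorphM -mulrA; congr (_ * (_ * _)).
by congr (_%:C); apply: eq_bigr => c _; rewrite -rowsubE mxE.
Qed.

Lemma inv_gram n (G P : 'M[R]_n) : P *m G *m P^T = 1%:M ->
  invmx G = P^T *m P.
Proof.
rewrite -mulmxA => /mulmx1C; rewrite -mulmxA => GPP.
have [uG _] := mulmx1_unit GPP.
by rewrite -[LHS]mulmx1 -GPP mulKmx.
Qed.

(** The inverse metric is [P^T *m P], so every factor g^{ij} splits into a sum over one frame index.
    The sums over [i] and [j] then reassemble [a] and [b] on the frame vectors. *)
Lemma contraction_frame k (G P : 'M[R]_8) (a b : form R k) :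
  P *m G *m P^T = 1%:M -> multilinear a -> multilinear b ->
  \sum_(i : {ffun 'I_k -> 'I_8}) \sum_(j : {ffun 'I_k -> 'I_8})
     (\prod_c invmx G (i c) (j c))%:C *
     (a (rowsub i 1%:M) * b (rowsub j 1%:M)) =
  \sum_(f : {ffun 'I_k -> 'I_8}) a (rowsub f P) * b (rowsub f P).
Proof.
move=> /inv_gram -> ha hb.
under [RHS]eq_bigr => f _ do rewrite ha hb big_distrlr /=.
rewrite [RHS]exchange_big; apply: eq_bigr => i _ /=.
rewrite [RHS]exchange_big; apply: eq_bigr => j _ /=.
have -> : \prod_c (P^T *m P) (i c) (j c) =
    \sum_(f : {ffun 'I_k -> 'I_8}) \prod_c (P (f c) (i c) * P (f c) (j c)).
  under eq_bigr do rewrite mxE; rewrite bigA_distr_bigA.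
  by apply: eq_bigr => f _; apply: eq_bigr => c _; rewrite mxE.
rewrite rmorph_sum big_distrl; apply: eq_bigr => f _ /=.
rewrite big_split rmorphM /= [RHS]mulrACA; congr (_%:C * _%:C * _).
  by apply: eq_bigr => c _; rewrite !mxE.
by apply: eq_bigr => c _; rewrite !mxE.
Qed.

Definition ecol (i : 'I_8) : 'cV[C]_8 := delta_mx i 0.

(** For each permutation [s] in the determinant only [f = t \o s] survives. Alternation of [b]
    cancels the sign, so all k! terms agree and the prefactor removes their number. *)
Lemma contraction_dform k (t : 'I_k -> 'I_8) l (P : 'M[R]_8) (b : form R k) :
  (forall i : 'I_k, nth 0 l i = ecol (t i)) -> alternating b ->
  (k`!%:R)^-1 * (\sum_(f : {ffun 'I_k -> 'I_8})
     dform k l (rowsub f 1%:M) * b (rowsub f P)) = b (rowsub t P).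
Proof.
move=> lt ab; apply: (canLR (mulKf _)).
  by rewrite pnatr_eq0 -lt0n fact_gt0.
under eq_bigr => f _ do rewrite /dform big_distrl /=.
rewrite exchange_big /=.
transitivity (\sum_(s : 'S_k) b (rowsub t P)); last first.
  by rewrite sumr_const card_Sn mulr_natl.
apply: eq_bigr => s _.
rewrite (bigD1 [ffun c => t (s c)]) //= [X in _ + X]big1 ?addr0 => [|f ft].
  rewrite big1 => [|c _]; last first.
    by rewrite mxE cmx_rowsub1 lt ffunE mxE !eqxx.
  rewrite mulr1 (_ : rowsub _ P = row_perm s (rowsub t P)).
    by rewrite ab mulrA -signr_addb addbb mul1r.
  by apply/matrixP => i j; rewrite !mxE ffunE.
suff [c /negbTE hc] : exists c, f c != t (s c).
  by rewrite (bigD1 c) //= mxE cmx_rowsub1 lt mxE hc !(mul0r, mulr0).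
apply/existsP; apply: contraNT ft; rewrite negb_exists => /forallP h.
by apply/eqP/ffunP => c; rewrite ffunE; apply/eqP; have := h c; rewrite negbK.
Qed.

(** As a form in [n] this is a volume form with its last [l] arguments frozen, which is what [star]
    contracts with. *)
Lemma multilinear_det_col k l (Q : 'M[R]_(8, k + l)) (m : 'M[R]_(l, 8)) :
  multilinear (fun n : 'M[R]_(k, 8) => (\det (col_mx n m *m Q))%:C).
Proof.
move=> n.
pose r (s : 'S_(k + l)) := \prod_(c < l) (m *m Q) c (s (rshift k c)).
have detE n' : \det (col_mx n' m *m Q) = \sum_(s : 'S_(k + l)) (-1) ^+ s *
    (\prod_(c < k) (n' *m Q) c (s (lshift l c)) * r s).
  apply: eq_bigr => s _; congr (_ * _); rewrite big_split_ord mul_col_mx.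
  by congr (_ * _); apply: eq_bigr => c _; rewrite ?col_mxEu ?col_mxEd.
rewrite detE.
transitivity ((\sum_(s : 'S_(k + l)) (-1) ^+ s * \sum_(f : {ffun 'I_k -> 'I_8})
    \prod_c (n c (f c) * Q (f c) (s (lshift l c))) * r s)%:C).
  congr (_%:C); apply: eq_bigr => s _; congr (_ * _).
  rewrite -big_distrl; congr (_ * _).
  by under [LHS]eq_bigr do rewrite mxE; rewrite bigA_distr_bigA.
under eq_bigr => s _ do rewrite big_distrr.
rewrite exchange_big rmorph_sum; apply: eq_bigr => f _ /=.
rewrite detE -rmorphM; congr (_%:C); rewrite big_distrr.
apply: eq_bigr => s _ /=; rewrite big_split [RHS]mulrCA -!mulrA.
congr (_ * (_ * (_ * _))); apply: eq_bigr => c _.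
by rewrite -rowsubE mxE.
Qed.

Lemma alternating_det_col k l (Q : 'M[R]_(8, k + l)) (m : 'M[R]_(l, 8)) :
  alternating (fun n : 'M[R]_(k, 8) => (\det (col_mx n m *m Q))%:C).
Proof.
move=> s n; rewrite row_permE.
have -> : col_mx (perm_mx s *m n) m =
    (block_mx (perm_mx s) 0 0 1%:M : 'M[R]_(k + l)) *m col_mx n m.
  by rewrite mul_block_col !mul0mx mul1mx addr0 add0r.
rewrite -mulmxA det_mulmx det_ublock det1 mulr1 det_perm rmorphM /=.
by rewrite rmorphXn rmorphN1.
Qed.

Lemma form_dot_frame k (G P : 'M[R]_8) (a b : form R k) :
  P *m G *m P^T = 1%:M -> multilinear a -> multilinear b ->
  form_dot G a b = (k`!%:R)^-1 * \sum_(f : {ffun 'I_k -> 'I_8})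
    a (rowsub f P) * b (rowsub f P).
Proof. by move=> PG ha hb; congr (_ * _); apply: contraction_frame. Qed.

(* P is an oriented orthonormal frame and Q = P^-1 its coframe. *)
Lemma star_dform (t : 'I_6 -> 'I_8) l (G P Q : 'M[R]_8) (vol : form R 8) m :
  P *m G *m P^T = 1%:M -> P *m Q = 1%:M ->
  (forall n, vol n = (\det (n *m Q))%:C) ->
  (forall i : 'I_6, nth 0 l i = ecol (t i)) ->
  pullback P (@star R G 6 2 vol (pullback Q (dform 6 l))) m =
  (\det (col_mx (rowsub t 1%:M) m : 'M[R]_(6 + 2)))%:C.
Proof.
move=> PG PQ hv lt.
pose b : form R 6 := fun n => vol (col_mx n (m *m P)).
have bE : b = fun n => (\det (col_mx n (m *m P) *m Q))%:C.
  by apply/funext => n; rewrite /b hv.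
transitivity (b (rowsub t P)); last first.
  rewrite bE -[P in rowsub _ P]mul1mx -mul_rowsub_mx -mul_col_mx -mulmxA PQ.
  by rewrite mulmx1.
rewrite -(contraction_dform P lt) ?bE; last exact: alternating_det_col.
congr (_ * _).
rewrite [LHS](contraction_frame (b := b) PG).
- apply: eq_bigr => f _; rewrite /pullback -[P in rowsub _ P]mul1mx.
  by rewrite -mul_rowsub_mx -mulmxA PQ mulmx1 bE.
- exact/multilinear_pullback/multilinear_dform.
- by rewrite bE; apply: multilinear_det_col.
Qed.

End Multilinear.

(** * Unitary frames *)

Section SimultaneousDiagonalization.
Variables (F : numClosedFieldType) (n : nat).
Local Open Scope sesquilinear_scope.
Implicit Types A B S H K : 'M[F]_n.

Lemma adjmxM m p q (A : 'M[F]_(m, p)) (B : 'M[F]_(p, q)) :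
  (A *m B)^t* = B^t* *m A^t*.
Proof. by rewrite trmx_mul map_mxM. Qed.

Lemma hermitian_diag H : H^t* = H ->
  exists (P : 'M[F]_n) (d : 'rV[F]_n), [/\ P *m P^t* = 1%:M, P *m H *m P^t* = diag_mx d
                & d \is a realmx].
Proof.
move=> Hh; have hH : H \is hermsymmx.
  by apply/is_hermitianmxP; rewrite expr0 scale1r Hh.
have /orthomx_spectralP HE := hermitian_normalmx hH.
have uP := spectral_unitarymx H; have P1 := spectral_unit H.
have HP := mulKVmx P1 (diag_mx (spectral_diag H) *m spectralmx H).
rewrite -mulmxA in HE; rewrite -HE in HP.
exists (spectralmx H), (spectral_diag H); split.
- exact/unitarymxP.
- by rewrite HP -mulmxA (unitarymxP uP) mulmx1.
- exact: hermitian_spectral_diag_real.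
Qed.

Lemma hermitian_normalize H : H^t* = H ->
  (forall v : 'rV_n, v != 0 -> 0 < (v *m H *m v^t*) 0 0) ->
  exists S : 'M[F]_n, S *m H *m S^t* = 1%:M.
Proof.
move=> /hermitian_diag[P [d [PP PHP _]]] Hpos.
(* Each [d 0 i] is the value of the Hermitian form on the i-th row of [P]. *)
have d0 i : 0 < d 0 i.
  have E : (delta_mx 0 i *m diag_mx d *m delta_mx i 0) (0 : 'I_1) (0 : 'I_1) = d 0 i.
    by rewrite -rowE -colE !mxE eqxx.
  have := Hpos (delta_mx 0 i *m P).
  rewrite adjmxM trmx_delta map_delta_mx !mulmxA -(mulmxA _ P) -(mulmxA _ (P *m H)).
  rewrite PHP E; apply; apply/negP => /eqP e0.
  have /(congr1 (fun v => (v *m P^t*) 0 i)) /= := e0.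
  rewrite -mulmxA PP mulmx1 mul0mx.
  rewrite !mxE !eqxx => /eqP.
  by rewrite oner_eq0.
pose e := \row_i (sqrtC (d 0 i))^-1.
exists (diag_mx e *m P).
rewrite adjmxM !mulmxA -(mulmxA _ P) -(mulmxA _ (P *m H)) PHP.
rewrite tr_diag_mx map_diag_mx !mulmx_diag -diag_const_mx; congr (diag_mx _).
apply/rowP => i; rewrite !mxE.
have s0 : 0 < sqrtC (d 0 i) by rewrite sqrtC_gt0.
rewrite /= geC0_conj ?invr_ge0 ?(ltW s0) // mulrAC -invfM -expr2 sqrtCK.
by rewrite mulVf // gt_eqF.
Qed.

(** Once [H] is normalized to the identity, -i times the transformed [K] is Hermitian; diagonalizing
    it by a unitary matrix leaves the identity untouched. *)
Lemma simultaneous_diag H K : H^t* = H ->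
  (forall v : 'rV_n, v != 0 -> 0 < (v *m H *m v^t*) 0 0) ->
  K^t* = - K ->
  exists (S : 'M[F]_n) (l : 'rV[F]_n), [/\ S *m H *m S^t* = 1%:M, S *m K *m S^t* = 'i *: diag_mx l
                & l \is a realmx].
Proof.
move=> Hh Hpos Ks; have [S SHS] := hermitian_normalize Hh Hpos.
have [|U [l [UU UKU lr]]] := @hermitian_diag (- 'i *: (S *m K *m S^t*)).
  rewrite linearZ /= map_mxZ !adjmxM trmxCK Ks rmorphN /= conjCi mulNmx mulmxN.
  by rewrite mulmxA scalerN -scaleNr opprK.
exists (U *m S), l; split=> //.
  by rewrite adjmxM !mulmxA -(mulmxA U) -(mulmxA U) SHS mulmx1.
rewrite -UKU adjmxM -scalemxAr -scalemxAl scalerA mulrN -expr2 sqrCi opprK.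
by rewrite scale1r !mulmxA.
Qed.
End SimultaneousDiagonalization.

Section UnitaryFrame.
Variable R : realType.
Local Notation C := R[i].
Local Open Scope complex_scope.
Local Open Scope sesquilinear_scope.

(* The columns are the covectors dz^j. *)
Definition Zmx : 'M[C]_(8, 4) := (col_mx 1%:M ('i%C)%:M : 'M[C]_(4 + 4, 4)).

Lemma cmx_row_Zmx k (u w : 'M[R]_(k, 4)) :
  cmx (row_mx u w : 'M[R]_(k, 4 + 4)) *m Zmx = cmx u + 'i%C *: cmx w.
Proof.
rewrite /Zmx /cmx (map_row_mx _ u w).
rewrite [LHS](mul_row_col (cmx u) (cmx w) 1%:M ('i%C)%:M).
by rewrite mulmx1 mul_mx_scalar.
Qed.

Lemma row_mx8 k (m : 'M[R]_(k, 8)) :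
  exists u w : 'M[R]_(k, 4), m = (row_mx u w : 'M[R]_(k, 4 + 4)).
Proof.
exists (lsubmx (m : 'M[R]_(k, 4 + 4))), (rsubmx (m : 'M[R]_(k, 4 + 4))).
by rewrite hsubmxK.
Qed.

Lemma dz4E (m : 'M[R]_(4, 8)) : dz4 m = \det (cmx m *m Zmx).
Proof.
congr (\det _); apply/matrixP => a j; have [u [w ->]] := row_mx8 m.
rewrite cmx_row_Zmx !mxE /zcoord !mxE (unsplitK (inl _)) (unsplitK (inr _)) /=.
by simpc.
Qed.

Lemma cmxM m n p (A : 'M[R]_(m, n)) (B : 'M[R]_(n, p)) :
  cmx (A *m B) = cmx A *m cmx B.
Proof. exact: map_mxM. Qed.

(** Real matrices are determined by their complex coordinates, so identities between them can be
    checked after multiplication by [Zmx], where J is the scalar i. *)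
Lemma Zmx_inj k (A B : 'M[R]_(k, 8)) : cmx A *m Zmx = cmx B *m Zmx -> A = B.
Proof.
have [u [w ->]] := row_mx8 A; have [u' [w' ->]] := row_mx8 B.
rewrite !cmx_row_Zmx => /matrixP uw.
have {}uw i j : u i j = u' i j /\ w i j = w' i j.
  by have := uw i j; rewrite !mxE; simpc => -[].
suff [-> ->] : u = u' /\ w = w' by [].
by split; apply/matrixP => i j; have [] := uw i j.
Qed.

(** Right multiplication of z = x + i y by [S], written on the real row (x, y). *)
Definition realify (S : 'M[C]_4) : 'M[R]_8 :=
  (block_mx (map_mx (@complex.Re R) S) (map_mx (@complex.Im R) S)
     (- map_mx (@complex.Im R) S) (map_mx (@complex.Re R) S) : 'M[R]_(4 + 4)).

Lemma cmx_block_Zmx k l (a b : 'M[R]_(k, 4)) (c d : 'M[R]_(l, 4)) :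
  cmx (block_mx a b c d : 'M[R]_(k + l, 4 + 4)) *m Zmx =
  col_mx (cmx a + 'i%C *: cmx b) (cmx c + 'i%C *: cmx d).
Proof.
rewrite block_mxEv /cmx (map_col_mx _ (row_mx a b) (row_mx c d)).
by rewrite [LHS](mul_col_mx (cmx (row_mx a b)) _ Zmx) !cmx_row_Zmx.
Qed.

Lemma cmx_ReIm k l (S : 'M[C]_(k, l)) :
  cmx (map_mx (@complex.Re R) S) + 'i%C *: cmx (map_mx (@complex.Im R) S) = S.
Proof. by apply/matrixP => i j; rewrite !mxE -complexE. Qed.

Lemma cmx_realify S : cmx (realify S) *m Zmx = Zmx *m S.
Proof.
rewrite [RHS](mul_col_mx 1%:M ('i%C)%:M S) mul1mx mul_scalar_mx.
rewrite /realify [LHS](@cmx_block_Zmx 4 4) cmx_ReIm; congr (@col_mx _ 4 4 4 _ _).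
rewrite -[in RHS](cmx_ReIm S) scalerDr scalerA -expr2 sqr_i scaleN1r addrC.
by rewrite /cmx map_mxN.
Qed.

Lemma cmx_J : cmx (Jmx R) *m Zmx = 'i%C *: Zmx.
Proof.
transitivity (col_mx ('i%C *: 1%:M) ('i%C *: ('i%C)%:M) : 'M[C]_(4 + 4, 4));
  last by apply/esym; apply: (@scale_col_mx _ 4 4 4).
rewrite /Jmx [LHS](@cmx_block_Zmx 4 4).
rewrite /cmx map_mxN map_mx1 map_mx0 scaler0 add0r addr0; congr (@col_mx _ 4 4 4 _ _).
by rewrite scale_scalar_mx -expr2 sqr_i raddfN.
Qed.

Lemma realifyM S T : realify (S *m T) = realify S *m realify T.
Proof.
apply: Zmx_inj; rewrite cmxM -mulmxA !cmx_realify.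
by rewrite !mulmxA cmx_realify.
Qed.

Lemma realify_inj : injective realify.
Proof.
move=> S T ST; have := cmx_realify S; rewrite ST cmx_realify.
rewrite [LHS](mul_col_mx 1%:M ('i%C)%:M T) [RHS](mul_col_mx 1%:M ('i%C)%:M S).
by move/(@eq_col_mx _ 4 4 4) => [+ _]; rewrite !mul1mx.
Qed.

Lemma realifyN S : realify (- S) = - realify S.
Proof.
by apply: Zmx_inj; rewrite [cmx (- _)]map_mxN mulNmx !cmx_realify mulmxN.
Qed.

Lemma tr_realify S : (realify S)^T = realify (S^t*).
Proof.
rewrite /realify [LHS](tr_block_mx (map_mx (@complex.Re R) S)).
suff [-> ->] : map_mx (@complex.Re R) (S^t*) = (map_mx (@complex.Re R) S)^T /\
    map_mx (@complex.Im R) (S^t*) = - (map_mx (@complex.Im R) S)^T.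
  by rewrite opprK linearN.
by split; apply/matrixP => i j; rewrite !mxE; case: (S j i).
Qed.

Lemma comm_realify S : Jmx R *m realify S = realify S *m Jmx R.
Proof.
apply: Zmx_inj; rewrite !cmxM -!mulmxA cmx_realify cmx_J mulmxA cmx_J.
by rewrite -scalemxAl -scalemxAr cmx_realify.
Qed.

(** In complex coordinates the commutation forces the lower block of [cmx A *m Zmx] to be i times
    the upper one, and the upper block is the required complex matrix. *)
Lemma realifyP (A : 'M[R]_8) : Jmx R *m A = A *m Jmx R -> exists S, A = realify S.
Proof.
move=> JA; have [u [d AZ]] : exists u d : 'M[C]_4,
    cmx A *m Zmx = (col_mx u d : 'M[C]_(4 + 4, 4)).
  exists (usubmx (cmx A *m Zmx : 'M[C]_(4 + 4, 4))).
  by exists (dsubmx (cmx A *m Zmx : 'M[C]_(4 + 4, 4))); rewrite vsubmxK.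
have : cmx (Jmx R) *m (cmx A *m Zmx) = 'i%C *: (cmx A *m Zmx).
  by rewrite [LHS]mulmxA -cmxM JA cmxM -mulmxA cmx_J -scalemxAr.
rewrite AZ /cmx /Jmx (@map_block_mx _ _ _ 4 4 4 4) (@mul_block_col _ 4 4 4 4 4).
rewrite (@scale_col_mx _ 4 4 4) map_mx0 map_mx1 map_mxN map_mx1 !mul0mx mul1mx.
rewrite addr0 add0r => /(@eq_col_mx _ 4 4 4)[du _].
exists u; apply: Zmx_inj; rewrite cmx_realify AZ du.
by rewrite [RHS](@mul_col_mx _ 4 4 4 4 1%:M ('i%C)%:M) mul1mx mul_scalar_mx.
Qed.

(* A complex row z is row 0 of the matrix S with all rows z, and row 0 of
   [realify S] is z as a real vector. *)
Lemma realify_pos (H : 'M[C]_4) : H^t* = H ->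
  (forall v, v != 0 -> 0 < gdot (realify H) v v) ->
  forall z : 'rV_4, z != 0 -> 0 < (z *m H *m z^t*) 0 0.
Proof.
move=> Hh Hpos z z0; pose S : 'M[C]_4 := \matrix_(i, j) z 0 j.
have zS : z = row 0 S by apply/rowP => j; rewrite !mxE.
have zHz : (z *m H *m z^t*) 0 0 = (S *m H *m S^t*) 0 0.
  rewrite zS -row_mul -map_trmx map_row !mxE; apply: eq_bigr => k _.
  by rewrite !mxE.
have hSHS : (S *m H *m S^t*)^t* = S *m H *m S^t*.
  by rewrite !adjmxM trmxCK Hh mulmxA.
have im0 : complex.Im ((S *m H *m S^t*) 0 0) = 0.
  have /matrixP/(_ 0 0) := hSHS; rewrite [LHS]mxE [X in _ X = _]mxE.
  by case: (_ 0 0) => a b [/esym/eqP]; rewrite -addr_eq0 -mulr2n mulrn_eq0 => /eqP.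
pose i0 : 'I_8 := lshift 4 (0 : 'I_4).
rewrite zHz ltcE im0 eqxx /=.
have -> : complex.Re ((S *m H *m S^t*) 0 0) =
    gdot (realify H) (row i0 (realify S)) (row i0 (realify S)).
  transitivity (realify (S *m H *m S^t*) i0 i0).
    by rewrite /realify [RHS](@block_mxEul _ 4 4 4 4) [RHS]mxE.
  rewrite !realifyM -tr_realify /gdot -row_mul [LHS]mxE [RHS]mxE.
  by apply: eq_bigr => k _; rewrite !mxE.
apply: Hpos; apply: contraNneq z0 => S0; apply/eqP/rowP => j.
have S0k k : realify S i0 k = 0.
  by move/rowP/(_ k): S0; rewrite !mxE.
have := S0k (lshift 4 j : 'I_8); have := S0k (rshift 4 j : 'I_8).
rewrite /realify (@block_mxEul _ 4 4 4 4) (@block_mxEur _ 4 4 4 4) !mxE.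
by case: (z 0 j) => a b /= -> ->.
Qed.

(** Commuting with J, the metric and the curvature matrix come from complex 4 by 4 matrices, one
    Hermitian and positive, the other skew-Hermitian. The complex frame diagonalizing both is then
    made real again. *)
Lemma unitary_frame (G B : 'M[R]_8) (f : C) :
  G^T = G -> (forall v, v != 0 -> 0 < gdot G v v) ->
  Jmx R *m G = G *m Jmx R ->
  B^T = - B -> Jmx R *m B = B *m Jmx R -> f != 0 ->
  exists (P : 'M[R]_8) (l : 'rV[R]_4) (r : C), [/\ P *m G *m P^T = 1%:M,
    Jmx R *m P = P *m Jmx R,
    P *m B *m P^T =
      (block_mx 0 (diag_mx l) (- diag_mx l) 0 : 'M[R]_(4 + 4)),
    0 < r & forall m, f * dz4 (m *m P) = r * dz4 m].
Proof.
move=> Gs Gpos /realifyP[H GH] Bs /realifyP[K BK] f0; subst G B.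
have Hh : H^t* = H by apply: realify_inj; rewrite -tr_realify.
have Ks : K^t* = - K by apply: realify_inj; rewrite -tr_realify realifyN.
have [S [l [SHS SKS lr]]] := simultaneous_diag Hh (realify_pos Hh Gpos) Ks.
pose z := f * \det S.
have z0 : z != 0.
  rewrite mulf_neq0 // -unitfE -unitmxE.
  by move: SHS; rewrite -mulmxA => /mulmx1_unit[].
pose zeta := (z^*)%R / `|z|.
have zz : zeta * (zeta^*)%R = 1.
  rewrite /zeta; move: (z) z0 => w w0.
  rewrite rmorphM /= conjCK fmorphV /= (CrealP (normr_real w)).
  by rewrite mulrACA [(w^*)%R * w]mulrC -normCK -invfM -expr2 mulfV // expf_neq0 ?normr_eq0.
pose D : 'M[C]_4 := diag_mx (\row_i (if i == 0 then zeta else 1)).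
(* The diagonal unitary matrix [D] commutes with diagonal matrices, so the rotation spoils neither
   of the two diagonal forms. *)
have Dd d : D *m diag_mx d *m D^t* = diag_mx d.
  rewrite /D tr_diag_mx map_diag_mx !mulmx_diag; congr diag_mx; apply/rowP => i.
  rewrite !mxE; case: ifP => _; first by rewrite mulrAC zz mul1r.
  by rewrite rmorph1 mul1r mulr1.
(* [zeta] rotates the first frame vector so as to make the coefficient of
   dz4 positive. *)
exists (realify (D *m S)), (map_mx (@complex.Re R) l), `|z|; split.
- rewrite tr_realify -!realifyM adjmxM !mulmxA -(mulmxA D) -(mulmxA D).
  rewrite SHS -diag_const_mx Dd diag_const_mx.
  by apply: Zmx_inj; rewrite cmx_realify /cmx map_mx1 mul1mx mulmx1.
- exact: comm_realify.
- rewrite tr_realify -!realifyM adjmxM !mulmxA -(mulmxA D) -(mulmxA D).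
  rewrite SKS -scalemxAr -scalemxAl Dd.
  (* Multiplication by i times a real diagonal matrix is, in the coordinates (x, y), the
     off-diagonal block matrix of the conclusion. *)
  have lE : 'i *: diag_mx l = 'i%C *: cmx (diag_mx (map_mx (@complex.Re R) l)).
    rewrite /cmx map_diag_mx; congr (_ *: diag_mx _); apply/rowP => i.
    rewrite !mxE.
    by rewrite /= RRe_real // (mxOverP lr).
  apply: Zmx_inj; rewrite cmx_realify lE (@cmx_block_Zmx 4 4).
  rewrite [LHS](@mul_col_mx _ 4 4 4 4 1%:M ('i%C)%:M) mul1mx mul_scalar_mx.
  rewrite scalerA -expr2 sqr_i scaleN1r /cmx map_mx0 scaler0 add0r addr0.
  by rewrite map_mxN.
- by rewrite normr_gt0.
- move=> m; rewrite !dz4E cmxM -mulmxA cmx_realify mulmxA !det_mulmx.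
  have -> : \det D = zeta.
    rewrite det_diag (bigD1 0) //= big1 ?mulr1 ?mxE // => i /negbTE i0.
    by rewrite mxE i0.
  have zz' : zeta * z = `|z|.
    rewrite /zeta mulrAC [_ * z]mulrC -normCK expr2 mulfK //.
    by rewrite normr_eq0.
  by rewrite -zz' /z; ring.
Qed.

End UnitaryFrame.

(** * The curvature of a Hermitian connection *)

Section SymmetryOfDerivatives.
Variable R : realType.

Lemma MVT0 (g dg : R -> R) (h : R) : 0 < h ->
  (forall s : R, s \in `[0, h] ->
     is_derive (s : R^o) (1 : R^o) (g : R^o -> R^o) (dg s)) ->
  exists2 s : R, s \in `[0, h] & g h - g 0 = dg s * h.
Proof.
move=> h0 g'.
have g'oo (s : R) : s \in `]0, h[ -> is_derive (s : R^o) (1 : R^o) g (dg s).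
  by rewrite in_itv /= => /andP[/ltW s0 /ltW sh]; apply: g'; rewrite in_itv /= s0.
have gc := @derivable_within_continuous R R g `[0, h]
  (fun s hs => @ex_derive _ _ _ _ _ _ _ (g' s hs)).
have [c hc E] := MVT_segment (ltW h0) g'oo gc.
by exists c => //; rewrite E subr0.
Qed.

Lemma ltr_dist_half (e a b c : R) :
  `|a - b| < e / 2 -> `|c - b| < e / 2 -> `|a - c| < e.
Proof.
move=> ab cb; apply: le_lt_trans (ler_distD b a c) _.
by rewrite [e]splitr ltrD // distrC.
Qed.

Section Line.
Variable V : normedModType R.

Lemma line_growth (f : V -> R) p v (s h : R) :
  h^-1 *: (f (p + (h *: 1 + s) *: v) - f (p + s *: v)) =
  h^-1 *: (f (h *: v + (p + s *: v)) - f (p + s *: v)).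
Proof. by rewrite [h *: 1]mulr1 scalerDl addrCA. Qed.

Lemma is_derive_line (f : V -> R^o) p v (s : R) :
  differentiable f (p + s *: v) ->
  is_derive (s : R^o) (1 : R^o) (fun t : R^o => f (p + t *: v) : R^o) ('D_v f (p + s *: v)).
Proof.
move=> /diff_derivable-/(_ v) df; split.
  move: df; rewrite /derivable /=.
  by under [in X in X -> _]eq_fun do rewrite -line_growth.
by rewrite /derive /=; under eq_fun do rewrite line_growth.
Qed.

Lemma MVT_line (f : V -> R^o) p v (h : R) : 0 < h ->
  (forall s, s \in `[0, h] -> differentiable f (p + s *: v)) ->
  exists2 s, s \in `[0, h] & f (p + h *: v) - f p = 'D_v f (p + s *: v) * h.
Proof.
move=> h0 df.
have [s hs|s hs E] := @MVT0 (fun t => f (p + t *: v)) (fun t => 'D_v f (p + t *: v)) h h0.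
  by apply: is_derive_line; apply: df.
by exists s => //; rewrite -E scale0r addr0.
Qed.

(** The mean value theorem is applied to the difference of [f] along two parallel segments: this
    yields one common parameter [s], where two separate applications would give two. *)
Lemma MVT_line2 (f : V -> R^o) p q v (h : R) : 0 < h ->
  (forall s, s \in `[0, h] -> differentiable f (p + s *: v)) ->
  (forall s, s \in `[0, h] -> differentiable f (q + s *: v)) ->
  exists2 s, s \in `[0, h] & (f (p + h *: v) - f (q + h *: v)) - (f p - f q) =
     ('D_v f (p + s *: v) - 'D_v f (q + s *: v)) * h.
Proof.
move=> h0 dp dq.
pose F (t : R) : R := f (p + t *: v) - f (q + t *: v).
pose dF (t : R) : R := 'D_v f (p + t *: v) - 'D_v f (q + t *: v).
have d (s : R) : s \in `[0, h] -> is_derive (s : R^o) (1 : R^o) (F : R^o -> R^o) (dF s).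
  by move=> hs; apply: is_deriveB; apply: is_derive_line; [apply: dp|apply: dq].
have [s hs E] := MVT0 h0 d; exists s => //.
by move: E; rewrite /F /dF !scale0r !addr0.
Qed.

Lemma mixed_difference (f : V -> R^o) u v w (h : R) : 0 < h ->
  (forall s t, s \in `[0, h] -> t \in `[0, h] ->
     differentiable f (u + s *: v + t *: w) /\
     differentiable ('D_v f : V -> R^o) (u + s *: v + t *: w)) ->
  exists s t, [/\ s \in `[0, h], t \in `[0, h] &
    f (u + h *: w + h *: v) - f (u + h *: v) - (f (u + h *: w) - f u) =
    'D_w ('D_v f : V -> R^o) (u + s *: v + t *: w) * h * h].
Proof.
move=> h0 df.
have i0 : 0 \in `[0, h] by rewrite in_itv /= lexx ltW.
have ih : h \in `[0, h] by rewrite in_itv /= lexx ltW.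
have [||s hs ->] := @MVT_line2 f (u + h *: w) u v h h0.
- by move=> s hs; rewrite addrAC; have [] := df s h hs ih.
- by move=> s hs; have [] := df s 0 hs i0; rewrite scale0r addr0.
have [|t ht E] := @MVT_line ('D_v f) (u + s *: v) w h h0.
  by move=> t ht; have [] := df s t hs ht.
by exists s, t; split => //; rewrite -E [u + h *: w + _]addrAC.
Qed.

(** The second difference of [f] over a small parallelogram is symmetric in [v] and [w]. By
    [mixed_difference], used in both orders, it is h^2 times either mixed derivative at some point
    of the parallelogram; continuity at [u] concludes. *)
Lemma derive_comm (f : V -> R^o) (U : set V) u v w :
  open U -> U u ->
  (forall p, U p -> differentiable f p) ->
  (forall p, U p -> differentiable ('D_v f : V -> R^o) p) ->
  (forall p, U p -> differentiable ('D_w f : V -> R^o) p) ->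
  {for u, continuous ('D_w ('D_v f : V -> R^o))} ->
  {for u, continuous ('D_v ('D_w f : V -> R^o))} ->
  'D_w ('D_v f : V -> R^o) u = 'D_v ('D_w f : V -> R^o) u.
Proof.
move=> oU Uu df dv dw cwv cvw.
set A := 'D_w ('D_v f : V -> R^o) in cwv *.
set B := 'D_v ('D_w f : V -> R^o) in cvw *.
suff AB e : 0 < e -> `|A u - B u| < e.
  apply/eqP; rewrite -subr_eq0 -normr_le0 leNgt; apply/negP => /AB.
  by rewrite ltxx.
move=> e0; have e2 : 0 < e / 2 by rewrite divr_gt0.
have nU : nbhs u U by apply: open_nbhs_nbhs.
have nA : \forall p \near u, `|A u - A p| < e / 2.
  by move/cvgrPdist_lt: cwv; apply.
have nB : \forall p \near u, `|B u - B p| < e / 2.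
  by move/cvgrPdist_lt: cvw; apply.
have [r /= r0 hr] := (nbhs_ballP _ _).1 (filterI nU (filterI nA nB)).
(* The summand 1 keeps [M] positive even when both directions vanish. The parallelogram stays within
   distance h M = r / 2 of [u]. *)
pose M := `|v| + `|w| + 1.
have M0 : 0 < M by rewrite ltr_wpDl ?addr_ge0.
pose h := r / (2 * M).
have h0 : 0 < h by rewrite divr_gt0 ?mulr_gt0.
have near_u s t : s \in `[0, h] -> t \in `[0, h] ->
    ball u r (u + s *: v + t *: w).
  rewrite !in_itv /= => /andP[s0 sh] /andP[t0 th].
  rewrite -ball_normE /ball_ /= -addrA opprD addNKr normrN.
  rewrite (le_lt_trans (ler_normD _ _)) // !normrZ !ger0_norm //.
  apply: (@le_lt_trans _ _ (h * M)).
    rewrite /M mulrDr mulrDr mulr1 ler_wpDr ?(ltW h0) //.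
    by rewrite lerD // ler_wpM2r.
  rewrite /h invfM mulrA mulfVK ?gt_eqF // ltr_pdivrMr // ltr_pMr //.
  by rewrite ltr1n.
have [|s [t [hs ht E1]]] := @mixed_difference f u v w h h0.
  by move=> s t hs ht; have [Up _] := hr _ (near_u s t hs ht); split; auto.
have [|s' [t' [hs' ht' E2]]] := @mixed_difference f u w v h h0.
  move=> s' t' hs' ht'; have [] := hr _ (near_u t' s' ht' hs').
  by rewrite addrAC => Up _; split; auto.
have hh : h != 0 by rewrite gt_eqF.
have E : A (u + s *: v + t *: w) = B (u + t' *: v + s' *: w).
  have swap (a b c d : R) : a - b - (c - d) = a - c - (b - d) by ring.
  apply: (mulIf hh); apply: (mulIf hh).
  rewrite -[LHS]E1 [X in B X]addrAC -[RHS]E2 [u + h *: v + h *: w]addrAC.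
  exact: swap.
have [_ [a1 _]] := hr _ (near_u s t hs ht).
have [_ [_ b1]] := hr _ (near_u t' s' ht' hs').
by apply: (ltr_dist_half a1); rewrite E.
Qed.

End Line.

End SymmetryOfDerivatives.

(** * Charts and changes of tangent coordinates *)

Section Charts.
Variables (R : realType) (X : complex_manifold4 R).
Local Open Scope classical_set_scope.

Lemma cfunK_img (c : chart R X) u : cimg c u -> c (cinv c u) = u.
Proof. by move=> [x cx <-]; rewrite cfunK. Qed.

Lemma cimg_dom (c : chart R X) u : cimg c u -> cdom c (cinv c u).
Proof. by move=> [x cx <-]; rewrite cfunK. Qed.

Lemma cinv_cvg (c : chart R X) u : cimg c u -> {for u, continuous (cinv c)}.
Proof.
have := @cinv_continuous _ _ c; rewrite continuous_open_subspace; last exact: cimg_open.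
by move=> /in_setP h /h.
Qed.

Lemma nbhs_chart (c : chart R X) (W : set X) u :
  open W -> cimg c u -> W (cinv c u) -> nbhs u (cimg c `&` cinv c @^-1` W).
Proof.
move=> oW cu Wu; apply: filterI.
  by apply: open_nbhs_nbhs; split => //; exact: cimg_open.
by apply: (cinv_cvg cu); apply: open_nbhs_nbhs.
Qed.

Lemma open_chart (c : chart R X) (W : set X) :
  open W -> open (cimg c `&` cinv c @^-1` W).
Proof. by move=> oW; rewrite openE => u [cu Wu]; apply: nbhs_chart. Qed.

Lemma transition_differentiable (c c' : chart R X) u : atlas c -> atlas c' ->
  cimg c u -> cdom c' (cinv c u) ->
  differentiable (fun w => c' (cinv c w)) u.
Proof.
move=> ac ac' cu c'u; have [s _] := cm_transition ac ac'.
exact: (s [::] u (conj cu c'u)).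
Qed.

Lemma tangent_change1 (x : X) : tangent_change (chart_at x) (chart_at x x) = 1%:M.
Proof.
set c := chart_at x; have cx : cdom c x := chart_at_dom x.
have cu : cimg c (c x) by exists x.
rewrite /tangent_change cfunK // -/c; apply/row_matrixP => i.
rewrite !rowE mulmx1 -deriveEjacobian; last first.
  apply: transition_differentiable => //; first exact: chart_at_atlas.
  - exact: chart_at_atlas.
  - exact: cimg_dom.
rewrite (@near_eq_derive _ _ _ _ id); first by rewrite derive_id.
have := @nbhs_chart c setT (c x) openT cu I.
by apply: filterS => u [/cfunK_img].
Qed.

(** Chain rule through the transition map. It is needed because [dfun] and [connection] refer to the
    chosen chart at each point, whereas second derivatives must be taken in one fixed chart. *)
Lemma derive_chart (f : X -> R^o) (c : chart R X) u v (c' := chart_at (cinv c u)) :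
  atlas c -> cimg c u ->
  differentiable (fun w => f (cinv c' w) : R^o) (c' (cinv c u)) ->
  'D_v (fun w => f (cinv c w) : R^o) u =
  'D_(v *m tangent_change c u) (fun w => f (cinv c' w) : R^o) (c' (cinv c u)).
Proof.
move=> ac cu df; have c'u : cdom c' (cinv c u) := chart_at_dom _.
have dt : differentiable (fun w => c' (cinv c w)) u.
  by apply: transition_differentiable => //; apply: chart_at_atlas.
rewrite (@near_eq_derive _ _ _ _ ((fun w => f (cinv c' w) : R^o) \o (fun w => c' (cinv c w)))).
  rewrite deriveE; last exact: differentiable_comp.
  rewrite diff_comp // /= -(deriveE _ dt) -(deriveE _ df).
  by rewrite (deriveEjacobian _ dt).
have := @nbhs_chart c (cdom c') u (@cdom_open _ _ c') cu c'u.
by apply: filterS => w [_ c'w] /=; rewrite cfunK.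
Qed.

End Charts.

Lemma Im_scale_add (R : realType) (r : R) (z z' : R[i]) :
  complex.Im ((r%:C)%C * z + z') = r * complex.Im z + complex.Im z'.
Proof. by case: z z' => [p q] [p' q'] /=; rewrite mul0r addr0. Qed.

Lemma subc_same_Re (R : realType) (p q s : R) :
  ((p +i* q) - (p +i* s) = 'i * (q - s)%:C)%C.
Proof. by simpc. Qed.

Lemma linear_combB (K : pzRingType) (r p q p' q' : K) :
  r * p + q - (r * p' + q') = r * (p - p') + (q - q').
Proof. by rewrite opprD mulrBr addrACA. Qed.

Lemma skew_bilinear_mx (R : realType) n (b : 'rV[R]_n -> 'rV[R]_n -> R) :
  (forall r v w x, b (r *: v + w) x = r * b v x + b w x) ->
  (forall v w, b v w = - b w v) ->
  exists2 B : 'M[R]_n, B^T = - B & forall v w, b v w = (v *m B *m w^T) 0 0.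
Proof.
move=> bl bs.
have b0 x : b 0 x = 0.
  have := bl 1 0 0 x; rewrite scale1r addr0 mul1r => /eqP.
  by rewrite -subr_eq0 opprD addrA subrr sub0r oppr_eq0 => /eqP.
have bE v x : b v x = \sum_i v 0 i * b (delta_mx 0 i) x.
  rewrite [in LHS](row_sum_delta v).
  elim/big_rec2: _ => [|i y w _ <-]; first exact: b0.
  exact: bl.
exists (\matrix_(i, j) b (delta_mx 0 i) (delta_mx 0 j)).
  by apply/matrixP => i j; rewrite !mxE bs.
move=> v w; rewrite bE -mulmxA mxE; apply: eq_bigr => i _; congr (_ * _).
rewrite bs bE -sumrN mxE; apply: eq_bigr => j _.
by rewrite !mxE -mulrN -bs mulrC.
Qed.

Section Curvature.
Variables (R : realType) (X : complex_manifold4 R) (L : line_bundle X).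
Variables (h : hermitian_metric L) (D : connection L).
Hypothesis hD : hermitian_connection h D.
Local Open Scope complex_scope.
Local Open Scope classical_set_scope.

Lemma lframe_smooth_at a y : ldom a y -> section_smooth_at (lframe (l := L) a) y.
Proof.
by move=> ay; exists (ldom a); split => // [|b]; [exact: ldom_open|exact: ltransition].
Qed.

Lemma connection_form_linear a y (r : R) (v w : 'rV[R]_8) : ldom a y ->
  connection_form D a y (r *: v + w) =
  r%:C * connection_form D a y v + connection_form D a y w.
Proof.
move=> ay; rewrite /connection_form (cov_linear D (lframe_smooth_at ay)).
rewrite -[X in _ *: X + _](lframeK ay) -[X in _ + X](lframeK ay).
by rewrite scalerA -scalerDl lcoefK.
Qed.

Lemma hdot0 x (t : L x) : h x 0 t = 0.
Proof.
have := hdot_linear h 1 0 0 t; rewrite scale1r addr0 mul1r => /eqP.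
by rewrite -subr_eq0 opprD addrA subrr sub0r oppr_eq0 => /eqP.
Qed.

Definition frame_norm2 a (y : X) : R := complex.Re (h y (lframe a y) (lframe a y)).

Lemma frame_norm2E a y :
  h y (lframe a y) (lframe a y) = (frame_norm2 a y)%:C.
Proof.
rewrite /frame_norm2; have := hdot_sym h (lframe a y) (lframe a y).
by case: (h y _ _) => p q [/eqP]; rewrite -addr_eq0 -mulr2n mulrn_eq0 => /eqP ->.
Qed.

Lemma frame_norm2_neq0 a y : ldom a y -> frame_norm2 a y != 0.
Proof.
move=> ay; have e0 : lframe a y != 0 :> L y.
  apply/eqP => e0; have := lcoefK ay 1; have := lcoefK ay 0.
  by rewrite e0 !scaler0 => -> /eqP; rewrite eq_sym oner_eq0.
apply/eqP => n0; have := hdot_pos h e0.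
by rewrite frame_norm2E n0 ltxx.
Qed.

(** Compatibility with [h], applied to the frame in both arguments, gives the connection form plus
    its conjugate. *)
Lemma derive_frame_norm2 a y (v : 'rV[R]_8) : ldom a y ->
  'D_v (fun u => frame_norm2 a (cinv (chart_at y) u) : R^o) (chart_at y y) =
  2 * complex.Re (connection_form D a y v) * frame_norm2 a y.
Proof.
move=> ay; have sm := lframe_smooth_at ay.
set z := connection_form D a y v.
have Dz : D (lframe a) y v = z *: lframe a y by rewrite /z /connection_form lframeK.
have hz : h y (z *: lframe a y) (lframe a y) = z * (frame_norm2 a y)%:C.
  by rewrite -[X in h y X]addr0 hdot_linear hdot0 addr0 frame_norm2E.
have := hD sm sm v; rewrite Dz hz (hdot_sym h (z *: _)) hz.
move=> /(congr1 (@complex.Re R)); rewrite [LHS]/= => ->.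
by case: z {Dz hz} => p q /=; ring.
Qed.

Lemma smooth_frame_norm2 a (c : chart R X) : atlas c ->
  smooth_on (cimg c `&` cinv c @^-1` ldom a)
    (fun u => frame_norm2 a (cinv c u) : R^o).
Proof. by move=> ac; have [] := hdot_smooth h a ac. Qed.

Lemma derive_frame_norm2_chart a (c : chart R X) u v : atlas c ->
  cimg c u -> ldom a (cinv c u) ->
  'D_v (fun w => frame_norm2 a (cinv c w) : R^o) u =
  2 * complex.Re (local_form (connection_form D a) c u v) * frame_norm2 a (cinv c u).
Proof.
move=> ac cu au; rewrite derive_chart // ?derive_frame_norm2 //.
set y := cinv c u.
have cy := chart_at_dom y.
apply: (smooth_frame_norm2 (chart_at_atlas y) [::]); split; first by exists y.
by rewrite /preimage /= cfunK.
Qed.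

Definition local_connection a (c : chart R X) u (v : 'rV[R]_8) : R[i] :=
  local_form (connection_form D a) c u v.

Lemma smooth_local_connection a (c : chart R X) v : atlas c ->
  Csmooth_on (cimg c `&` cinv c @^-1` ldom a) (fun u => local_connection a c u v).
Proof. by move=> ac; apply: (cov_smooth D a ac v). Qed.

Lemma local_connection_linear a (c : chart R X) u r v w :
  ldom a (cinv c u) ->
  local_connection a c u (r *: v + w) =
  r%:C * local_connection a c u v + local_connection a c u w.
Proof.
move=> au; rewrite /local_connection /local_form mulmxDl -scalemxAl.
exact: connection_form_linear.
Qed.

(* The real part of the connection form is half the differential of the
   logarithm of the norm of the frame, hence closed. *)
Lemma Re_connection_closed a (c : chart R X) u v w : atlas c ->
  cimg c u -> ldom a (cinv c u) ->
  'D_v (fun u => complex.Re (local_connection a c u w) : R^o) u =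
  'D_w (fun u => complex.Re (local_connection a c u v) : R^o) u.
Proof.
move=> ac cu au.
pose U := cimg c `&` cinv c @^-1` ldom a.
have oU : open U by apply: open_chart; apply: ldom_open.
have nU : nbhs u U by apply: open_nbhs_nbhs.
pose N u := frame_norm2 a (cinv c u) : R^o.
pose rho v u := complex.Re (local_connection a c u v) : R^o.
have sN : smooth_on U N by apply: smooth_frame_norm2.
have DN v' u' : U u' -> 'D_v' N u' = 2 * rho v' u' * N u'.
  by move=> [cu' au']; rewrite /N derive_frame_norm2_chart.
have drho v' : differentiable (rho v') u.
  exact: ((smooth_local_connection a v' ac).1 [::]).
have dN : differentiable N u by apply: (sN [::]).
(* In the second derivative the product of the two real parts is symmetric in the directions.
   Symmetry therefore leaves [N u] times the difference to be shown zero, and [N u] is nonzero. *)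
have DDN v' w' : 'D_w' ('D_v' N : 'rV[R]_8 -> R^o) u =
    2 * (rho v' u * (2 * rho w' u * N u) + N u * 'D_w' (rho v') u).
  rewrite (@near_eq_derive _ _ _ _ (2 *: (rho v' * N))); last first.
    by apply: filterS nU => u' /DN ->; rewrite -mulrA.
  rewrite deriveZ; last by apply: derivableM; apply: diff_derivable.
  by rewrite deriveM ?DN //; apply: diff_derivable.
have comm : 'D_w ('D_v N : 'rV[R]_8 -> R^o) u = 'D_v ('D_w N : 'rV[R]_8 -> R^o) u.
  apply: (@derive_comm R _ N U u v w oU (conj cu au)).
  - exact: (sN [::]).
  - exact: (sN [:: v]).
  - exact: (sN [:: w]).
  - by apply: differentiable_continuous; apply: (sN [:: w; v]).
  - by apply: differentiable_continuous; apply: (sN [:: v; w]).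
have N0 : N u != 0 by apply: frame_norm2_neq0.
move: comm; rewrite !DDN => /(mulfI _); rewrite pnatr_eq0 => /(_ isT).
move/eqP; rewrite -subr_eq0 => E; apply/eqP; rewrite eq_sym -subr_eq0.
rewrite -(mulrI_eq0 _ (mulfI N0)); apply/eqP; move/eqP: E => <-.
by ring.
Qed.

(** The two real parts cancel by [Re_connection_closed]. What remains is i times the exterior
    derivative of the imaginary part of the connection form, and [B] is its real matrix at [x]. *)
Lemma curvature_skew x : exists2 B : 'M[R]_8, B^T = - B &
  curvature D x = fun m => 'i%C * ((row 0 m *m B *m (row 1 m)^T) 0 0)%:C.
Proof.
set a := triv_at L x; set c := chart_at x.
have ac : atlas c by apply: chart_at_atlas.
have cx : cinv c (c x) = x by apply: cfunK; apply: chart_at_dom.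
have cu : cimg c (c x) by exists x => //; apply: chart_at_dom.
have au : ldom a (cinv c (c x)) by rewrite cx; apply: triv_at_dom.
pose U := cimg c `&` cinv c @^-1` ldom a.
have nU : nbhs (c x) U.
  by apply: open_nbhs_nbhs; split=> //; apply: open_chart; apply: ldom_open.
pose dcov w u := complex.Im (local_connection a c u w) : R^o.
have ddcov w : differentiable (dcov w) (c x).
  exact: ((smooth_local_connection a w ac).2 [::]).
pose b v w : R := 'D_v (dcov w) (c x) - 'D_w (dcov v) (c x).
have [|v w|B Bs bB] := @skew_bilinear_mx R 8 b.
- move=> r v w z; rewrite /b.
  have -> : 'D_z (dcov (r *: v + w)) (c x) = r * 'D_z (dcov v) (c x) + 'D_z (dcov w) (c x).
    (* Linearity of the connection form holds only over the trivializing open set, but a derivative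
       sees only a neighbourhood. *)
    rewrite (@near_eq_derive _ _ _ _ (r *: dcov v + dcov w)); last first.
      apply: filterS nU => u [_ au']; rewrite /dcov local_connection_linear //.
      exact: Im_scale_add.
    rewrite deriveD ?deriveZ //; try exact: diff_derivable.
    by apply: derivableZ; apply: diff_derivable.
  have -> : 'D_(r *: v + w) (dcov z) (c x) = r * 'D_v (dcov z) (c x) + 'D_w (dcov z) (c x).
    by rewrite !(deriveE _ (ddcov _)) linearP.
  exact: linear_combB.
- by rewrite /b opprB.
exists B => //; apply/funext => m; rewrite -bB.
have r0 : row' (0 : 'I_2) m = row 1 m :> 'rV[R]_8.
  apply/rowP => j; rewrite !mxE; congr (m _ _); exact/val_inj.
have r1 : row' (1 : 'I_2) m = row 0 m :> 'rV[R]_8.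
  apply/rowP => j; rewrite !mxE; congr (m _ _); exact/val_inj.
have -> : curvature D x m =
    CD (fun u => local_connection a c u (row 1 m)) (c x) (row 0 m) -
    CD (fun u => local_connection a c u (row 0 m)) (c x) (row 1 m).
  rewrite /curvature /extd big_ord_recl big_ord1.
  have -> : lift ord0 ord0 = 1 :> 'I_2 by apply/val_inj.
  by rewrite r0 r1 expr0 mul1r expr1 mulN1r.
rewrite /CD (Re_connection_closed (row 0 m) (row 1 m) ac cu au).
rewrite /b /dcov.
exact: subc_same_Re.
Qed.

End Curvature.

(** * J-invariance of the curvature and of the metric *)

Section JInvariance.
Variable R : realType.
Local Open Scope complex_scope.

Lemma tr_Jmx : (Jmx R)^T = - Jmx R.
Proof.
rewrite /Jmx [LHS](@tr_block_mx _ 4 4 4 4).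
rewrite (_ : - _ = - (block_mx 0 1%:M (- 1%:M) 0 : 'M[R]_(4 + 4))) //.
by rewrite opp_block_mx !linearN /= !trmx0 !trmx1 !oppr0 opprK.
Qed.

Lemma Jmx2 : Jmx R *m Jmx R = - 1%:M.
Proof.
apply: Zmx_inj; rewrite cmxM -mulmxA cmx_J -scalemxAr cmx_J scalerA -expr2.
by rewrite sqr_i scaleN1r /cmx map_mxN map_mx1 mulNmx mul1mx.
Qed.

Lemma bilinear_mx_eq0 n (A : 'M[R]_n) :
  (forall v w : 'rV_n, (v *m A *m w^T) 0 0 = 0) -> A = 0.
Proof.
move=> A0; apply/matrixP => i j.
have := A0 (delta_mx 0 i) (delta_mx 0 j).
by rewrite -rowE trmx_delta -colE !mxE.
Qed.

Lemma Re_part02 (p q r s : R) :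
  'i%C * p%:C + 'i%C * ('i%C * q%:C) + 'i%C * ('i%C * r%:C) - 'i%C * s%:C = 0 ->
  q + r = 0.
Proof.
by simpc => -[E _]; apply: oppr_inj; rewrite oppr0 opprD -E; ring.
Qed.

(** For F = i B with [B] real, the real part of 4 F^{0,2}(v, w) is -(B(Jv, w) + B(v, Jw)). Its
    vanishing is the commutation with J, since J is skew. *)
Lemma part02_eq0_comm (B : 'M[R]_8) :
  part02 (fun m => 'i%C * ((row 0 m *m B *m (row 1 m)^T) 0 0)%:C) = 0 ->
  Jmx R *m B = B *m Jmx R.
Proof.
move=> F0; apply/eqP; rewrite -subr_eq0 -mulmxN -tr_Jmx; apply/eqP.
apply: bilinear_mx_eq0 => v w.
have := congr1 (fun a : form R 2 => a (col_mx v w : 'M[R]_(1 + 1, 8))) F0.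
rewrite /part02 /= => /eqP; rewrite mulf_eq0 invr_eq0 pnatr_eq0 /=.
have r0 (a b : 'rV[R]_8) : row 0 (col_mx a b : 'M[R]_(1 + 1, 8)) = a.
  apply/rowP => j; rewrite mxE -[RHS](col_mxEu a b 0 j).
  by congr (col_mx _ _ _ _); apply/val_inj.
have r1 (a b : 'rV[R]_8) : row 1 (col_mx a b : 'M[R]_(1 + 1, 8)) = b.
  apply/rowP => j; rewrite mxE -[RHS](col_mxEd a b 0 j).
  by congr (col_mx _ _ _ _); apply/val_inj.
rewrite !r0 !r1 => /eqP/Re_part02 <-.
rewrite mulmxDr mulmxDl mxE trmx_mul.
by rewrite !mulmxA.
Qed.

End JInvariance.

Section CalabiYau.
Variables (R : realType) (X : calabi_yau4 R).

Lemma cy_OmegaE (x : X) :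
  exists2 f : R[i], f != 0 & cy_Omega x = fun m => f * dz4 m.
Proof.
have [f [_ f0 fE]] := cy_Omega_holo (chart_at_atlas x).
have cu : cimg (chart_at x) (chart_at x x) by exists x => //; apply: chart_at_dom.
exists (f (chart_at x x)); first exact: f0.
rewrite -(fE _ cu); apply/funext => m; rewrite /local_form tangent_change1 mulmx1.
by rewrite cfunK //; apply: chart_at_dom.
Qed.

Lemma cy_metric_comm (x : X) : Jmx R *m cy_metric x = cy_metric x *m Jmx R.
Proof.
apply/eqP; rewrite -subr_eq0; apply/eqP/bilinear_mx_eq0 => v w.
have wJJ : - (w *m Jmx R) *m Jmx R = w.
  by rewrite mulNmx -mulmxA Jmx2 mulmxN mulmx1 opprK.
have := cy_metric_J x v (- (w *m Jmx R)); rewrite wJJ /gdot.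
rewrite linearN /= trmx_mul tr_Jmx mulNmx opprK !mulmxA => E.
by rewrite mulmxBr mulmxBl mxE [X in _ + X]mxE !mulmxA E subrr.
Qed.

End CalabiYau.

(** * The Hodge star of products of the dx_j /\ dy_j *)

Lemma sum4 (V : nmodType) (F : 'I_4 -> V) :
  \sum_i F i = F 0 + F 1 + F 2%:R + F 3%:R.
Proof.
rewrite !big_ord_recl big_ord0 addr0 !addrA.
by congr (_ + F _ + F _ + F _); apply/val_inj.
Qed.

Lemma col_sub1_det (K : fieldType) n (f : 'I_n -> 'I_n) : injective f ->
  \det (colsub f (1%:M : 'M[K]_n)) ^+ 2 = 1.
Proof.
move=> fi; rewrite expr2 -{1}det_tr -det_mulmx -[RHS](det1 K n); congr (\det _).
apply/matrixP => i j; rewrite !mxE (bigD1 (f j)) //= big1 => [|k kj].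
  by rewrite !mxE eqxx mulr1 addr0 (inj_eq fi) eq_sym.
by rewrite !mxE (negbTE kj) mulr0.
Qed.

Lemma colsub1_mul (K : pzRingType) m n p (A : 'M[K]_(m, n)) (f : 'I_p -> 'I_n) :
  A *m colsub f 1%:M = colsub f A.
Proof.
by rewrite mulmx_colsub mulmx1.
Qed.

Section Pairs.
Local Open Scope complex_scope.

Definition cx (j : 'I_4) : 'I_8 := lshift 4 j.
Definition cy (j : 'I_4) : 'I_8 := rshift 4 j.

(* The position, among the coordinates (x_0, .., x_3, y_0, .., y_3), of the
   n-th coordinate in the oriented ordering x_0, y_0, .., x_3, y_3. *)
Definition interleave (n : 'I_8) : 'I_8 :=
  if odd n then cy (inord n./2) else cx (inord n./2).

Lemma val_interleave (n : 'I_8) :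
  interleave n = (if odd n then 4 + n./2 else n./2)%N :> nat.
Proof.
have n4 : (n./2 < 4)%N by case: n => [[|[|[|[|[|[|[|[|]]]]]]]]].
by rewrite /interleave; case: ifP => _ /=; rewrite inordK.
Qed.

Lemma interleave3 n : interleave (interleave (interleave n)) = n.
Proof.
apply/val_inj; rewrite /= !val_interleave.
by case: n => [[|[|[|[|[|[|[|[|]]]]]]]]].
Qed.

Lemma interleave_inj : injective interleave.
Proof. by apply: (can_inj (g := interleave \o interleave)) => n; apply: interleave3. Qed.

(* A permutation of order three is even. *)
Lemma det_interleave (K : fieldType) : \det (colsub interleave (1%:M : 'M[K]_8)) = 1.
Proof.
set A := colsub _ _; have A2 : \det A ^+ 2 = 1 by apply/col_sub1_det/interleave_inj.
have A3 : A *m A *m A = 1%:M.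
  rewrite !colsub1_mul; apply/matrixP => i j; rewrite !mxE.
  by rewrite interleave3.
transitivity (\det A ^+ 2 * \det A); first by rewrite A2 mul1r.
by rewrite expr2 -!det_mulmx A3 det1.
Qed.

Definition pair_map (f : 'I_4 -> 'I_4) (n : 'I_8) : 'I_8 :=
  match fintype.split (n : 'I_(4 + 4)) with inl i => cx (f i) | inr i => cy (f i) end.

Lemma pair_map_cx f i : pair_map f (cx i) = cx (f i).
Proof. by rewrite /pair_map (unsplitK (inl _)). Qed.

Lemma pair_map_cy f i : pair_map f (cy i) = cy (f i).
Proof. by rewrite /pair_map (unsplitK (inr _)). Qed.

(** The same index map acts on the x and on the y coordinates, so the determinant is a square and
    the sign of [f] disappears: the 2-forms dx_j /\ dy_j commute. *)
Lemma det_pair_map (K : fieldType) (f : 'I_4 -> 'I_4) :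
  \det (colsub (pair_map f) (1%:M : 'M[K]_8)) = (injectiveb f)%:R.
Proof.
pose F := colsub f (1%:M : 'M[K]_4).
have -> : colsub (pair_map f) (1%:M : 'M[K]_8) =
    (block_mx F 0 0 F : 'M[K]_(4 + 4)).
  rewrite -[1%:M]/(1%:M : 'M[K]_(4 + 4)) scalar_mx_block.
  apply/matrixP => a b; rewrite mxE.
  case: (split_ordP (b : 'I_(4 + 4))) => b' ->.
    rewrite -[lshift 4 b']/(cx b') pair_map_cx.
    case: (split_ordP (a : 'I_(4 + 4))) => a' ->.
      by rewrite /cx !(@block_mxEul _ 4 4 4 4) !mxE.
    by rewrite /cx !(@block_mxEdl _ 4 4 4 4) !mxE.
  rewrite -[rshift 4 b']/(cy b') pair_map_cy.
  case: (split_ordP (a : 'I_(4 + 4))) => a' ->.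
    by rewrite /cy !(@block_mxEur _ 4 4 4 4) !mxE.
  by rewrite /cy !(@block_mxEdr _ 4 4 4 4) !mxE.
rewrite (@det_ublock _ 4 4) -expr2; case: injectiveP => [fi|/injectiveP].
  exact: col_sub1_det.
move=> /injectivePn[i [j ij fij]]; rewrite -det_tr.
rewrite (determinant_alternate ij) ?expr0n // => a.
by rewrite !mxE fij.
Qed.

Variable R : realType.
Local Notation C := R[i].

Definition dxdy (j : 'I_4) : seq 'cV[C]_8 := [:: ecol R (cx j); ecol R (cy j)].

Lemma dform_ecol k (t : 'I_k -> 'I_8) l : (forall i : 'I_k, nth 0 l i = ecol R (t i)) ->
  dform k l = fun m => (\det (colsub t m))%:C.
Proof.
move=> lt; apply/funext => m; rewrite /dform -det_map_mx; congr (\det _).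
by apply/matrixP => a b; rewrite mxE lt /ecol -colE !mxE.
Qed.

Definition tuple4 (i j k l : 'I_4) (n : 'I_4) : 'I_4 := nth 0 [:: i; j; k; l] n.

Lemma tuple4_inj i j k l : injectiveb (tuple4 i j k l) = uniq [:: i; j; k; l].
Proof.
rewrite /injectiveb /dinjectiveb; congr uniq.
rewrite /image_mem (_ : enum _ = [:: 0; 1; 2%:R; 3%:R]) //.
by apply: (inj_map val_inj); rewrite val_enum_ord.
Qed.

(** The list of covectors is [pair_map (tuple4 i j k l)] composed with the even permutation
    [interleave]. *)
Lemma dform_pairs i j k l :
  dform 8 (dxdy i ++ dxdy j ++ dxdy k ++ dxdy l) =
  fun m => (\det m)%:C * (uniq [:: i; j; k; l])%:R.
Proof.
rewrite (@dform_ecol 8 (pair_map (tuple4 i j k l) \o interleave)); last first.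
  case=> [[|[|[|[|[|[|[|[|]]]]]]]] //= n8]; rewrite /interleave /=
    ?pair_map_cx ?pair_map_cy /tuple4 inordK //.
apply/funext => m.
have -> : colsub (pair_map (tuple4 i j k l) \o interleave) m =
    m *m (colsub (pair_map (tuple4 i j k l)) 1%:M *m colsub interleave 1%:M).
  by rewrite mulmxA !colsub1_mul; apply/matrixP => a b; rewrite !mxE.
by rewrite !det_mulmx det_interleave mulr1 det_pair_map tuple4_inj rmorphM rmorph_nat.
Qed.

End Pairs.

Ltac eval_uniq := repeat match goal with |- context [uniq ?s] =>
  let b := eval vm_compute in (uniq s) in change (uniq s) with b end.

Section UniqSums.
Variable K : comPzRingType.
Implicit Types c : 'I_4 -> K.

(** In this and the next two sums the factors 24, 6 and 2 count the orderings of the indices. They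
    serve the fourth power of omega + F, the star of F^3, and the star of omega^2 wedged with a
    2-form. *)
Lemma sum_uniq4 c :
  \sum_i c i * (\sum_j c j * (\sum_k c k * (\sum_l c l *
    (uniq [:: i; j; k; l])%:R))) = 24%:R * \prod_i c i.
Proof.
rewrite !sum4; eval_uniq.
rewrite !big_ord_recl big_ord0.
have e1 : lift ord0 ord0 = 1 :> 'I_4 by apply/val_inj.
have e2 : lift ord0 (lift ord0 ord0) = 2%:R :> 'I_4 by apply/val_inj.
have e3 : lift ord0 (lift ord0 (lift ord0 ord0)) = 3%:R :> 'I_4 by apply/val_inj.
rewrite e1 e2 e3; move: (c 0) (c 1) (c 2%:R) (c 3%:R) => a b d e.
by rewrite /=; ring.
Qed.

Lemma sum_uniq3 c l :
  \sum_i c i * (\sum_j c j * (\sum_k c k * (uniq [:: i; j; k; l])%:R)) =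
  6%:R * \prod_(i | i != l) c i.
Proof.
rewrite !sum4 big_mkcond !big_ord_recl big_ord0.
have e1 : lift ord0 ord0 = 1 :> 'I_4 by apply/val_inj.
have e2 : lift ord0 (lift ord0 ord0) = 2%:R :> 'I_4 by apply/val_inj.
have e3 : lift ord0 (lift ord0 (lift ord0 ord0)) = 3%:R :> 'I_4 by apply/val_inj.
rewrite e1 e2 e3; move: (c 0) (c 1) (c 2%:R) (c 3%:R) => a b d e.
have : l \in [:: 0; 1; 2%:R; 3%:R].
  by case: l => [[|[|[|[|]]]]].
rewrite !inE => /or4P[] /eqP ->; eval_uniq; rewrite /=; ring.
Qed.

Lemma sum_uniq2 c l :
  \sum_i (\sum_j (\sum_k c k * (uniq [:: i; j; k; l])%:R)) =
  2%:R * \sum_(i | i != l) c i.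
Proof.
rewrite !sum4 big_mkcond !big_ord_recl big_ord0.
have e1 : lift ord0 ord0 = 1 :> 'I_4 by apply/val_inj.
have e2 : lift ord0 (lift ord0 ord0) = 2%:R :> 'I_4 by apply/val_inj.
have e3 : lift ord0 (lift ord0 (lift ord0 ord0)) = 3%:R :> 'I_4 by apply/val_inj.
rewrite e1 e2 e3; move: (c 0) (c 1) (c 2%:R) (c 3%:R) => a b d e.
have : l \in [:: 0; 1; 2%:R; 3%:R].
  by case: l => [[|[|[|[|]]]]].
rewrite !inE => /or4P[] /eqP ->; eval_uniq; rewrite /=; ring.
Qed.

End UniqSums.

Lemma uniq4_unique (i j k d e : 'I_4) :
  uniq [:: i; j; k; d] -> uniq [:: i; j; k; e] -> d = e.
Proof.
rewrite -![[:: i; j; k; _]]/(rcons [:: i; j; k] _) !rcons_uniq.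
move=> /andP[ds us] /andP[es _]; apply/eqP; apply: contraT => de.
have u5 : uniq [:: d, e & [:: i; j; k]].
  by rewrite 2!cons_uniq in_cons negb_or de ds es us.
have : (size [:: d; e; i; j; k] <= size (enum 'I_4))%N.
  by apply: uniq_leq_size u5 _ => x _; rewrite mem_enum.
by rewrite size_enum_ord.
Qed.

Lemma uniq3_extend (i j k : 'I_4) : uniq [:: i; j; k] ->
  exists d, uniq [:: i; j; k; d].
Proof.
have m4 (l : 'I_4) : l \in [:: 0; 1; 2%:R; 3%:R] by case: l => [[|[|[|[|]]]]].
have := m4 i; have := m4 j; have := m4 k; rewrite !inE.
do 3!(case/or4P => /eqP ->);
  by [|move=> _; exists 0|move=> _; exists 1|move=> _; exists 2%:R|move=> _; exists 3%:R].
Qed.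

Section StarPairs.
Variable R : realType.
Local Notation C := R[i].
Local Open Scope complex_scope.

Definition pair_col (d : 'I_4) (b : 'I_2) : 'I_8 := if b == 0 then cx d else cy d.

Lemma dform2E d : dform 2 (dxdy R d) = fun m => (\det (colsub (pair_col d) m))%:C.
Proof. by apply: dform_ecol => -[[|[|]] //= ?]. Qed.

Definition pair_row i j k l (b : 'I_8) : 'I_8 :=
  pair_map (tuple4 i j k l) (interleave b).

Lemma pair_rowE i j k l b : pair_row i j k l b =
  (if odd b then cy else cx) (nth 0 [:: i; j; k; l] b./2).
Proof.
have b4 : (b./2 < 4)%N by case: b => [[|[|[|[|[|[|[|[|]]]]]]]]].
rewrite /pair_row /interleave; case: ifP => _;
  by rewrite ?pair_map_cx ?pair_map_cy /tuple4 inordK.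
Qed.

(** The fourth index 0 is a placeholder: the first six positions read only [i], [j] and [k]. *)
Definition pair_row6 i j k (b : 'I_6) : 'I_8 :=
  pair_row i j k 0 (lshift 2 b : 'I_(6 + 2)).

Lemma pair_row6E i j k l (b : 'I_6) :
  pair_row6 i j k b = pair_row i j k l (lshift 2 b : 'I_(6 + 2)).
Proof.
rewrite /pair_row6 !pair_rowE /=; congr (_ _);
by case: b => [[|[|[|[|[|[|]]]]]]].
Qed.

(** If an index repeats, two rows coincide. Otherwise exactly one [d] is missing, and the volume
    form with the other three pairs inserted is dx_d /\ dy_d. *)
Lemma det_pair_row i j k (m : 'M[R]_(2, 8)) :
  \det (col_mx (rowsub (pair_row6 i j k) 1%:M) m : 'M[R]_(6 + 2)) =
  \sum_d \det (colsub (pair_col d) m) * (uniq [:: i; j; k; d])%:R.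
Proof.
have [u3|] := boolP (uniq [:: i; j; k]); last first.
  move=> nu3; rewrite [RHS]big1 => [|d _]; last first.
    suff -> : uniq [:: i; j; k; d] = false by rewrite mulr0.
    apply: contraNF nu3; rewrite -[[:: i; j; k; d]]/(rcons [:: i; j; k] d).
    by rewrite rcons_uniq => /andP[].
  have det0 (a b : 'I_6) : a != b -> pair_row6 i j k a = pair_row6 i j k b ->
      \det (col_mx (rowsub (pair_row6 i j k) 1%:M) m : 'M[R]_(6 + 2)) = 0.
    move=> ab E; apply: (@determinant_alternate _ _ _ (lshift 2 a) (lshift 2 b)).
      by rewrite (inj_eq (@lshift_inj _ _)).
    by move=> c; rewrite !col_mxEu !mxE /= E.
  move: nu3; rewrite /= !inE andbT !(negb_or, negb_and, negbK) => /orP[/orP[]|] /eqP E.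
  - apply: (det0 (inord 0) (inord 2)); first by rewrite -val_eqE /= !inordK.
    by rewrite /pair_row6 !pair_rowE /= !inordK //= E.
  - apply: (det0 (inord 0) (inord 4)); first by rewrite -val_eqE /= !inordK.
    by rewrite /pair_row6 !pair_rowE /= !inordK //= E.
  - apply: (det0 (inord 2) (inord 4)); first by rewrite -val_eqE /= !inordK.
    by rewrite /pair_row6 !pair_rowE /= !inordK //= E.
have [d ud] := uniq3_extend u3.
rewrite (bigD1 d) // ud mulr1 big1 ?Monoid.mulm1 => [|e ed]; last first.
  case ue: (uniq [:: i; j; k; e]); last by rewrite mulr0.
  by rewrite (uniq4_unique ue ud) eqxx in ed.
pose T := pair_row i j k d; pose N := colsub T (1%:M : 'M[R]_8).
have detN : \det N = 1.
  have -> : N = colsub (pair_map (tuple4 i j k d)) 1%:M *m colsub interleave 1%:M.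
    by rewrite colsub1_mul; apply/matrixP => a b; rewrite !mxE.
  by rewrite det_mulmx det_interleave mulr1 det_pair_map tuple4_inj ud.
have Tinj : injective T.
  move=> a b Tab; apply/eqP; apply: contraT => ab.
  have : \det N = 0.
    by rewrite -det_tr (determinant_alternate ab) // => c; rewrite !mxE Tab.
  by rewrite detN => /eqP; rewrite oner_eq0.
(* The columns are reordered by [N], of determinant 1, so that the six inserted frame vectors become
   the first six basis vectors. *)
transitivity (\det (block_mx 1%:M 0 (lsubmx (m *m N : 'M[R]_(2, 6 + 2)))
      (rsubmx (m *m N : 'M[R]_(2, 6 + 2))) : 'M[R]_(6 + 2))).
  rewrite -[LHS]mulr1 -[X in _ * X]detN -[LHS](@det_mulmx _ 8); congr (\det _).
  rewrite [LHS]colsub1_mul; apply/matrixP => a b; rewrite mxE.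
  case: (split_ordP (a : 'I_(6 + 2))) => a' ->.
    rewrite [LHS](@col_mxEu _ 6 2 8) [LHS]mxE [LHS]mxE (pair_row6E _ _ _ d) (inj_eq Tinj).
    case: (split_ordP (b : 'I_(6 + 2))) => b' ->.
      by rewrite [RHS](@block_mxEul _ 6 2 6 2) mxE.
    by rewrite [RHS](@block_mxEur _ 6 2 6 2) mxE (eq_lrshift a' b' : _ = false).
  rewrite [LHS](@col_mxEd _ 6 2 8) colsub1_mul.
  case: (split_ordP (b : 'I_(6 + 2))) => b' ->.
    by rewrite [RHS](@block_mxEdl _ 6 2 6 2) !mxE.
  by rewrite [RHS](@block_mxEdr _ 6 2 6 2) !mxE.
rewrite det_lblock det1 mul1r colsub1_mul; congr (\det _).
apply/matrixP => a b; rewrite !mxE /T pair_rowE; congr (m _ _).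
by case: b => [[|[|]]].
Qed.

Lemma star_pairs (G P Q : 'M[R]_8) (vol : form R 8) i j k :
  P *m G *m P^T = 1%:M -> P *m Q = 1%:M ->
  (forall n, vol n = (\det (n *m Q))%:C) ->
  pullback P (@star R G 6 2 vol (pullback Q (dform 6 (dxdy R i ++ dxdy R j ++ dxdy R k)))) =
  fun m => \sum_d dform 2 (dxdy R d) m * (uniq [:: i; j; k; d])%:R.
Proof.
move=> PG PQ hv; apply/funext => m.
rewrite (@star_dform _ (pair_row6 i j k) _ G P Q) //; last first.
  by case=> [[|[|[|[|[|[|]]]]]] //= ?]; rewrite /pair_row6 pair_rowE.
rewrite det_pair_row rmorph_sum; apply: eq_bigr => d _.
by rewrite rmorphM rmorph_nat dform2E.
Qed.

End StarPairs.

(** * The forms omega, F and Omega in a unitary frame *)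

Lemma det2 (K : comPzRingType) (A : 'M[K]_2) :
  \det A = A 0 0 * A 1 1 - A 0 1 * A 1 0.
Proof.
rewrite (expand_det_row _ 0) big_ord_recl big_ord1 /cofactor !det_mx11 !mxE.
have -> : lift ord0 ord0 = 1 :> 'I_2 by apply/val_inj.
have -> : lift 1 0 = 0 :> 'I_2 by apply/val_inj.
by rewrite /= expr0 mul1r expr1; ring.
Qed.

Section KahlerAlgebra.
Variable R : realType.
Local Notation C := R[i].
Local Open Scope complex_scope.

(* In a unitary frame, the form sum_j c_j dx_j /\ dy_j. *)
Definition diag2 (c : 'I_4 -> C) : form R 2 :=
  fun m => \sum_j c j * dform 2 (dxdy R j) m.

Lemma skew_block_diag2 (l : 'rV[R]_4) :
  (fun m : 'M[R]_(2, 8) => ((row 0 m *m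
      (block_mx 0 (diag_mx l) (- diag_mx l) 0 : 'M[R]_(4 + 4)) *m (row 1 m)^T) 0 0)%:C) =
  diag2 (fun j => (l 0 j)%:C).
Proof.
apply/funext => m; have [u [w E0]] := row_mx8 (row 0 m).
have [u' [w' E1]] := row_mx8 (row 1 m).
have entry v (z z' : 'rV[R]_4) k : row v m = (row_mx z z' : 'M[R]_(1, 4 + 4)) ->
    m v (cx k) = z 0 k /\ m v (cy k) = z' 0 k.
  move=> /rowP E; have := E (cx k); have := E (cy k).
  by rewrite (row_mxEl z z') (row_mxEr z z') !mxE.
rewrite E0 E1.
rewrite (@mul_row_block _ 1 4 4 4 4) (@tr_row_mx _ 1 4 4) (@mul_row_col _ 1 4 4 1).
rewrite !mulmx0 add0r addr0 mulmxN mulNmx !mul_mx_diag.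
rewrite mxE [X in X + _]mxE mxE [X in _ + X]mxE -sumrN -big_split rmorph_sum.
apply: eq_bigr => j _; rewrite dform2E -rmorphM /=; congr (_%:C).
rewrite det2 !mxE /pair_col /=.
have [-> ->] := entry 0 u w j E0; have [-> ->] := entry 1 u' w' j E1.
ring.
Qed.

Lemma pullback_kahler_form (G P : 'M[R]_8) :
  P *m G *m P^T = 1%:M -> Jmx R *m P = P *m Jmx R ->
  pullback P (kahler_form G) = diag2 (fun=> 1).
Proof.
move=> PG JP.
rewrite (_ : (fun=> 1) = fun j => ((const_mx 1 : 'rV[R]_4) 0 j)%:C); last first.
  by apply/funext => j; rewrite mxE.
rewrite -skew_block_diag2 diag_const_mx; apply/funext => m.
rewrite /pullback /kahler_form /gdot !row_mul; congr ((_ 0 0)%:C).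
rewrite trmx_mul -!mulmxA; congr (_ *m _); rewrite !mulmxA; congr (_ *m _).
by rewrite -JP -!(mulmxA (Jmx R)) PG mulmx1.
Qed.

Lemma wedge_diag2l q c (b : form R q) :
  wedge (diag2 c) b = fun m => \sum_i c i * wedge (dform 2 (dxdy R i)) b m.
Proof. exact: (wedge_suml _ _ c (fun j => dform 2 (dxdy R j))). Qed.

(** The empty tail and the degree [2 + 0] come from the zeroth power, the constant 1, which is the
    empty determinant. *)
Lemma wexp_diag2_1 c : wexp (diag2 c) 1 =
  fun m => \sum_i c i * dform (2 + 0) (dxdy R i ++ [::]) m.
Proof.
have E : wexp (diag2 c) 0 = dform 0 [::].
  by apply/funext => m; rewrite /dform det_mx00.
rewrite -[LHS]/(wedge (diag2 c) (wexp (diag2 c) 0)) E wedge_diag2l; apply/funext => m; apply: eq_bigr => i _.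
by rewrite wedge_dform.
Qed.

Lemma wexp_diag2_2 c : wexp (diag2 c) 2 =
  fun m => \sum_i c i * \sum_j c j * dform (2 + (2 + 0)) (dxdy R i ++ dxdy R j ++ [::]) m.
Proof.
rewrite -[LHS]/(wedge (diag2 c) (wexp (diag2 c) 1)) wexp_diag2_1 wedge_diag2l.
apply/funext => m; apply: eq_bigr => i _; congr (_ * _).
by rewrite wedge_sumr; apply: eq_bigr => j _; rewrite wedge_dform.
Qed.

Lemma wexp_diag2_3 c : wexp (diag2 c) 3 =
  fun m => \sum_i c i * \sum_j c j * \sum_k c k *
    dform (2 + (2 + (2 + 0))) (dxdy R i ++ dxdy R j ++ dxdy R k ++ [::]) m.
Proof.
rewrite -[LHS]/(wedge (diag2 c) (wexp (diag2 c) 2)) wexp_diag2_2 wedge_diag2l.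
apply/funext => m; apply: eq_bigr => i _; congr (_ * _).
rewrite wedge_sumr; apply: eq_bigr => j _; congr (_ * _).
by rewrite wedge_sumr; apply: eq_bigr => k _; rewrite wedge_dform.
Qed.

Lemma wexp_diag2_4 c : wexp (diag2 c) 4 =
  fun m => 24%:R * \prod_i c i * (\det m)%:C.
Proof.
rewrite -[LHS]/(wedge (diag2 c) (wexp (diag2 c) 3)) wexp_diag2_3 wedge_diag2l.
apply/funext => m.
transitivity (\sum_i c i * (\sum_j c j * (\sum_k c k * (\sum_l c l *
    (uniq [:: i; j; k; l])%:R))) * (\det m)%:C).
  apply: eq_bigr => i _; rewrite -mulrA; congr (_ * _).
  rewrite wedge_sumr big_distrl; apply: eq_bigr => j _ /=; rewrite -mulrA; congr (_ * _).
  rewrite wedge_sumr big_distrl; apply: eq_bigr => k _ /=; rewrite -mulrA; congr (_ * _).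
  rewrite wedge_sumr big_distrl; apply: eq_bigr => l _ /=; rewrite -mulrA; congr (_ * _).
  rewrite wedge_dform // -[LHS]/(dform 8 (dxdy R i ++ dxdy R j ++ dxdy R k ++ dxdy R l) m).
  by rewrite dform_pairs mulrC.
by rewrite -big_distrl sum_uniq4.
Qed.

End KahlerAlgebra.

Lemma mul_col (K : pzRingType) m n p (A : 'M[K]_(m, n)) (B : 'M[K]_(n, p)) j :
  col j (A *m B) = A *m col j B.
Proof. by rewrite !colE mulmxA. Qed.

Section HolomorphicVolume.
Variable R : realType.
Local Notation C := R[i].
Local Open Scope complex_scope.

(** For [t] equal to i this is dz^j, for -i its conjugate; one computation in [t] serves both. The
    explicit coefficient 1 matches [dform_lin]. *)
Definition zcol (t : C) (j : 'I_4) : 'cV[C]_8 :=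
  1 *: ecol R (cx j) + t *: ecol R (cy j).

Definition zcols (t : C) : seq 'cV[C]_8 :=
  [:: zcol t 0; zcol t 1; zcol t 2%:R; zcol t 3%:R].

Lemma nth_zcols t (b : 'I_4) : nth 0 (zcols t) b = zcol t b.
Proof. by case: b => [[|[|[|[|]]]] //= ?]; congr zcol; apply/val_inj. Qed.

Lemma zcolE t (b : 'I_4) :
  zcol t b = col b (col_mx 1%:M t%:M : 'M[C]_(4 + 4, 4)).
Proof.
apply/matrixP => a o; rewrite ord1 !mxE mul1r.
case: (split_ordP (a : 'I_(4 + 4))) => a' ->.
  have ab : (lshift 4 a' == cy b :> 'I_8) = false by apply: eq_lrshift.
  by rewrite !mxE !eqxx !andbT ab mulr0 addr0.
have ab : (rshift 4 a' == cx b :> 'I_8) = false by rewrite eq_sym; apply: eq_lrshift.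
by rewrite !mxE !eqxx !andbT ab add0r mulr_natr.
Qed.

Lemma dform_zcols t (m : 'M[R]_(4, 8)) :
  dform 4 (zcols t) m = \det (cmx m *m (col_mx 1%:M t%:M : 'M[C]_(4 + 4, 4))).
Proof.
by congr (\det _); apply/matrixP => a b; rewrite mxE nth_zcols zcolE -mul_col mxE.
Qed.

Lemma dz4_dform : @dz4 R = dform 4 (zcols 'i%C).
Proof. by apply/funext => m; rewrite dform_zcols dz4E. Qed.

Lemma conj_dz4_dform : form_conj (@dz4 R) = dform 4 (zcols (- 'i%C)).
Proof.
apply/funext => m; rewrite dform_zcols /form_conj dz4E.
rewrite -[LHS]/((conjc : {rmorphism C -> C}) _) -det_map_mx map_mxM.
congr (\det (_ *m _)).
  by apply/matrixP => a b; rewrite !mxE; apply: conjc_real.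
rewrite /Zmx (@map_col_mx _ _ _ 4 4 4) map_mx1 map_scalar_mx.
by congr (@col_mx _ 4 4 4 _ (_%:M)); apply/eqP; rewrite eq_complex /= oppr0 !eqxx.
Qed.

Lemma dz4_wedge_conj (m : 'M[R]_(4 + 4, 8)) :
  wedge (@dz4 R) (form_conj (@dz4 R)) m = 16%:R * (\det (m : 'M[R]_8))%:C.
Proof.
rewrite conj_dz4_dform dz4_dform wedge_dform // /dform.
pose N : 'M[C]_(4 + 4) := block_mx 1%:M 1%:M ('i%C)%:M (- 'i%C)%:M.
transitivity (\det (cmx m *m (N : 'M[C]_8))).
  congr (\det _); apply/matrixP => a b; rewrite mxE nth_cat -[size _]/4%N.
  case: (split_ordP (b : 'I_(4 + 4))) => b' -> /=.
    rewrite nth_zcols zcolE -mul_col mxE /N block_mxEh.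
    by rewrite (@mul_mx_row _ 8 8 4 4) row_mxEl.
  rewrite addKn nth_zcols zcolE -mul_col mxE /N block_mxEh.
  by rewrite (@mul_mx_row _ 8 8 4 4) row_mxEr.
rewrite det_mulmx mulrC det_map_mx; congr (_ * _).
(* Row reduction by [L] makes [N] block triangular with lower block -2i, whence the factor (-2i)^4 =
   16. *)
pose L : 'M[C]_(4 + 4) := block_mx 1%:M 0 (- 'i%C)%:M 1%:M.
have detL : \det L = 1 by rewrite det_lblock !det1 mulr1.
rewrite -[LHS]mul1r -[X in X * _]detL -[LHS](@det_mulmx _ 8) [_ *m _](@mulmx_block _ 4 4 4 4 4 4).
rewrite !mul1mx !mul0mx !addr0 !mulmx1.
have -> : (- 'i%C)%:M + ('i%C)%:M = 0 :> 'M[C]_4 by rewrite -raddfD addNr raddf0.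
rewrite (@det_ublock _ 4 4) det1 mul1r -raddfD det_scalar.
transitivity (16%:R * ('i%C ^+ 2) ^+ 2 : C); first by ring.
by rewrite sqr_i; ring.
Qed.

(** The covector [zcol t j] lies in the span of dx_j and dy_j, which occupy the last two positions 4
    and 5, so each of its two parts repeats a covector. *)
Lemma dform_zcol_pr t j l1 l2 : (size l1 + size l2 = 3)%N ->
  dform 6 (l1 ++ zcol t j :: (l2 ++ dxdy R j)) = fun=> 0.
Proof.
move=> s12; have s1 : (size l1 < 6)%N by lia.
have s4 : (4 - size l1)%N = (size l2).+1 by lia.
have s5 : (5 - size l1)%N = (size l2).+2 by lia.
have l14 : (4 < size l1)%N = false by lia.
have l15 : (5 < size l1)%N = false by lia.
rewrite /zcol dform_lin //; apply/funext => m.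
rewrite (@dform_dup _ 6 _ (Ordinal s1) (inord 4)); first last.
- by rewrite inordK //= !nth_cat ltnn subnn l14 s4 /= nth_cat ltnn subnn.
- by rewrite -val_eqE /= inordK // neq_ltn -subn_gt0 s4.
rewrite (@dform_dup _ 6 _ (Ordinal s1) (inord 5)); first last.
- by rewrite inordK //= !nth_cat ltnn subnn l15 s5 /= nth_cat ltnNge leqnSn subSnn.
- by rewrite -val_eqE /= inordK // neq_ltn -subn_gt0 s5.
by rewrite !mulr0 addr0.
Qed.

Lemma dform_zcols_pr t j : dform 6 (zcols t ++ dxdy R j) = fun=> 0.
Proof.
have : j \in [:: 0; 1; 2%:R; 3%:R] by case: j => [[|[|[|[|]]]]].
rewrite !inE => /or4P[] /eqP ->.
- exact: (@dform_zcol_pr t 0 [::] [:: zcol t 1; zcol t 2%:R; zcol t 3%:R]).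
- exact: (@dform_zcol_pr t 1 [:: zcol t 0] [:: zcol t 2%:R; zcol t 3%:R]).
- exact: (@dform_zcol_pr t 2%:R [:: zcol t 0; zcol t 1] [:: zcol t 3%:R]).
- exact: (@dform_zcol_pr t 3%:R [:: zcol t 0; zcol t 1; zcol t 2%:R] [::]).
Qed.

(** A form of type (4,0) or (0,4) kills every (1,1)-form in complex dimension 4. Hence Re Omega does
    not contribute to pi^2_7 of such forms. *)
Lemma Re_dz4_wedge c : wedge (form_Re (@dz4 R)) (diag2 c) = fun=> 0.
Proof.
have -> : form_Re (@dz4 R) = fun m => \sum_(b : bool)
    2%:R^-1 * dform 4 (zcols (if b then 'i%C else - 'i%C)) m.
  apply/funext => m; rewrite big_bool /= -conj_dz4_dform -dz4_dform -mulrDr.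
  by rewrite /form_Re ReJ_add mulrC.
rewrite (wedge_suml _ _ (fun=> 2%:R^-1)
  (fun b : bool => dform 4 (zcols (if b then 'i%C else - 'i%C)))).
apply/funext => m; apply: big1 => b _; rewrite /diag2 wedge_sumr big1 ?mulr0 //.
move=> j _; rewrite wedge_dform // -[dform _ _ m]/(dform 6 (zcols _ ++ dxdy R j) m).
by rewrite dform_zcols_pr mulr0.
Qed.

End HolomorphicVolume.

(** * The equation F^1 = 0 *)

Lemma star_sum (R : realType) k l (G : 'M[R]_8) (vol : form R (k + l))
    (I : finType) (c : I -> R[i]) (a : I -> form R k) :
  star G vol (fun m => \sum_i c i * a i m) =
  fun m => \sum_i c i * star G vol (a i) m.
Proof.
apply/funext => m; rewrite /star.
under [RHS]eq_bigr => i _ do rewrite mulrCA big_distrr.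
rewrite -big_distrr; congr (_ * _); rewrite [RHS]exchange_big /=; apply: eq_bigr => f _.
under [RHS]eq_bigr => i _ do rewrite big_distrr.
rewrite [RHS]exchange_big /=; apply: eq_bigr => g _.
rewrite mulr_suml mulr_sumr; apply: eq_bigr => i _.
by rewrite -mulrA mulrCA.
Qed.

Section Phase.
Variables (R : realType) (G P Q : 'M[R]_8) (l : 'rV[R]_4) (vol : form R 8)
  (Om : form R 4) (F : form R 2).
Local Notation C := R[i].
Local Open Scope complex_scope.
Hypothesis PG : P *m G *m P^T = 1%:M.
Hypothesis PQ : P *m Q = 1%:M.
Hypothesis JP : Jmx R *m P = P *m Jmx R.
Hypothesis volE : forall n, vol n = (\det (n *m Q))%:C.
Hypothesis OmE : pullback P Om = @dz4 R.
Let u (j : 'I_4) : C := 'i%C * (l 0 j)%:C.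
Hypothesis FE : pullback P F = diag2 u.

Lemma pullbackK k (a : form R k) : pullback Q (pullback P a) = a.
Proof.
by apply/funext => m; rewrite /pullback -mulmxA (mulmx1C PQ) mulmx1.
Qed.

Lemma pullback_eq k (a b : form R k) : pullback P a = pullback P b -> a = b.
Proof. by move=> /(congr1 (pullback Q)); rewrite !pullbackK. Qed.

Definition star6 (a : form R 6) : form R 2 :=
  pullback P (@star R G 6 2 vol (pullback Q a)).

Lemma star6_sum (I : finType) (c : I -> C) (a : I -> form R 6) :
  star6 (fun m => \sum_i c i * a i m) = fun m => \sum_i c i * star6 (a i) m.
Proof.
by rewrite /star6 /pullback (star_sum _ _ c (fun i m => a i (m *m Q))).
Qed.

Lemma star6_pairs i j k :
  star6 (dform 6 (dxdy R i ++ dxdy R j ++ dxdy R k)) =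
  diag2 (fun d => (uniq [:: i; j; k; d])%:R).
Proof.
rewrite /star6 (star_pairs _ _ _ PG PQ volE); apply/funext => m.
by apply: eq_bigr => d _; rewrite mulrC.
Qed.

Lemma star6_pairs_sum (a b c : 'I_4 -> C) :
  star6 (fun m => \sum_i a i * \sum_j b j * \sum_k c k *
    dform 6 (dxdy R i ++ dxdy R j ++ dxdy R k) m) =
  diag2 (fun d => \sum_i a i * (\sum_j b j * (\sum_k c k *
    (uniq [:: i; j; k; d])%:R))).
Proof.
rewrite star6_sum; apply/funext => m; rewrite /diag2.
under [RHS]eq_bigr => d _ do rewrite big_distrl.
rewrite exchange_big; apply: eq_bigr => i _ /=.
under [RHS]eq_bigr => d _ do rewrite -mulrA.
rewrite -big_distrr star6_sum; congr (_ * _).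
under [RHS]eq_bigr => d _ do rewrite big_distrl.
rewrite exchange_big; apply: eq_bigr => j _ /=.
under [RHS]eq_bigr => d _ do rewrite -mulrA.
rewrite -big_distrr star6_sum; congr (_ * _).
under [RHS]eq_bigr => d _ do rewrite big_distrl.
rewrite exchange_big; apply: eq_bigr => k _ /=.
under [RHS]eq_bigr => d _ do rewrite -mulrA.
by rewrite -big_distrr star6_pairs.
Qed.

Lemma pullback_F3 :
  pullback P (fun m => F m + 6%:R^-1 * @star R G 6 2 vol (wexp F 3) m) =
  diag2 (fun d => u d + \prod_(j | j != d) u j).
Proof.
have F3 : wexp F 3 = pullback Q (wexp (diag2 u) 3).
  by rewrite -FE -pullback_wexp pullbackK.
apply/funext => m.
transitivity (pullback P F m + 6%:R^-1 * star6 (wexp (diag2 u) 3) m).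
  by rewrite F3.
rewrite FE wexp_diag2_3 star6_pairs_sum /diag2 big_distrr -big_split.
apply: eq_bigr => d _ /=; rewrite sum_uniq3 [RHS]mulrDl.
by rewrite !mulrA mulVf ?mul1r ?pnatr_eq0.
Qed.

Let Phi : form R 4 :=
  fun m => 2%:R^-1 * wexp (kahler_form G) 2 m + form_Re Om m.

(** The star of omega^2 / 2 wedged with the form replaces each coefficient by the sum of the other
    three. Adding the form itself completes this to the full trace, whatever the position. *)
Lemma pullback_pi27 (A : form R 2) (a : 'I_4 -> C) : pullback P A = diag2 a ->
  pullback P (pi27 G vol Phi A) = diag2 (fun=> 4%:R^-1 * \sum_j a j).
Proof.
move=> AE.
have PhiA : pullback P (wedge Phi A) = fun m => \sum_i 2%:R^-1 *
    \sum_j 1 * \sum_k a k * dform 6 (dxdy R i ++ dxdy R j ++ dxdy R k) m.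
  rewrite pullback_wedge AE.
  (* The two summands of Phi are indexed by [bool] so that [wedge_suml] distributes over them. *)
  have -> : pullback P Phi = fun m => \sum_(b : bool) (if b then 2%:R^-1 else 1) *
      (if b then wexp (diag2 (fun=> 1)) 2 else form_Re (@dz4 R)) m.
    apply/funext => m; rewrite big_bool mul1r -(pullback_kahler_form PG JP).
    by rewrite -pullback_wexp -OmE.
  rewrite (wedge_suml _ _ (fun b : bool => if b then 2%:R^-1 else 1)
    (fun b : bool => if b then wexp (diag2 (fun=> 1)) 2 else form_Re (@dz4 R))).
  apply/funext => m; rewrite big_bool /= Re_dz4_wedge mulr0 addr0.
  rewrite -[LHS]/(2%:R^-1 * wedge (wexp (diag2 (fun=> 1)) 2 : form R 4) (diag2 a) m).
  rewrite wexp_diag2_2 wedge_suml big_distrr; apply: eq_bigr => i _; congr (_ * _).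
  rewrite mul1r wedge_suml; apply: eq_bigr => j _.
  congr (_ * _); rewrite wedge_sumr; apply: eq_bigr => k _.
  by rewrite wedge_dform.
apply/funext => m.
transitivity (4%:R^-1 * (pullback P A m + star6 (pullback P (wedge Phi A)) m)).
  by rewrite /star6 pullbackK.
rewrite AE PhiA star6_pairs_sum /diag2 -big_split big_distrr.
apply: eq_bigr => d _ /=; rewrite -mulrDl mulrA; congr (_ * _ * _).
transitivity (a d + 2%:R^-1 * (2%:R * \sum_(i | i != d) a i)).
  rewrite -sum_uniq2 big_distrr; congr (_ + _); apply: eq_bigr => i _.
  by congr (_ * _); apply: eq_bigr => j _; rewrite mul1r.
by rewrite mulrA mulVf ?pnatr_eq0 // mul1r [RHS](bigD1 d).
Qed.

Lemma diag2_const_eq0 (c : C) : diag2 (fun=> c) = (fun=> 0 : C) -> c = 0.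
Proof.
pose m : 'M[R]_(2, 8) := rowsub (pair_col 0) 1%:M.
move=> /(congr1 (fun a : form R 2 => a m)); rewrite /diag2 -big_distrr /=.
have xx i j : (cx i == cx j) = (i == j) := inj_eq (@lshift_inj 4 4) i j.
have -> : \sum_i dform 2 (dxdy R i) m = 1; last by rewrite mulr1.
rewrite (bigD1 0) //= big1 ?addr0 => [|j j0]; rewrite dform2E det2 !mxE /pair_col /=.
  by rewrite mulr1 mul0r subr0.
by rewrite xx eq_sym (negbTE j0) !mul0r subrr.
Qed.

Lemma pi27_eq0 :
  pi27 G vol Phi (fun m => F m + 6%:R^-1 * @star R G 6 2 vol (wexp F 3) m) = 0 <->
  \sum_j (u j + \prod_(i | i != j) u i) = 0.
Proof.
have E := pullback_pi27 pullback_F3; split => [F0|S0].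
  move: E; rewrite F0 => /esym/diag2_const_eq0/eqP.
  by rewrite mulf_eq0 invr_eq0 pnatr_eq0 => /eqP.
apply: pullback_eq; rewrite E S0 mulr0; apply/funext => m.
by rewrite /diag2 big1 // => j _; rewrite mul0r.
Qed.

Lemma wexp4_Im_eq0 :
  (forall m, complex.Im (wexp (kahler_form G + F) 4 m) = 0) <->
  complex.Im (\prod_j (1 + u j)) = 0.
Proof.
have E : pullback P (wexp (kahler_form G + F) 4) =
    fun m => 24%:R * \prod_j (1 + u j) * (\det m)%:C.
  rewrite pullback_wexp -wexp_diag2_4; congr (wexp _ 4).
  rewrite -[LHS]/(pullback P (kahler_form G) + pullback P F).
  rewrite (pullback_kahler_form PG JP) FE; apply/funext => m.
  rewrite -[LHS]/(diag2 (fun=> 1) m + diag2 u m) /diag2 -big_split.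
  by apply: eq_bigr => j _; rewrite /= -mulrDl.
have Im24 (z : C) (r : R) : complex.Im (24%:R * z * r%:C) = 24%:R * complex.Im z * r.
  rewrite -[24%:R](rmorph_nat (real_complex R)); case: z => p q /=.
  by rewrite !(mul0r, mulr0, add0r, addr0).
split=> [W0|P0 m].
  (* On the frame itself the determinant is 1. *)
  have := W0 P; rewrite -[X in wexp _ 4 X]mul1mx -[wexp _ _ _]/(pullback P (wexp (kahler_form G + F) 4) 1%:M).
  rewrite E det1 Im24 mulr1 => /eqP.
  by rewrite mulf_eq0 pnatr_eq0 => /eqP.
rewrite -[m]mulmx1 -(mulmx1C PQ) mulmxA.
rewrite -[wexp _ _ _]/(pullback P (wexp (kahler_form G + F) 4) (m *m Q)).
by rewrite E Im24 P0 mulr0 mul0r.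
Qed.

(** For imaginary u_j the elementary symmetric functions of even degree are real and those of odd
    degree imaginary. The left-hand side is the sum of those of degrees 1 and 3. *)
Lemma Im_prod_sum : \sum_j (u j + \prod_(i | i != j) u i) =
  'i%C * (complex.Im (\prod_j (1 + u j)))%:C.
Proof.
under [LHS]eq_bigr => j _ do rewrite big_mkcond.
rewrite !big_ord_recl !big_ord0 /= !(mulr1, mul1r, addr0) /u.
move: (l 0 _) (l 0 _) (l 0 _) (l 0 _) => a b d e.
by apply/eqP; rewrite eq_complex /=; apply/andP; split; apply/eqP; ring.
Qed.

Lemma pi27_eq0_iff_wexp4 :
  (forall m, complex.Im (wexp (kahler_form G + F) 4 m) = 0) <->
  pi27 G vol Phi (fun m => F m + 6%:R^-1 * @star R G 6 2 vol (wexp F 3) m) = 0.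
Proof.
rewrite wexp4_Im_eq0 pi27_eq0 Im_prod_sum; split => [->|/eqP]; first by rewrite mulr0.
by rewrite mulf_eq0 => /orP[/eqP[/eqP]|/eqP[]] //; rewrite oner_eq0.
Qed.

End Phase.

(** * The bundle Lambda^4_7 and the equation F^2 = 0 *)

Section ReplaceRows.
Variable R : realType.
Local Notation C := R[i].
Local Open Scope complex_scope.

(* The summands of the action of A as a derivation. *)
Definition replace_row k (m : 'M[R]_(k, 8)) (A : 'M[R]_8) (c : 'I_k) : 'M[R]_(k, 8) :=
  \matrix_(a, j) (if a == c then (m *m A) a j else m a j).

(** The derivation is defined on vectors, but on monomials in covectors it has to be computed
    covector by covector; [det_replace] trades one for the other. *)
Lemma sum_replace_row k l (m : 'M[R]_(k, 8)) (A : 'M[R]_8) :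
  \sum_c dform k l (replace_row m A c) =
  \sum_(b < k) dform k (set_nth 0 l b (cmx A *m nth 0 l b)) m.
Proof.
pose N : 'M[C]_k := \matrix_(a, b) (cmx m *m nth 0 l b) a 0.
pose N' : 'M[C]_k := \matrix_(a, b) (cmx m *m (cmx A *m nth 0 l b)) a 0.
transitivity (\sum_c \det (\matrix_(a, b) (if a == c then N' a b else N a b))).
  apply: eq_bigr => c _; congr (\det _); apply/matrixP => a b; rewrite !mxE.
  case: eqP => [->|/eqP ac].
    transitivity ((cmx m *m (cmx A *m nth 0 l b)) c 0); last by rewrite mxE.
    rewrite mulmxA -cmxM mxE; apply: eq_bigr => j _.
    by rewrite !mxE eqxx.
  by apply: eq_bigr => j _; rewrite !mxE (negbTE ac).
rewrite det_replace; apply: eq_bigr => c _; congr (\det _); apply/matrixP => a b.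
by rewrite mxE [RHS]mxE nth_set_nth /= val_eqE; case: eqP => [->|_]; rewrite mxE.
Qed.

Lemma dformZ k (l1 l2 : seq 'cV[C]_8) (c : C) (x : 'cV[C]_8) : (size l1 < k)%N ->
  dform k (l1 ++ (c *: x) :: l2) = fun m => c * dform k (l1 ++ x :: l2) m.
Proof.
move=> sk; apply/funext => m; rewrite -[c *: x]addr0 -[X in _ + X](scale0r x).
by rewrite dform_lin // mul0r addr0.
Qed.

Lemma dform_swap k (l1 l2 : seq 'cV[C]_8) x y : ((size l1).+1 < k)%N ->
  dform k (l1 ++ x :: y :: l2) = fun m => - dform k (l1 ++ y :: x :: l2) m.
Proof.
move=> sk; pose i := Ordinal (ltnW sk); pose j := Ordinal sk.
have ij : i != j by rewrite -val_eqE /= neq_ltn ltnSn.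
rewrite (@dform_perm _ k (l1 ++ y :: x :: l2) _ (tperm i j)) => [|c].
  by apply/funext => m; rewrite odd_tperm ij expr1 mulN1r.
rewrite !nth_cat; case: tpermP => [->|->|/eqP ci /eqP cj] /=.
- by rewrite ltnn subnn ltnNge leqnSn subSnn.
- by rewrite ltnn subnn ltnNge leqnSn subSnn.
have := ci; have := cj; rewrite -!val_eqE /=; case: ltnP => // lc cj' ci'.
by have -> : (c - size l1 = (c - size l1 - 2).+2)%N by lia.
Qed.

Lemma dform_interior k l (v : 'rV[R]_8) (m : 'M[R]_(k, 8)) : size l = k.+1 ->
  dform k.+1 l (col_mx v m : 'M[R]_(1 + k, 8)) =
  \sum_(b < k.+1) (-1) ^+ b * (cmx v *m nth 0 l b) 0 0 *
    dform k (take b l ++ drop b.+1 l) m.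
Proof.
move=> sl; rewrite {1}/dform (expand_det_row _ 0); apply: eq_bigr => b _.
rewrite mxE /cofactor add0n mulrCA mulrA; congr (_ * _ * _).
  rewrite [LHS]mxE [RHS]mxE; apply: eq_bigr => j _; congr (_ * _).
  rewrite [LHS]mxE [RHS]mxE; congr (_%:C).
  rewrite -[RHS](col_mxEu v m 0 j); congr (col_mx _ _ _ _); exact/val_inj.
congr (\det _); apply/matrixP => a d; rewrite [LHS]mxE [LHS]mxE [LHS]mxE [LHS]mxE [RHS]mxE [RHS]mxE.
have -> : nth 0 l (lift b d) = nth 0 (take b l ++ drop b.+1 l) d.
  rewrite nth_cat size_take sl ltn_ord /= /bump.
  case: ltnP => db; first by rewrite nth_take.
  by rewrite nth_drop add1n addSn subnKC.
apply: eq_bigr => j _; congr (_ * _).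
rewrite [LHS]mxE [RHS]mxE; congr (_%:C).
by rewrite -[RHS](col_mxEd v m a j); congr (col_mx _ _ _ _); exact/val_inj.
Qed.

Section Frame.
Variables (nu : 'rV[R]_8).
Hypothesis nu0 : nu 0 0 = 0.

(* The skew endomorphism e^0 (x) nu - nu^flat (x) e_0. *)
Definition boost : 'M[R]_8 :=
  delta_mx 0 0 *m nu - nu^T *m (delta_mx 0 0 : 'rV[R]_8).

Definition nucol : 'cV[C]_8 := cmx nu^T.

Lemma tr_boost : boost^T = - boost.
Proof. by rewrite /boost linearB /= !trmx_mul trmxK !trmx_delta opprB. Qed.

Lemma boost_ecol0 : cmx boost *m ecol R 0 = (-1) *: nucol.
Proof.
rewrite /ecol -colE scaleN1r; apply/matrixP => a o; rewrite ord1 !mxE !big_ord1 !mxE.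
by rewrite nu0 mulr0 add0r mulr1 rmorphN.
Qed.

Lemma boost_ecol (i : 'I_8) : i != 0 -> cmx boost *m ecol R i = (nu 0 i)%:C *: ecol R 0.
Proof.
move=> i0; rewrite /ecol -colE; apply/matrixP => a o.
rewrite ord1 !mxE !big_ord1 !mxE (negbTE i0) mulr0 subr0 rmorphM /= mulrC.
by congr (_ * _); rewrite rmorph_nat.
Qed.

Lemma cmx_ecol (v : 'rV[R]_8) i : (cmx v *m ecol R i) 0 0 = (v 0 i)%:C.
Proof. by rewrite /ecol -colE !mxE. Qed.

Local Notation e0 := (ecol R 0).

Lemma boost_e0 (i j k : 'I_8) m : i != 0 -> j != 0 -> k != 0 ->
  \sum_c dform 4 [:: e0; ecol R i; ecol R j; ecol R k] (replace_row m boost c) =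
  - dform 4 [:: nucol; ecol R i; ecol R j; ecol R k] m.
Proof.
move=> i0 j0 k0; rewrite sum_replace_row !big_ord_recl big_ord0 /=.
rewrite boost_ecol0 !boost_ecol //.
rewrite (@dformZ 4 [::]) // (@dformZ 4 [:: e0]) //.
rewrite (@dformZ 4 [:: e0; ecol R i]) // (@dformZ 4 [:: e0; ecol R i; ecol R j]) //=.
rewrite (@dform_dup _ 4 [:: e0; e0; ecol R j; ecol R k] 0 1) //.
rewrite (@dform_dup _ 4 [:: e0; ecol R i; e0; ecol R k] 0 2%:R) //.
rewrite (@dform_dup _ 4 [:: e0; ecol R i; ecol R j; e0] 0 3%:R) //.
by rewrite !mulr0 !addr0 mulN1r.
Qed.

(** Each replacement puts e^0 into slot [b]. Moving it to the front costs (-1)^b, the sign of the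
    interior product, so this is e^0 wedged with the contraction by [nu]. *)
Lemma boost_e (i j k l : 'I_8) m : i != 0 -> j != 0 -> k != 0 -> l != 0 ->
  \sum_c dform 4 [:: ecol R i; ecol R j; ecol R k; ecol R l] (replace_row m boost c) =
  \sum_(b < 4) (-1) ^+ b * (nu 0 (nth 0 [:: i; j; k; l] b))%:C *
    dform 4 (e0 :: [seq ecol R x | x <- take b [:: i; j; k; l] ++ drop b.+1 [:: i; j; k; l]]) m.
Proof.
move=> i0 j0 k0 l0; rewrite sum_replace_row !big_ord_recl !big_ord0 /=.
rewrite !boost_ecol //.
move: (nu 0 i)%:C (nu 0 j)%:C (nu 0 k)%:C (nu 0 l)%:C => a b c d.
move: (ecol R i) (ecol R j) (ecol R k) (ecol R l) e0 => x y z w e.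
move: (dform 4) (@dformZ 4) (@dform_swap 4) => D DZ Dswap.
rewrite (DZ [::]) // (DZ [:: x]) // (DZ [:: x; y]) // (DZ [:: x; y; z]) //=.
rewrite (Dswap [::] [:: z; w] x e) //=.
rewrite (Dswap [:: x] [:: w] y e) //= (Dswap [::] [:: y; w] x e) //=.
rewrite (Dswap [:: x; y] [::] z e) //= (Dswap [:: x] [:: z] y e) //=.
rewrite (Dswap [::] [:: y; z] x e) //= /bump /=.
move: (D _ m) (D _ m) (D _ m) (D _ m) => p q r s.
by rewrite expr0 expr1; ring.
Qed.

End Frame.

End ReplaceRows.

(** * The standard Spin(7)-form and the elements of Lambda^4_7 *)

Section SpinForm.
Variable R : realType.
Local Notation C := R[i].
Local Open Scope complex_scope.

Definition phi0_terms : seq (C * seq nat) :=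
  [:: (1, [:: 1; 2; 3]%N); (1, [:: 1; 4; 5]%N); (1, [:: 1; 6; 7]%N); (1, [:: 2; 4; 6]%N);
      (-1, [:: 2; 5; 7]%N); (-1, [:: 3; 4; 7]%N); (-1, [:: 3; 5; 6]%N)].

Definition psi0_terms : seq (C * seq nat) :=
  [:: (1, [:: 4; 5; 6; 7]%N); (1, [:: 2; 3; 6; 7]%N); (1, [:: 2; 3; 4; 5]%N);
      (1, [:: 1; 3; 5; 7]%N); (-1, [:: 1; 3; 4; 6]%N); (-1, [:: 1; 2; 5; 6]%N);
      (-1, [:: 1; 2; 4; 7]%N)].

(** The covectors [e] are a parameter because the same expression is read in an adapted basis, in
    the standard basis and in the unitary frame. *)
Definition spin_dform (e : nat -> 'cV[C]_8) : form R 4 := fun m =>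
  \sum_(t <- phi0_terms) t.1 * dform 4 (e 0%N :: map e t.2) m +
  \sum_(t <- psi0_terms) t.1 * dform 4 (map e t.2) m.

Section Pullback.
Variables (E M N : 'M[R]_8).
Hypothesis MN : M *m invmx E = N.

Definition coframe_col (i : nat) : 'cV[C]_8 := col (inord i) (cmx N).

Lemma pullback_emono s m :
  emono E s (m *m M) = dform (size s) (map coframe_col s) m.
Proof.
congr (\det _); apply/matrixP => a b; rewrite !mxE (nth_map 0%N) // /coframe.
rewrite -row_mul -mulmxA MN /coframe_col mxE.
by rewrite [LHS]/= mxE rmorph_sum; apply: eq_bigr => j _; rewrite rmorphM !mxE.
Qed.

Lemma pullback_coframe0 : pullback M (coframe E 0) = dform 1 [:: coframe_col 0].
Proof.
apply/funext => m; rewrite -[RHS](@pullback_emono [:: 0%N] m) /emono det_mx11 mxE.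
by congr (coframe E 0 _); apply/rowP => j; rewrite [RHS]mxE.
Qed.

Lemma pullback_phi0 : pullback M (phi0 E) =
  fun m => \sum_(t <- phi0_terms) t.1 * dform 3 (map coframe_col t.2) m.
Proof.
apply/funext => m.
have P3 i j k : emono E [:: i; j; k] (m *m M) = dform 3 (map coframe_col [:: i; j; k]) m.
  exact: (@pullback_emono [:: i; j; k] m).
rewrite /pullback /phi0 !P3 /phi0_terms !big_cons big_nil /=.
move: (dform 3) => D3; by rewrite !mul1r !mulN1r addr0 !addrA.
Qed.

Lemma pullback_psi0 : pullback M (star7_phi0 E) =
  fun m => \sum_(t <- psi0_terms) t.1 * dform 4 (map coframe_col t.2) m.
Proof.
apply/funext => m.
have P4 i j k l : emono E [:: i; j; k; l] (m *m M) =
    dform 4 (map coframe_col [:: i; j; k; l]) m.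
  exact: (@pullback_emono [:: i; j; k; l] m).
rewrite /pullback /star7_phi0 !P4 /psi0_terms !big_cons big_nil /=.
move: (dform 4) => D4; by rewrite !mul1r !mulN1r addr0 !addrA.
Qed.

Lemma pullback_wedge_phi0 (a : form R 1) x : pullback M a = dform 1 [:: x] ->
  pullback M (wedge a (phi0 E)) =
  fun m => \sum_(t <- phi0_terms) t.1 * dform 4 (x :: map coframe_col t.2) m.
Proof.
move=> aE; rewrite pullback_wedge aE pullback_phi0 wedge_sumr.
by apply/funext => m; apply: eq_bigr => t _; rewrite wedge_dform.
Qed.

Lemma pullback_spin7_form : pullback M (spin7_form E) = spin_dform coframe_col.
Proof.
apply/funext => m; rewrite /spin_dform.
rewrite -[LHS]/(pullback M (wedge (coframe E 0) (phi0 E)) m + pullback M (star7_phi0 E) m).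
by rewrite (pullback_wedge_phi0 pullback_coframe0) pullback_psi0.
Qed.

End Pullback.

Definition std_col (i : nat) : 'cV[C]_8 := ecol R (inord i).

Lemma coframe_col1 : coframe_col 1%:M = std_col.
Proof.
apply/funext => i; apply/matrixP => a o; rewrite /cmx /std_col !mxE !ord1 andbT.
by rewrite rmorph_nat.
Qed.

Section Lambda47.
Variables (G E : 'M[R]_8) (nu : 'rV[R]_8).
Hypothesis EG : E *m G *m E^T = 1%:M.
Hypothesis nu0 : nu 0 0 = 0.

Lemma boost_phi0_term s m : size s = 3 -> all (fun i => 0 < i < 8)%N s ->
  \sum_c dform 4 (std_col 0 :: map std_col s) (replace_row m (boost nu) c) =
  - dform 4 (nucol nu :: map std_col s) m.
Proof.
have n0 i : (0 < i < 8)%N -> inord i != 0 :> 'I_8.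
  by move=> /andP[i0 i8]; rewrite -val_eqE /= inordK // -lt0n.
case: s => [|i [|j [|k []]]] //= _ /and4P[i0 j0 k0 _].
have -> : std_col 0 = ecol R 0 by congr ecol; apply/val_inj; rewrite /= inordK.
by rewrite boost_e0 ?n0.
Qed.

Lemma boost_psi0_term s m : size s = 4 -> all (fun i => 0 < i < 8)%N s ->
  \sum_c dform 4 (map std_col s) (replace_row m (boost nu) c) =
  wedge (dform 1 [:: std_col 0])
    (fun m' : 'M[R]_(3, 8) => dform 4 (map std_col s) (col_mx nu m' : 'M[R]_(1 + 3, 8))) m.
Proof.
have n0 i : (0 < i < 8)%N -> inord i != 0 :> 'I_8.
  by move=> /andP[i0 i8]; rewrite -val_eqE /= inordK // -lt0n.
case: s => [|i [|j [|k [|l []]]]] //= _ /and5P[i0 j0 k0 l0 _].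
rewrite boost_e ?n0 //.
have -> : (fun m' : 'M[R]_(3, 8) => dform 4 [:: std_col i; std_col j; std_col k; std_col l]
    (col_mx nu m' : 'M[R]_(1 + 3, 8))) = fun m' => \sum_(b < 4)
    ((-1) ^+ b * (nu 0 (nth 0 [:: inord i; inord j; inord k; inord l] b))%:C) *
    dform 3 [seq ecol R x | x <- take b [:: inord i; inord j; inord k; inord l] ++
      drop b.+1 [:: inord i; inord j; inord k; inord l]] m'.
  apply/funext => m'.
  apply: etrans (@dform_interior R 3
    (map (ecol R) [:: inord i; inord j; inord k; inord l]) nu m' (erefl _)) _.
  apply: eq_bigr => b _.
  by rewrite (nth_map 0) // cmx_ecol -map_take -map_drop -map_cat.
rewrite wedge_sumr; apply: eq_bigr => b _; congr (_ * _).
rewrite wedge_dform //.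
by have -> : std_col 0 = ecol R 0 by congr ecol; apply/val_inj; rewrite /= inordK.
Qed.

(* The right-hand side is the derivation action of [boost nu] on Phi. *)
Lemma pullback_lambda47 : pullback E (lambda47_elt G E (nu *m E)) =
  fun m => \sum_c spin_dform std_col (replace_row m (boost nu) c).
Proof.
have uE : E \in unitmx by have [] := mulmx1_unit (etrans (mulmxA _ _ _) EG).
have EE : E *m invmx E = 1%:M by rewrite mulmxV.
have flatE : pullback E (fun w : 'M[R]_(1, 8) => (gdot G (nu *m E) w)%:C) =
    dform 1 [:: nucol nu].
  apply/funext => w; rewrite /pullback /gdot /dform det_mx11 [RHS]mxE.
  transitivity (cmx (w *m nu^T) 0 0); last by rewrite cmxM.
  rewrite trmx_mul !mulmxA -(mulmxA nu) -(mulmxA nu) EG mulmx1 [RHS]mxE.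
  by rewrite -[w *m _]trmxK trmx_mul trmxK [in RHS]mxE.
have iprodE : pullback E (iprod (nu *m E) (star7_phi0 E)) = fun m' =>
    \sum_(t <- psi0_terms) t.1 * dform 4 (map std_col t.2) (col_mx nu m' : 'M[R]_(1 + 3, 8)).
  apply/funext => m'.
  have -> : pullback E (iprod (nu *m E) (star7_phi0 E)) m' =
      pullback E (star7_phi0 E) (col_mx nu m' : 'M[R]_(1 + 3, 8)).
    by congr (star7_phi0 E _); apply/esym; apply: (@mul_col_mx _ 1 3 8 8).
  by rewrite (pullback_psi0 EE) coframe_col1.
apply/funext => m; rewrite /lambda47_elt.
rewrite -[LHS]/(pullback E (wedge (coframe E 0) (iprod (nu *m E) (star7_phi0 E))) m -
  pullback E (wedge (fun w : 'M[R]_(1, 8) => (gdot G (nu *m E) w)%:C) (phi0 E)) m).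
rewrite (pullback_wedge_phi0 EE flatE) coframe_col1.
rewrite pullback_wedge iprodE (pullback_coframe0 EE) coframe_col1 wedge_sumr.
rewrite /spin_dform big_split [LHS]addrC; congr (_ + _).
  rewrite exchange_big /= -sumrN big_seq [RHS]big_seq; apply: eq_bigr => t.
  have /allP : all (fun t => (size t.2 == 3) && all (fun i => 0 < i < 8)%N t.2) phi0_terms.
    by [].
  move=> /[apply] /andP[/eqP s3 t8].
  by rewrite -mulrN -boost_phi0_term // big_distrr.
rewrite exchange_big /= big_seq [RHS]big_seq; apply: eq_bigr => t.
have /allP : all (fun t => (size t.2 == 4) && all (fun i => 0 < i < 8)%N t.2) psi0_terms.
  by [].
move=> /[apply] /andP[/eqP s4 t8].
by rewrite -boost_psi0_term // big_distrr.
Qed.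

End Lambda47.
End SpinForm.

(** * The Calabi-Yau form Phi in standard Spin(7) shape *)

Section AdaptedFrame.
Variable R : realType.
Local Notation C := R[i].
Local Open Scope complex_scope.

Local Notation x := (fun j : 'I_4 => ecol R (cx j)).
Local Notation y := (fun j : 'I_4 => ecol R (cy j)).

(** Kept polynomial in [t], so that averaging its values at i and -i cancels the odd powers and
    yields Re Omega. *)
Lemma dform_zcols_expand t m :
  dform 4 (zcols t) m =
  dform 4 [:: x 0; x 1; x 2%:R; x 3%:R] m +
  t * (dform 4 [:: y 0; x 1; x 2%:R; x 3%:R] m + dform 4 [:: x 0; y 1; x 2%:R; x 3%:R] m +
       dform 4 [:: x 0; x 1; y 2%:R; x 3%:R] m + dform 4 [:: x 0; x 1; x 2%:R; y 3%:R] m) +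
  t ^+ 2 * (dform 4 [:: x 0; x 1; y 2%:R; y 3%:R] m + dform 4 [:: x 0; y 1; x 2%:R; y 3%:R] m +
       dform 4 [:: x 0; y 1; y 2%:R; x 3%:R] m + dform 4 [:: y 0; y 1; x 2%:R; x 3%:R] m +
       dform 4 [:: y 0; x 1; y 2%:R; x 3%:R] m + dform 4 [:: y 0; x 1; x 2%:R; y 3%:R] m) +
  t ^+ 3 * (dform 4 [:: x 0; y 1; y 2%:R; y 3%:R] m + dform 4 [:: y 0; x 1; y 2%:R; y 3%:R] m +
       dform 4 [:: y 0; y 1; x 2%:R; y 3%:R] m + dform 4 [:: y 0; y 1; y 2%:R; x 3%:R] m) +
  t ^+ 4 * dform 4 [:: y 0; y 1; y 2%:R; y 3%:R] m.
Proof.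
rewrite /zcols /zcol.
move: (ecol R (cx 0)) (ecol R (cx 1)) (ecol R (cx 2%:R)) (ecol R (cx 3%:R)).
move: (ecol R (cy 0)) (ecol R (cy 1)) (ecol R (cy 2%:R)) (ecol R (cy 3%:R)).
move=> b0 b1 b2 b3 a0 a1 a2 a3.
move: (dform 4) (@dform_lin R 4) => D Dlin.
have L0 l : D ((1 *: a0 + t *: b0) :: l) m = 1 * D (a0 :: l) m + t * D (b0 :: l) m.
  by rewrite (Dlin [::] l).
have L1 u l : D (u :: (1 *: a1 + t *: b1) :: l) m =
    1 * D (u :: a1 :: l) m + t * D (u :: b1 :: l) m.
  by rewrite (Dlin [:: u] l).
have L2 u v l : D [:: u, v, (1 *: a2 + t *: b2) & l] m =
    1 * D [:: u, v, a2 & l] m + t * D [:: u, v, b2 & l] m.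
  by rewrite (Dlin [:: u; v] l).
have L3 u v w l : D [:: u, v, w, (1 *: a3 + t *: b3) & l] m =
    1 * D [:: u, v, w, a3 & l] m + t * D [:: u, v, w, b3 & l] m.
  by rewrite (Dlin [:: u; v; w] l).
rewrite L0 !L1 !L2 !L3; ring.
Qed.

Lemma form_Re_dz4 m : form_Re (@dz4 R) m =
  dform 4 [:: x 0; x 1; x 2%:R; x 3%:R] m -
  (dform 4 [:: x 0; x 1; y 2%:R; y 3%:R] m + dform 4 [:: x 0; y 1; x 2%:R; y 3%:R] m +
   dform 4 [:: x 0; y 1; y 2%:R; x 3%:R] m + dform 4 [:: y 0; y 1; x 2%:R; x 3%:R] m +
   dform 4 [:: y 0; x 1; y 2%:R; x 3%:R] m + dform 4 [:: y 0; x 1; x 2%:R; y 3%:R] m) +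
  dform 4 [:: y 0; y 1; y 2%:R; y 3%:R] m.
Proof.
rewrite /form_Re ReJ_add -[(dz4 m)^*]/(form_conj (@dz4 R) m) conj_dz4_dform dz4_dform.
apply: (canLR (mulfK _)); first by rewrite pnatr_eq0.
rewrite !dform_zcols_expand.
have i4 : 'i%C ^+ 4 = 1 :> C by rewrite (exprM _ 2 2) sqr_i sqrrN expr1n.
have i4' : (- 'i%C) ^+ 4 = 1 :> C by rewrite (exprM _ 2 2) sqrrN sqr_i sqrrN expr1n.
have i3' : (- 'i%C) ^+ 3 = - 'i%C ^+ 3 :> C by ring.
have i2' : (- 'i%C) ^+ 2 = -1 :> C by rewrite sqrrN sqr_i.
rewrite i4 i4' i3' i2' sqr_i.
move: (dform 4) => D; ring.
Qed.

Lemma dform_pair_swap (a b c d : 'cV[C]_8) :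
  dform 4 [:: a; b; c; d] = dform 4 [:: c; d; a; b].
Proof.
move: (dform 4) (@dform_swap R 4) => D Dswap.
apply/funext => m.
rewrite (Dswap [:: a] [:: d] b c) //= (Dswap [::] [:: b; d] a c) //=.
by rewrite (Dswap [:: c; a] [::] b d) //= (Dswap [:: c] [:: b] a d) //= !opprK.
Qed.

Lemma dform_pair_diag (a b : 'cV[C]_8) : dform 4 [:: a; b; a; b] = fun=> 0.
Proof. exact: (@dform_dup _ 4 [:: a; b; a; b] 0 2%:R). Qed.

Lemma half_omega2 m : 2%:R^-1 * wexp (diag2 (fun=> 1 : C)) 2 m =
  dform 4 [:: x 0; y 0; x 1; y 1] m + dform 4 [:: x 0; y 0; x 2%:R; y 2%:R] m +
  dform 4 [:: x 0; y 0; x 3%:R; y 3%:R] m + dform 4 [:: x 1; y 1; x 2%:R; y 2%:R] m +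
  dform 4 [:: x 1; y 1; x 3%:R; y 3%:R] m + dform 4 [:: x 2%:R; y 2%:R; x 3%:R; y 3%:R] m.
Proof.
rewrite wexp_diag2_2.
pose P i j := dform 4 (dxdy R i ++ dxdy R j ++ [::]) m.
have swapP i j : P i j = P j i by rewrite /P /dxdy /= dform_pair_swap.
have diagP i : P i i = 0 by rewrite /P /dxdy /= dform_pair_diag.
rewrite -[RHS]/(P 0 1 + P 0 2%:R + P 0 3%:R + P 1 2%:R + P 1 3%:R + P 2%:R 3%:R).
rewrite -[LHS]/(2%:R^-1 * \sum_i 1 * \sum_j 1 * P i j).
move: P swapP diagP => P swapP diagP.
apply: (canLR (mulKf _)); first by rewrite pnatr_eq0.
rewrite !sum4 !diagP (swapP 1 0) (swapP 2%:R 0) (swapP 2%:R 1).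
by rewrite (swapP 3%:R 0) (swapP 3%:R 1) (swapP 3%:R 2%:R); ring.
Qed.

Definition frame_col (i : nat) : 'cV[C]_8 := ecol R (interleave (inord i)).

Lemma frame_colE i (k : 'I_8) : (i < 8)%N ->
  (if odd i then 4 + i./2 else i./2)%N = k -> frame_col i = ecol R k.
Proof.
move=> i8 ik; congr (ecol R _); apply/val_inj.
by rewrite /= val_interleave inordK.
Qed.

(** With e^0, ..., e^7 read as dx_0, dy_0, ..., dx_3, dy_3, half of omega^2 supplies the six
    monomials made of two pairs and Re Omega the other eight. *)
Lemma spin_frame m :
  2%:R^-1 * wexp (diag2 (fun=> 1 : C)) 2 m + form_Re (@dz4 R) m =
  spin_dform frame_col m.
Proof.
rewrite half_omega2 form_Re_dz4 /spin_dform /phi0_terms /psi0_terms !big_cons !big_nil.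
rewrite ![(_, _).1]/fst ![(_, _).2]/snd ![map _ _]/=.
rewrite (@frame_colE 0 (cx 0)) // (@frame_colE 1 (cy 0)) //.
rewrite (@frame_colE 2 (cx 1)) // (@frame_colE 3 (cy 1)) //.
rewrite (@frame_colE 4 (cx 2%:R)) // (@frame_colE 5 (cy 2%:R)) //.
rewrite (@frame_colE 6 (cx 3%:R)) // (@frame_colE 7 (cy 3%:R)) //.
move: (dform 4) => D; ring.
Qed.

End AdaptedFrame.

Lemma det_zero_row (K : comPzRingType) n (A : 'M[K]_n) i :
  (forall j, A i j = 0) -> \det A = 0.
Proof.
by move=> A0; rewrite (expand_det_row _ i) big1 // => j _; rewrite A0 mul0r.
Qed.

Lemma det_zero_col (K : comPzRingType) n (A : 'M[K]_n) j :
  (forall i, A i j = 0) -> \det A = 0.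
Proof.
by move=> A0; rewrite (expand_det_col _ j) big1 // => i _; rewrite A0 mul0r.
Qed.

Lemma det_proportional_rows (K : fieldType) n (A : 'M[K]_n) i1 i2 c : i1 != i2 ->
  (forall j, A i1 j = c * A i2 j) -> \det A = 0.
Proof.
move=> i12 Ac; apply/eqP/det0P.
exists (delta_mx 0 i1 - c *: delta_mx 0 i2).
  apply/negP => /eqP/rowP/(_ i1); rewrite !mxE !eqxx (negbTE i12) mulr0 subr0.
  by move/eqP; rewrite oner_eq0.
rewrite mulmxBl -scalemxAl -!rowE; apply/rowP => j.
by rewrite !mxE Ac subrr.
Qed.

(** * Vanishing of T.Phi on sums of two complex coordinate lines *)

Section Vanishing.
Variable R : realType.
Local Notation C := R[i].
Local Open Scope complex_scope.

(* The frame vectors x_a, y_a, x_b, y_b. *)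
Definition pair_frame (a b : 'I_4) (r : 'I_4) : 'I_8 :=
  (if odd r then cy else cx) (if (r < 2)%N then a else b).

Lemma cxy_eq (o o' : bool) (i j : 'I_4) :
  ((if o then cy else cx) i == (if o' then cy else cx) j) = (o == o') && (i == j).
Proof.
have xx k l : (cx k == cx l) = (k == l) := inj_eq (@lshift_inj 4 4) k l.
have yy k l : (cy k == cy l) = (k == l) := inj_eq (@rshift_inj 4 4) k l.
have xy k l : (cx k == cy l) = false := eq_lrshift k l.
have yx k l : (cy k == cx l) = false by rewrite eq_sym.
by case: o; case: o'; rewrite ?xx ?yy ?xy ?yx.
Qed.

Lemma pair_frame_inj a b : a != b -> injective (pair_frame a b).
Proof.
move=> ab r s /eqP; rewrite /pair_frame cxy_eq => /andP[/eqP rs].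
case: r s rs => [[|[|[|[|]]]] //= ?] [[|[|[|[|]]]] //= ?] //= _ /eqP E; try exact/val_inj;
  by rewrite E eqxx in ab.
Qed.

Variables (a b : 'I_4) (T : 'M[R]_8).
Hypothesis ab : a != b.
Hypothesis Tskew : T^T = - T.

Lemma skew_diag i : T i i = 0.
Proof.
have /matrixP/(_ i i) := Tskew; rewrite !mxE => /eqP.
by rewrite -addr_eq0 -mulr2n mulrn_eq0 => /eqP.
Qed.

Let m (c : 'I_4) : 'M[R]_(4, 8) := replace_row (rowsub (pair_frame a b) 1%:M) T c.

Lemma replaced_rowE c r j : m c r j =
  if r == c then T (pair_frame a b c) j else (pair_frame a b r == j)%:R.
Proof.
rewrite /m mxE; case: eqP => [->|_]; last by rewrite !mxE.
by rewrite mul_rowsub_mx mul1mx mxE.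
Qed.

(** Let q be the complex line of the replaced vector. If q is [i] or [j], the covector dual to the
    old vector vanishes on all four rows, on the new one because a skew matrix has zero diagonal. If
    not, the untouched partner in q is annihilated by all four covectors. *)
Lemma dform_pairs_replaced c i j :
  dform 4 (dxdy R i ++ dxdy R j ++ [::]) (m c) = 0.
Proof.
have tE (s : 'I_4) : nth 0 (dxdy R i ++ dxdy R j ++ [::]) s = ecol R (pair_frame i j s).
  by case: s => [[|[|[|[|]]]] //= ?].
rewrite (dform_ecol tE); congr (_%:C).
pose q := if (c < 2)%N then a else b.
have tc : pair_frame a b c = (if odd c then cy else cx) q by [].
have zero_col s : pair_frame i j s = pair_frame a b c -> \det (colsub (pair_frame i j) (m c)) = 0.
  move=> sc; apply: (@det_zero_col _ _ _ s) => r.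
  rewrite mxE sc replaced_rowE; case: eqP => [_|rc]; first exact: skew_diag.
  by rewrite (inj_eq (pair_frame_inj ab)); move/eqP/negbTE: rc => ->.
have [qi|qi] := eqVneq q i.
  apply: (zero_col (inord (odd c))).
  by rewrite tc qi /pair_frame inordK ?(leq_trans (ltn_ord c)) //; case: (odd c).
have [qj|qj] := eqVneq q j.
  apply: (zero_col (inord (2 + odd c))).
  by rewrite tc qj /pair_frame inordK; case: (odd c).
(* The position of the partner of the replaced vector: the other element of the same pair. *)
pose p : 'I_4 := inord (if (c < 2)%N then (~~ odd c : nat) else 2 + ~~ odd c)%N.
have pE : p = (if (c < 2)%N then (~~ odd c : nat) else 2 + ~~ odd c)%N :> nat.
  by rewrite inordK //; case: ifP => _; case: (odd c).
have tp : pair_frame a b p = (if ~~ odd c then cy else cx) q.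
  by rewrite /pair_frame pE /q; case: (c < 2)%N; case: (odd c).
have pc : (p == c) = false.
  rewrite -val_eqE /= pE.
  by case: c {q tc zero_col qi qj p pE tp} => [[|[|[|[|]]]] //= ?].
apply: (@det_zero_row _ _ _ p) => s.
rewrite mxE replaced_rowE pc tp cxy_eq.
by case: ifP => _; rewrite ?(negbTE qi) ?(negbTE qj) andbF.
Qed.

(** The pair x, y not containing the replaced vector is intact. As y = J x, its two rows of
    dz-values differ by the factor i. *)
Lemma Re_dz4_replaced c : form_Re (@dz4 R) (m c) = 0.
Proof.
rewrite /form_Re dz4E; suff -> : \det (cmx (m c) *m Zmx R) = 0 by [].
have rowZ r k j : r != c -> pair_frame a b r = k ->
    (cmx (m c) *m Zmx R) r j = Zmx R k j.
  move=> rc rk; rewrite mxE (bigD1 k) //= big1 => [|l lk].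
    by rewrite mxE replaced_rowE (negbTE rc) rk eqxx mul1r addr0.
  by rewrite mxE replaced_rowE (negbTE rc) rk eq_sym (negbTE lk) mul0r.
have Zxy k j : Zmx R (cy k) j = 'i%C * Zmx R (cx k) j.
  rewrite /Zmx (@col_mxEd _ 4 4 4) (@col_mxEu _ 4 4 4) !mxE.
  by case: eqP => _; rewrite ?mulr1n ?mulr0n ?mulr1 ?mulr0.
have [c2|c2] := ltnP c 2.
  apply: (@det_proportional_rows _ _ _ (inord 3) (inord 2) 'i%C).
    by rewrite -val_eqE /= !inordK.
  move=> j; rewrite (rowZ (inord 3) (cy b)) ?(rowZ (inord 2) (cx b)) ?Zxy //.
  - by rewrite -val_eqE /= inordK //; lia.
  - by rewrite /pair_frame inordK.
  - by rewrite -val_eqE /= inordK //; lia.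
  - by rewrite /pair_frame inordK.
apply: (@det_proportional_rows _ _ _ (inord 1) (inord 0) 'i%C).
  by rewrite -val_eqE /= !inordK.
move=> j; rewrite (rowZ (inord 1) (cy a)) ?(rowZ (inord 0) (cx a)) ?Zxy //.
- by rewrite -val_eqE /= inordK //; lia.
- by rewrite /pair_frame inordK.
- by rewrite -val_eqE /= inordK //; lia.
- by rewrite /pair_frame inordK.
Qed.

Lemma spin_replaced c :
  2%:R^-1 * wexp (diag2 (fun=> 1 : C)) 2 (m c) + form_Re (@dz4 R) (m c) = 0.
Proof.
rewrite Re_dz4_replaced addr0 wexp_diag2_2 big1 ?mulr0 // => i _.
by rewrite big1 ?mulr0 // => j _; rewrite mul1r; apply: dform_pairs_replaced.
Qed.

End Vanishing.

Section RealSpinForms.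
Variable R : realType.
Local Notation C := R[i].
Local Open Scope complex_scope.

Lemma complexR_real (r : R) : (r%:C : C) \is Num.real.
Proof. by rewrite realE -[0]/((0 : R)%:C) !lecR -realE num_real. Qed.

Definition spin_terms : seq (C * seq nat) :=
  [seq (t.1, 0%N :: t.2) | t <- phi0_terms R] ++ psi0_terms R.

Lemma spin_dformE e m :
  spin_dform e m = \sum_(t <- spin_terms) t.1 * dform 4 (map e t.2) m.
Proof. by rewrite big_cat big_map. Qed.

Lemma spin_dform_real m : spin_dform (std_col R) m \is Num.real.
Proof.
rewrite spin_dformE big_seq; apply: rpred_sum => t.
have /allP : all (fun t => (size t.2 == 4) && (t.1 \is Num.real)) spin_terms.
  by rewrite /= ?rpredN ?rpred1.
move=> /[apply] /andP[/eqP s4 rt]; apply: rpredM => //.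
rewrite (@dform_ecol _ _ (fun i => inord (nth 0%N t.2 i))) ?complexR_real //.
by move=> i; rewrite (nth_map 0%N) ?s4.
Qed.

Lemma multilinear_spin_replace e (A : 'M[R]_8) :
  multilinear (fun m => \sum_c spin_dform e (replace_row m A c)).
Proof.
have -> : (fun m => \sum_c spin_dform e (replace_row m A c)) =
    fun m => \sum_(t <- spin_terms) t.1 *
      \sum_(b < 4) 1 * dform 4 (set_nth 0 (map e t.2) b
                                  (cmx A *m nth 0 (map e t.2) b)) m.
  apply/funext => m; under eq_bigr => c _ do rewrite spin_dformE.
  rewrite exchange_big; apply: eq_bigr => t _.
  rewrite -mulr_sumr sum_replace_row; congr (_ * _).
  by apply: eq_bigr => b _; rewrite mul1r.
apply: multilinear_sum => t; apply: multilinear_sum => b.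
exact: multilinear_dform.
Qed.

Lemma spin_replace0 e (m : 'M[R]_(4, 8)) c : spin_dform e (replace_row m 0 c) = 0.
Proof.
rewrite spin_dformE big1_seq // => t _; rewrite /dform (@det_zero_row _ _ _ c) ?mulr0 //.
move=> b; rewrite !mxE big1 // => j _.
by rewrite [cmx _ _ _]mxE [replace_row _ _ _ _ _]mxE eqxx mulmx0 mxE rmorph0 mul0r.
Qed.

Lemma row_replace_row k (m : 'M[R]_(k, 8)) A c a :
  row a (replace_row m A c) = if a == c then row a m *m A else row a m.
Proof.
by apply/rowP => j; rewrite -row_mul !mxE; case: eqP => _; rewrite !mxE.
Qed.

(** A change of frame conjugates the endomorphism by the orthogonal [S], which preserves
    skewness. *)
Lemma replace_row_mul k (m : 'M[R]_(k, 8)) (S A : 'M[R]_8) c : S^T *m S = 1%:M ->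
  replace_row (m *m S) A c = replace_row m (S *m A *m S^T) c *m S.
Proof.
move=> SS; apply/row_matrixP => a; rewrite row_mul !row_replace_row row_mul.
by case: eqP => // _; rewrite -!mulmxA SS mulmx1.
Qed.

Section Element.
Variables (G E : 'M[R]_8) (nu : 'rV[R]_8).
Hypothesis EG : E *m G *m E^T = 1%:M.
Hypothesis nu0 : nu 0 0 = 0.
Local Notation w := (lambda47_elt G E (nu *m E)).

Lemma orthonormal_unitmx : E \in unitmx.
Proof. by have [] := mulmx1_unit (etrans (mulmxA _ _ _) EG). Qed.

Lemma lambda47_alternating : alternating w.
Proof.
move=> s m; rewrite /lambda47_elt.
by rewrite -[LHS]/(wedge _ _ _ - wedge _ _ _) !wedge_alternating -mulrBr.
Qed.

Lemma lambda47E m : w m = pullback E w (m *m invmx E).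
Proof. by rewrite /pullback mulmxKV ?orthonormal_unitmx. Qed.

Lemma lambda47_multilinear : multilinear w.
Proof.
have -> : w = pullback (invmx E) (pullback E w) by apply/funext/lambda47E.
by rewrite pullback_lambda47 //; apply/multilinear_pullback/multilinear_spin_replace.
Qed.

Lemma lambda47_real m : w m \is Num.real.
Proof.
rewrite lambda47E pullback_lambda47 //; apply: rpred_sum => c _.
exact: spin_dform_real.
Qed.

End Element.

Lemma lambda47_0 (G E : 'M[R]_8) : E *m G *m E^T = 1%:M -> lambda47_elt G E 0 = 0.
Proof.
move=> EG; have uE := orthonormal_unitmx EG; apply: (pullback_eq (mulmxV uE)).
rewrite -{1}(mul0mx 1 E) pullback_lambda47 ?mxE //.
have -> : boost (0 : 'rV[R]_8) = 0 by rewrite /boost trmx0 mulmx0 mul0mx subrr.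
by apply/funext => m; rewrite big1 // => c _; apply: spin_replace0.
Qed.

End RealSpinForms.

(** * Vanishing of orthogonal projections *)

Section OrthogonalProjection.
Variables (R : realType) (k : nat) (G P : 'M[R]_8) (W : set (form R k)) (b : form R k).
Local Notation C := R[i].
Local Open Scope complex_scope.
Hypothesis PG : P *m G *m P^T = 1%:M.
Hypothesis bM : multilinear b.
Hypothesis W0 : W 0.
Hypothesis WM : forall w, W w -> multilinear w.
Hypothesis Wreal : forall w m, W w -> w m \is Num.real.
Local Notation dot a w :=
  (\sum_(f : {ffun 'I_k -> 'I_8}) a (rowsub f P) * w (rowsub f P)).
Hypothesis bW : forall w, W w -> dot b w = 0.

Lemma multilinear_lin (a1 a2 : form R k) c :
  multilinear a1 -> multilinear a2 -> multilinear (fun m => a1 m + c * a2 m).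
Proof.
move=> M1 M2 m; rewrite M1 M2 mulr_sumr -big_split; apply: eq_bigr => i _.
by rewrite mulrDr; congr (_ + _); apply: mulrCA.
Qed.

Lemma multilinear_eq0 (a : form R k) : multilinear a ->
  (forall f : {ffun 'I_k -> 'I_8}, a (rowsub f P) = 0) -> a = 0.
Proof.
move=> aM aP.
have uP : P \in unitmx by have [] := mulmx1_unit (etrans (mulmxA _ _ _) PG).
apply: (pullback_eq (mulmxV uP)); apply/funext => m.
rewrite (multilinear_pullback P aM) big1 // => f _.
by rewrite /pullback mul_rowsub_mx mul1mx aP mulr0.
Qed.

Lemma is_orth_proj0 : is_orth_proj G W b 0.
Proof.
split; first by exists 0, 0; split=> //; apply/funext => m; rewrite -[RHS]/(0 + 'i * 0) mulr0 addr0.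
move=> w Ww; have -> : b - 0 = b by apply: subr0.
by rewrite (form_dot_frame PG bM (WM Ww)) bW ?mulr0.
Qed.

(* Pairing p = w1 + i w2 with w1 and w2 gives |w1|^2 + |w2|^2 = 0. *)
Lemma orth_proj_eq0 p : is_orth_proj G W b p -> p = 0.
Proof.
move=> [[w1 [w2 [W1 W2 pE]]] orth].
have M1 := WM W1; have M2 := WM W2.
have bpE : b - p = fun m => (b m + (-1) * w1 m) + (- 'i) * w2 m.
  rewrite pE; apply/funext => m; rewrite -[LHS]/(b m - (w1 m + 'i * w2 m)).
  by rewrite mulN1r mulNr opprD addrA.
have proj w : W w -> dot w1 w + 'i * dot w2 w = 0.
  move=> Ww; have := orth w Ww; rewrite bpE.
  rewrite (form_dot_frame PG (multilinear_lin _ (multilinear_lin _ bM M1) M2) (WM Ww)).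
  move/eqP; rewrite mulf_eq0 invr_eq0 pnatr_eq0 eqn0Ngt fact_gt0 /= => /eqP E.
  apply: oppr_inj; rewrite oppr0 -[LHS]add0r -{1}(bW Ww) -[RHS]E.
  rewrite mulr_sumr -big_split -sumrN -big_split; apply: eq_bigr => f _ /=.
  ring.
(* Subtracting i times the pairing with [w2] from the pairing with [w1] cancels the cross terms by
   symmetry. *)
have w12 : dot w1 w1 + dot w2 w2 = 0.
  transitivity ((dot w1 w1 + 'i * dot w2 w1) - 'i * (dot w1 w2 + 'i * dot w2 w2)).
    have -> : dot w2 w1 = dot w1 w2 by apply: eq_bigr => f _; rewrite mulrC.
    rewrite mulrDr mulrA -expr2 sqr_i; ring.
  by rewrite !proj // mulr0 subrr.
(* The pairing is complex bilinear, not Hermitian; its positivity comes from the elements of [W]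
   being real-valued. *)
have ge0 w : W w -> forall f, 0 <= w (rowsub f P) * w (rowsub f P).
  by move=> Ww f; rewrite -expr2 real_exprn_even_ge0 ?Wreal.
move: w12; rewrite -big_split /= => /eqP.
rewrite psumr_eq0 => [/allP w0|f _]; last by rewrite addr_ge0 ?ge0.
have z (f : {ffun 'I_k -> 'I_8}) : (w1 (rowsub f P) == 0) && (w2 (rowsub f P) == 0).
  have := w0 f (mem_index_enum f); rewrite paddr_eq0 ?ge0 //.
  by rewrite !mulf_eq0 !orbb.
have w10 : w1 = 0 by apply: multilinear_eq0 => // f; have /andP[/eqP] := z f.
have w20 : w2 = 0 by apply: multilinear_eq0 => // f; have /andP[_ /eqP] := z f.
rewrite pE w10 w20; apply/funext => m.
by rewrite -[LHS]/(0 + 'i * 0) mulr0 addr0.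
Qed.

(** Since 0 is a projection, the default [b'] is not taken; since it is the only one, the choice is
    determined. *)
Lemma xget_orth_proj b' : xget b' [set p | is_orth_proj G W b p]%classic = 0.
Proof.
apply: xget_subset1; first exact: is_orth_proj0.
by move=> p q /= pp qq; apply: etrans (orth_proj_eq0 pp) (esym (orth_proj_eq0 qq)).
Qed.

End OrthogonalProjection.

Section LambdaSquare.
Variables (R : realType) (G P Q : 'M[R]_8) (l : 'rV[R]_4) (vol : form R 8)
  (Om : form R 4) (F : form R 2).
Local Notation C := R[i].
Local Open Scope complex_scope.
Hypothesis PG : P *m G *m P^T = 1%:M.
Hypothesis PQ : P *m Q = 1%:M.
Hypothesis JP : Jmx R *m P = P *m Jmx R.
Hypothesis volE : forall n, vol n = (\det (n *m Q))%:C.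
Hypothesis OmE : pullback P Om = @dz4 R.
Let u (j : 'I_4) : C := 'i%C * (l 0 j)%:C.
Hypothesis FE : pullback P F = diag2 u.
Let Phi : form R 4 := fun m => 2%:R^-1 * wexp (kahler_form G) 2 m + form_Re Om m.

Lemma pullback_Phi m : Phi (m *m P) =
  2%:R^-1 * wexp (diag2 (fun=> 1 : C)) 2 m + form_Re (@dz4 R) m.
Proof.
rewrite -OmE -(pullback_kahler_form PG JP) -pullback_wexp.
by [].
Qed.

(** Reorders the frame into x_0, y_0, ..., x_3, y_3, the order in which [spin_frame] is stated. The
    permutation is even, so the orientation is kept. *)
Let Iperm : 'M[R]_8 := rowsub interleave 1%:M.
Let Espin : 'M[R]_8 := Iperm *m P.

Lemma Iperm_tr : Iperm *m Iperm^T = 1%:M.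
Proof.
rewrite mul_rowsub_mx mul1mx; apply/matrixP => i j.
by rewrite !mxE eq_sym (inj_eq interleave_inj).
Qed.

Lemma Espin_orthonormal : Espin *m G *m Espin^T = 1%:M.
Proof.
rewrite /Espin trmx_mul -!mulmxA (mulmxA P) (mulmxA _ P^T) PG mul1mx.
exact: Iperm_tr.
Qed.

Lemma Espin_adapted : adapted G vol Phi Espin.
Proof.
split; first exact: Espin_orthonormal.
  rewrite volE -mulmxA PQ mulmx1 -det_tr.
  have -> : Iperm^T = colsub interleave 1%:M.
    by apply/matrixP => i j; rewrite !mxE eq_sym.
  by rewrite det_interleave ltr01.
apply: (pullback_eq PQ).
have PE : P *m invmx Espin = Iperm^T.
  have uE := orthonormal_unitmx Espin_orthonormal.
  by rewrite -[P]mul1mx -(mulmx1C Iperm_tr) -[_ *m P]mulmxA mulmxK.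
rewrite (pullback_spin7_form PE); apply/funext => m.
rewrite /pullback pullback_Phi spin_frame; congr (spin_dform _ m).
apply/funext => i; apply/matrixP => a o.
by rewrite /frame_col /coframe_col !mxE ord1 andbT eq_sym rmorph_nat.
Qed.

Lemma Lambda47P w : Lambda47 G vol Phi w ->
  exists E (nu : 'rV[R]_8), [/\ E *m G *m E^T = 1%:M, nu 0 0 = 0, Phi = spin7_form E
                 & w = lambda47_elt G E (nu *m E)].
Proof.
move=> [E [v [[EG _ PE] v0 ->]]]; exists E, (v *m invmx E); split=> //.
  have i0 : (0 : 'I_8) = inord 0 by apply/val_inj; rewrite /= inordK.
  by rewrite i0; move: v0 => [].
by rewrite mulmxKV ?(orthonormal_unitmx EG).
Qed.

(* In the frame P the action of [boost nu] is that of a skew matrix. *)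
Lemma lambda47_pair_frame E (nu : 'rV[R]_8) a b : E *m G *m E^T = 1%:M -> nu 0 0 = 0 ->
  Phi = spin7_form E -> a != b ->
  lambda47_elt G E (nu *m E) (rowsub (pair_frame a b) P) = 0.
Proof.
move=> EG nu0 PhiE ab; have uE := orthonormal_unitmx EG.
have [S SE] : exists S, S *m E = P by exists (P *m invmx E); rewrite mulmxKV.
have SS : S^T *m S = 1%:M.
  apply: mulmx1C; rewrite -PG -SE trmx_mul -!mulmxA.
  by rewrite (mulmxA E) (mulmxA _ E^T) EG mul1mx.
have -> : rowsub (pair_frame a b) P = rowsub (pair_frame a b) 1%:M *m S *m E.
  by rewrite -mulmxA SE mul_rowsub_mx mul1mx.
rewrite -[LHS]/(pullback E _ _) pullback_lambda47 // big1 // => c _.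
rewrite (replace_row_mul _ _ _ SS) -coframe_col1.
rewrite -(pullback_spin7_form (mulmxV uE)) /pullback -PhiE -mulmxA SE pullback_Phi.
by apply: spin_replaced ab _ _; rewrite !trmx_mul trmxK tr_boost mulNmx mulmxN mulmxA.
Qed.

Lemma F_squared_multilinear : multilinear (wexp F 2 : form R 4).
Proof.
have -> : wexp F 2 = pullback Q (fun m : 'M[R]_(4, 8) => \sum_i u i *
    \sum_j u j * dform 4 (dxdy R i ++ dxdy R j ++ [::]) m).
  by rewrite -[LHS](pullbackK PQ) pullback_wexp FE wexp_diag2_2.
apply: (@multilinear_pullback R 4).
apply: (@multilinear_sum R 4 _ _ _ u) => i.
by apply: (@multilinear_sum R 4 _ _ _ u) => j; apply: multilinear_dform.
Qed.

(** Contraction with the monomial of pairs i and j evaluates the other form on x_i, y_i, x_j, y_j.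
    For i = j the monomial is zero, otherwise [lambda47_pair_frame] applies. *)
Lemma F_squared_orth w : Lambda47 G vol Phi w ->
  \sum_(f : {ffun 'I_4 -> 'I_8}) wexp F 2 (rowsub f P) * w (rowsub f P) = 0.
Proof.
move=> /Lambda47P[E [nu [EG nu0 PhiE ->]]]; set w' := lambda47_elt _ _ _.
have FP (f : {ffun 'I_4 -> 'I_8}) : wexp F 2 (rowsub f P) =
    \sum_i \sum_j u i * u j * dform 4 (dxdy R i ++ dxdy R j ++ [::]) (rowsub f 1%:M).
  transitivity (pullback P (wexp F 2) (rowsub f 1%:M)).
    by rewrite /pullback mul_rowsub_mx mul1mx.
  rewrite pullback_wexp FE wexp_diag2_2; apply: eq_bigr => i _.
  by rewrite mulr_sumr; apply: eq_bigr => j _; apply: mulrA.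
under eq_bigr => f _ do rewrite FP mulr_suml.
rewrite exchange_big big1 // => i _.
under eq_bigr => f _ do rewrite mulr_suml.
rewrite exchange_big big1 // => j _.
under eq_bigr => f _ do rewrite -mulrA.
rewrite -mulr_sumr.
have [<-|ij] := eqVneq i j.
  by rewrite big1 ?mulr0 // => f _; rewrite /dxdy /= dform_pair_diag mul0r.
have tE (s : 'I_4) : nth 0 (dxdy R i ++ dxdy R j ++ [::]) s = ecol R (pair_frame i j s).
  by case: s => [[|[|[|[|]]]] //= ?].
have := contraction_dform P tE (@lambda47_alternating R G E nu).
rewrite lambda47_pair_frame // => /eqP; rewrite mulf_eq0 invr_eq0 pnatr_eq0 eqn0Ngt fact_gt0.
move=> /eqP dot0.
by rewrite /w' dot0 mulr0.
Qed.

Lemma pi47_F_squared : pi47 G vol Phi (wexp F 2) = 0.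
Proof.
(* Even membership of 0 requires some adapted basis, which [Espin] supplies. *)
have W0 : Lambda47 G vol Phi 0.
  exists Espin, 0; split; [exact: Espin_adapted| |by rewrite lambda47_0 ?Espin_orthonormal].
  by rewrite /coframe mul0mx mxE.
apply: (xget_orth_proj PG F_squared_multilinear W0 _ _ F_squared_orth).
- by move=> w /Lambda47P[E [nu [EG nu0 _ ->]]]; apply: lambda47_multilinear.
- by move=> w m /Lambda47P[E [nu [EG nu0 _ ->]]]; apply: lambda47_real.
Qed.

End LambdaSquare.

Lemma wedgeZ (R : realType) p q (c d : R[i]) (a : form R p) (b : form R q) m :
  wedge (fun m => c * a m) (fun m => d * b m) m = c * d * wedge a b m.
Proof.
rewrite /wedge [RHS]mulrCA; congr (_ * _); rewrite mulr_sumr; apply: eq_bigr => s _.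
by rewrite [RHS]mulrCA; congr (_ * _); apply: mulrACA.
Qed.

Section CurvatureFrame.
Variables (R : realType) (X : calabi_yau4 R) (L : line_bundle X)
  (h : hermitian_metric L) (D : connection L) (hD : hermitian_connection h D)
  (hF : forall x, part02 (curvature D x) = 0).
Local Open Scope complex_scope.

Lemma curvature_frame (x : X) : exists P Q (l : 'rV[R]_4),
  [/\ P *m cy_metric x *m P^T = 1%:M, P *m Q = 1%:M,
      Jmx R *m P = P *m Jmx R,
      forall n, cy_vol x n = (\det (n *m Q))%:C
    & pullback P (cy_Omega x) = @dz4 R /\
      pullback P (curvature D x) = diag2 (fun j => 'i * (l 0 j)%:C)].
Proof.
have [B Bskew FE] := curvature_skew hD x.
have /part02_eq0_comm JB : part02 (fun m : 'M[R]_(2, 8) =>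
    'i * ((row 0 m *m B *m (row 1 m)^T) 0 0)%:C) = 0 by rewrite -FE.
have [f f0 OmE] := cy_OmegaE x.
have [P [l [r [PG JP PB r0 Pf]]]] :=
  unitary_frame (cy_metric_sym x) (@cy_metric_pos R X x) (cy_metric_comm x) Bskew JB f0.
have uP : P \in unitmx by have [] := mulmx1_unit (etrans (mulmxA _ _ _) PG).
have volP n : cy_vol x (n *m P) = (\det n)%:C.
  rewrite /cy_vol /kahler_vol -[wexp _ _ _]/(pullback P (wexp (kahler_form (cy_metric x)) 4) (n : 'M[R]_(4 * 2, 8))).
  rewrite pullback_wexp (pullback_kahler_form PG JP) wexp_diag2_4.
  by rewrite big1_eq mulr1 mulrA mulVf ?mul1r // pnatr_eq0.
have OmP : pullback P (cy_Omega x) = fun m => r * dz4 m.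
  by rewrite OmE; apply/funext => m; apply: Pf.
(* Comparing the normalization of Omega with [dz4_wedge_conj] on the frame gives r times its
   conjugate equal to 1, and [r] is positive. *)
have r1 : r = 1.
  have := congr1 (fun a : form R 8 => a (1%:M *m P)) (cy_normalized x).
  rewrite -/(cy_vol x) volP det1.
  rewrite -[wedge _ _ _]/(pullback P (wedge _ _) (1%:M : 'M[R]_(4 + 4))) pullback_wedge OmP.
  have -> : pullback P (form_conj (cy_Omega x)) = fun m => conjc r * form_conj (@dz4 R) m.
    by rewrite -[LHS]/(form_conj (pullback P (cy_Omega x))) OmP; apply/funext => m; apply: rmorphM.
  rewrite wedgeZ dz4_wedge_conj det1 mulr1 mulrCA mulVf ?pnatr_eq0 // mulr1.
  have -> : conjc r = r by apply/conj_Creal; rewrite gtr0_real.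
  rewrite -expr2 => /esym/eqP; rewrite sqrf_eq1 => /orP[/eqP//|/eqP rN].
  by move: r0; rewrite rN oppr_gt0 ltr10.
exists P, (invmx P), l; split=> //; first exact: mulmxV.
  by move=> n; rewrite -volP mulmxKV.
split; first by rewrite OmP r1; apply/funext => m; rewrite mul1r.
rewrite FE; apply/funext => m; rewrite /pullback !row_mul.
transitivity ('i * ((row 0 m *m (P *m B *m P^T) *m (row 1 m)^T) 0 0)%:C).
  by rewrite trmx_mul !mulmxA.
rewrite PB.
have /(congr1 (fun a => a m)) -> := skew_block_diag2 l.
by rewrite /diag2 mulr_sumr; apply: eq_bigr => j _; apply: mulrA.
Qed.

Lemma F2_spin7_eq0 x : F2_spin7 D x = 0.
Proof.
have [P [Q [l [PG PQ JP volE [OmE FE]]]]] := curvature_frame x.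
exact: (pi47_F_squared PG PQ JP volE OmE FE).
Qed.

Lemma F1_spin7_eq0_iff x :
  (forall m, complex.Im (wexp (cy_omega x + curvature D x) 4 m) = 0) <->
  F1_spin7 D x = 0.
Proof.
have [P [Q [l [PG PQ JP volE [OmE FE]]]]] := curvature_frame x.
exact: (pi27_eq0_iff_wexp4 PG PQ JP volE OmE FE).
Qed.

End CurvatureFrame.

Theorem lemma7p2 (R : realType) (X : calabi_yau4 R) (L : line_bundle X)
    (h : hermitian_metric L) (D : connection L) (hD : hermitian_connection h D)
    (hF : forall x, part02 (curvature D x) = 0) :
  (forall x, F2_spin7 D x = 0) /\
  (dHYM D <-> spin7_dDT D) /\
  (spin7_dDT D <-> forall x, F1_spin7 D x = 0).
Proof.
have F2 x := F2_spin7_eq0 hD hF x.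
have F1 x := F1_spin7_eq0_iff hD hF x.
split=> //; split; last by split=> [[]|].
split=> [dD|[D1 _]]; first by split=> // x; apply/F1/dD.
by move=> x; apply/F1/D1.
Qed.
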